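(* The minimisers of $F^0$ are exactly the sets of the form $E=E_0\times(0,1)$, where $E_0\subset\omega$ is any measurable subset which satisfies $$\{\overline\sigma<\lambda^*g\}\subset E_0\subset\{\overline\sigma\le\lambda^*g\},\qquad \int_{E_0}g(x)\,dx=a ,$$ where $\overline\sigma:=\sigma_0+\sigma_1$ and $\lambda^*$ is the supremum of all $\lambda\in\mathbf R$ such that $$\int_{\{\overline\sigma<\lambda g\}}g(x)\,dx<a .$$
   Context: Setting. Let $d\ge 1$ and let $\omega\subset\mathbf R^d$ be a bounded open set (or, with periodic conditions, $\omega=\mathbf T^d=\mathbf R^d/\mathbf Z^d$, in which case $\mathbf R^d$ below is replaced by $\mathbf T^d$). Let $h_0,h_1\in W^{1,\infty}(\omega)$ with $\int_\omega h_j\,dx=0$, let $z>0$, and assume the gap $g(x):=z+h_1(x)-h_0(x)$ satisfies $g>0$. Let $\sigma_0,\sigma_1\in L^\infty(\omega)$ be continuous with $\|\sigma_j\|_{L^\infty}<1$, and let $a\in(0,z|\omega|)$. Put $\Omega:=\omega\times(0,1)$, with points $(x,t)$. The functional $F^0$ is $$F^0(E):=|\mu_E|(\Omega)+\int_{\partial\Omega}\sigma\,d\mu_E,\qquad \sigma(x,t):=(t-1)\sigma_0(x)+t\sigma_1(x),$$ where $\mu_E$ is the Radon measure characterised by $\int_E\frac{\partial\varphi}{\partial t}\,dx\,dt=\int_{\mathbf R^d\times\mathbf R}\varphi\,d\mu_E$ for all $\varphi\in C_0^\infty(\mathbf R^d\times\mathbf R)$. Its domain consists of all measurable $E\subset\Omega$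 with $\sup\{\int_E\frac{\partial\varphi}{\partial t}\,dx\,dt:\varphi\in C_0^\infty(\mathbf R^{d+1}),|\varphi|\le1\}<\infty$ and $\int_E g(x)\,dx\,dt=a$; otherwise $F^0(E)=+\infty$. Sets, and inclusions and equalities between sets, are understood up to Lebesgue-null sets. *)

(* Defs.v *)
From HB Require Import structures.
From mathcomp Require Import all_boot all_order all_algebra.
From mathcomp Require Import all_classical all_reals all_analysis.

Set Implicit Arguments.
Unset Strict Implicit.
Unset Printing Implicit Defensive.

Import Order.TTheory GRing.Theory Num.Theory.
Import numFieldNormedType.Exports.
Local Open Scope classical_set_scope.
Local Open Scope ring_scope.

Definition rowvec_display : measure_display.
Proof. exact default_measure_display. Qed.

Section rowvec_measurable.
Context {R : realType} (n : nat).

Definition rowvec_coord (i : 'I_n) (x : 'rV[R]_n) : R := x ord0 i.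

Let rowvec_set0 : g_sigma_preimage rowvec_coord set0.
Proof. exact: sigma_algebra0. Qed.

Let rowvec_setC A : g_sigma_preimage rowvec_coord A ->
  g_sigma_preimage rowvec_coord (~` A).
Proof. exact: sigma_algebraC. Qed.

Let rowvec_bigcup (F : (set 'rV[R]_n)^nat) :
  (forall i, g_sigma_preimage rowvec_coord (F i)) ->
  g_sigma_preimage rowvec_coord (\bigcup_i (F i)).
Proof. exact: sigma_algebra_bigcup. Qed.

(* The sigma-algebra generated by the coordinates is the Borel one, since
   R^n is a finite product of second countable spaces. *)
HB.instance Definition _ := @isMeasurable.Build rowvec_display
  'rV[R]_n (g_sigma_preimage rowvec_coord) rowvec_set0 rowvec_setC
  rowvec_bigcup.

End rowvec_measurable.

Section rowvec_measurability.
Context {R : realType} (n : nat).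

Lemma measurable_rowvec_coord (i : 'I_n) :
  measurable_fun [set: 'rV[R]_n] (rowvec_coord i).
Proof.
move=> _ Y mY; rewrite setTI; apply: sub_sigma_algebra => /=.
rewrite -bigcup_seq/=; exists i => /=; first by rewrite mem_index_enum.
by exists Y => //; rewrite setTI.
Qed.

Lemma measurable_fun_rowvecP d (T : measurableType d) (f : T -> 'rV[R]_n) :
  (forall i, measurable_fun [set: T] (rowvec_coord i \o f)) ->
  measurable_fun [set: T] f.
Proof.
move=> mf.
have H : g_sigma_preimage (fun i => rowvec_coord i \o f) `<=` measurable.
  apply: smallest_sub; first exact: sigma_algebra_measurable.
  case: n => [|k] in f mf *; first by rewrite big_ord0.
  rewrite -bigcup_mkord_ord; apply: bigcup_sub => i Ii.
  by move=> A [B mB <-]; exact: mf.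
move=> _ A mA; rewrite setTI; apply: H.
by rewrite g_sigma_preimage_comp; exists A => //; rewrite setTI.
Qed.

End rowvec_measurability.

Section rowvec_cons.
Context {R : realType} (n : nat).

Definition rowvec_cons (p : measurableTypeR R * 'rV[R]_n) : 'rV[R]_n.+1 :=
  row_mx (p.1 : R)%:M p.2.

Definition rowvec_uncons (x : 'rV[R]_n.+1) : measurableTypeR R * 'rV[R]_n :=
  (x ord0 ord0, \row_i x ord0 (lift ord0 i)).

Lemma rowvec_consK : cancel rowvec_cons rowvec_uncons.
Proof.
move=> [a v]; congr pair => /=.
  by rewrite mxE; case: splitP => // j _; rewrite (ord1 j) mxE eqxx mulr1n.
apply/rowP => i; rewrite mxE.
rewrite -[RHS](row_mxEr (a : R)%:M v); congr (_ _ _).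
exact/val_inj.
Qed.

Lemma measurable_rowvec_cons : measurable_fun setT rowvec_cons.
Proof.
apply: measurable_fun_rowvecP => i.
have [->|[j ->]] : i = ord0 \/ exists j : 'I_n, i = lift ord0 j.
- by case: (unliftP ord0 i) => [j ->|->]; [right; exists j|left].
- rewrite (_ : _ \o _ = fst); first exact: measurable_fst.
  by apply/funext => p; rewrite -[RHS]/(fst p) -[in RHS](rowvec_consK p).
- rewrite (_ : _ \o _ = rowvec_coord j \o snd).
    by apply: measurableT_comp; [exact: measurable_rowvec_coord|].
  apply/funext => p; rewrite -[in RHS](rowvec_consK p) /=.
  by rewrite /rowvec_coord mxE.
Qed.

Lemma measurable_rowvec_uncons : measurable_fun setT rowvec_uncons.
Proof.
apply: measurable_fun_pair; first exact: (measurable_rowvec_coord ord0).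
apply: measurable_fun_rowvecP => i.
rewrite (_ : _ \o _ = rowvec_coord (lift ord0 i)).
  exact: measurable_rowvec_coord.
by apply/funext => x; rewrite /= /rowvec_coord mxE.
Qed.

End rowvec_cons.

Section lebesgue_rV_step.
Context {R : realType} (n : nat).
Variable m : {sigma_finite_measure set 'rV[R]_n -> \bar R}.
Local Open Scope ereal_scope.

Definition lebesgue_rV_step : set 'rV[R]_n.+1 -> \bar R :=
  pushforward (lebesgue_measure \x m) (@rowvec_cons R n).

Let step0 : lebesgue_rV_step set0 = 0.
Proof. by rewrite /lebesgue_rV_step /pushforward preimage_set0 measure0. Qed.

Let step_ge0 A : 0 <= lebesgue_rV_step A.
Proof. by rewrite /lebesgue_rV_step /pushforward measure_ge0. Qed.

Let step_sigma_additive : semi_sigma_additive lebesgue_rV_step.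
Proof.
move=> F mF tF mUF; rewrite /lebesgue_rV_step /pushforward preimage_bigcup.
apply: measure_semi_sigma_additive.
- by move=> k; rewrite -[X in measurable X]setTI; exact: measurable_rowvec_cons.
- apply/trivIsetP => /= i j _ _ ij; rewrite -preimage_setI.
  by move/trivIsetP : tF => /(_ _ _ _ _ ij) ->//; rewrite preimage_set0.
- rewrite -preimage_bigcup -[X in measurable X]setTI.
  exact: measurable_rowvec_cons.
Qed.

HB.instance Definition _ := isMeasure.Build _ _ _ lebesgue_rV_step
  step0 step_ge0 step_sigma_additive.

Let step_sigma_finite : sigma_finite setT lebesgue_rV_step.
Proof.
have [F FT mF] : sigma_finite setT (lebesgue_measure \x m).
  have /sigma_finiteP[F [TF ndF Foo]] := sigma_finiteT (@lebesgue_measure R).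
  have /sigma_finiteP[G [TG ndG Goo]] := sigma_finiteT m.
  exists (fun k => F k `*` G k).
    rewrite -setXTT TF TG predeqE => -[x y]; split.
      move=> [/= [k _ Fkx] [l _ Gly]]; exists (maxn k l) => //; split.
      - by move: x Fkx; exact/subsetPset/ndF/leq_maxl.
      - by move: y Gly; exact/subsetPset/ndG/leq_maxr.
    by move=> [k _ []/= ? ?]; split; exists k.
  move=> k; have [? ?] := Foo k; have [? ?] := Goo k.
  split; first exact: measurableX.
  by rewrite product_measure1E// lte_mul_pinfty// ge0_fin_numE.
exists (fun k => @rowvec_uncons R n @^-1` F k).
  by rewrite -preimage_bigcup -FT preimage_setT.
move=> k; have [mFk Fkoo] := mF k; split.
  by rewrite -[X in measurable X]setTI; exact: measurable_rowvec_uncons.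
rewrite /lebesgue_rV_step /pushforward -comp_preimage.
rewrite (_ : _ @^-1` _ = F k)//.
by apply/funext => p; rewrite /preimage/= rowvec_consK.
Qed.

HB.instance Definition _ := Measure_isSigmaFinite.Build _ _ _ lebesgue_rV_step
  step_sigma_finite.

End lebesgue_rV_step.

Fixpoint lebesgue_rV (R : realType) (n : nat) :
    {sigma_finite_measure set 'rV[R]_n -> \bar R} :=
  match n with
  | 0 => [the {sigma_finite_measure set 'rV[R]_0 -> \bar R} of
           \d_(0 : 'rV[R]_0)]
  | k.+1 => [the {sigma_finite_measure set 'rV[R]_k.+1 -> \bar R} of
              lebesgue_rV_step (lebesgue_rV R k)]
  end.

Lemma lebesgue_rV_box (R : realType) (n : nat) (A : 'I_n -> set R) :
  (forall i, measurable (A i)) ->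
  lebesgue_rV R n [set x | forall i, A i (x ord0 i)] =
  (\prod_(i < n) lebesgue_measure (A i))%E.
Proof.
elim: n A => [|n IH] A mA.
  by rewrite big_ord0 /= diracE mem_set// => -[].
rewrite big_ord_recl /= /lebesgue_rV_step /pushforward.
pose B : set 'rV[R]_n := [set x | forall i, A (lift ord0 i) (x ord0 i)].
have mB : measurable B.
  rewrite (_ : B =
      \big[setI/setT]_(i < n) (rowvec_coord i @^-1` A (lift ord0 i))).
    apply: bigsetI_measurable => i _; rewrite -[X in measurable X]setTI.
    exact: measurable_rowvec_coord.
  rewrite -bigcap_seq; apply/seteqP; split => x /= Hx i.
    by move=> _; exact: Hx.
  by apply: (Hx i); rewrite /= mem_index_enum.
have consE a v j :
    rowvec_cons (a, v) ord0 (lift ord0 j) = v ord0 j :> R.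
  rewrite -[in RHS]/((a, v).2) -[in RHS](rowvec_consK (a, v)).
  by rewrite [RHS]mxE.
have cons0 a v : rowvec_cons (a, v) ord0 ord0 = a :> R.
  by rewrite -[RHS]/((a, v).1) -[in RHS](rowvec_consK (a, v)).
rewrite (_ : _ @^-1` _ = A ord0 `*` B).
  rewrite product_measure1E//; last exact: mA.
  by congr (_ * _)%E; rewrite -IH// => i; exact: mA.
apply/seteqP; split => -[a v] /=.
- move=> H; split; first by have := H ord0; rewrite cons0.
  by move=> i; have := H (lift ord0 i); rewrite consE.
- move=> [H0 H] i; case: (unliftP ord0 i) => [j ->|->].
    by rewrite consE; exact: H.
  by rewrite cons0.
Qed.

(* The base is either an open set of R^d or the torus R^d / Z^d.  Functions on
   the torus are represented by Z^d-periodic functions on R^d, its Borel sets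
   and its measures by those of the fundamental cell [0, 1)^d. *)
Variant base (R : realType) (d : nat) : Type :=
| OpenBase of set 'rV[R]_d
| TorusBase.
Arguments TorusBase {R d}.

Notation spacetime R d := ('rV[R]_d * measurableTypeR R)%type.

Section setting.
Context {R : realType} {d : nat}.
Implicit Types (w : base R d) (f g h : 'rV[R]_d -> R).

Local Notation leb := (lebesgue_rV R d).

Definition vol : {measure set (spacetime R d) -> \bar R} :=
  [the {measure set (spacetime R d) -> \bar R} of (leb \x lebesgue_measure)%E].

Definition ae_subset (dp : measure_display) (T : measurableType dp)
    (mu : {measure set T -> \bar R}) (A B : set T) : Prop :=
  mu.-negligible (A `\` B).

Definition ae_eqset (dp : measure_display) (T : measurableType dp)
    (mu : {measure set T -> \bar R}) (A B : set T) : Prop :=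
  ae_subset mu A B /\ ae_subset mu B A.

Definition carrier w : set 'rV[R]_d :=
  match w with
  | OpenBase om => om
  | TorusBase => [set x | forall i, 0 <= x ord0 i < 1]
  end.

Definition wf_base w : Prop :=
  match w with
  | OpenBase om => open om /\ bounded_set om
  | TorusBase => True
  end.

Definition periodic f : Prop :=
  forall (k : 'rV[int]_d) (x : 'rV[R]_d), f (x + map_mx intr k) = f x.

Definition function_on w f : Prop :=
  match w with
  | OpenBase _ => True
  | TorusBase => periodic f
  end.

Definition continuous_on w f : Prop :=
  match w with
  | OpenBase om => {within om, continuous f}
  | TorusBase => continuous f
  end.

Definition smooth (V : normedModType R) (phi : V -> R) : Prop :=
  forall (s : seq V) (x : V),
    differentiable (foldr (fun v psi => 'D_v psi) phi s) x.

Definition tsupport (V : normedModType R) (phi : V -> R) : set V :=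
  closure [set x | phi x != 0].

Definition base_test w (phi : 'rV[R]_d -> R) : Prop :=
  smooth phi /\
  match w with
  | OpenBase om => compact (tsupport phi) /\ tsupport phi `<=` om
  | TorusBase => periodic phi
  end.

(* C_0^oo(R^d * R), resp. C_0^oo(T^d * R); as the torus is compact, compact
   support in T^d * R only bounds the vertical variable. *)
Definition cyl_test w (phi : 'rV[R]_d * R -> R) : Prop :=
  smooth phi /\
  match w with
  | OpenBase _ => compact (tsupport phi)
  | TorusBase =>
      (forall t, periodic (fun x => phi (x, t))) /\
      exists M : R, forall x t, M < `|t| -> phi (x, t) = 0
  end.

Definition Linfty_norm w f : \bar R :=
  ('N[leb]_(+oo%E) [EFin \o patch (fun=> 0%R) (carrier w) f])%E.

Definition Linfty w f : Prop :=
  [/\ function_on w f, measurable_fun (carrier w) f &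
      (Linfty_norm w f < +oo)%E].

Definition weak_partial w (i : 'I_d) h k : Prop :=
  forall phi, base_test w phi ->
    \int[leb]_(x in carrier w) (h x * 'D_(delta_mx ord0 i) phi x) =
    - \int[leb]_(x in carrier w) (k x * phi x).

Definition W1infty w h : Prop :=
  Linfty w h /\ forall i, exists2 k, Linfty w k & weak_partial w i h k.

Definition cylinder w : set (spacetime R d) := carrier w `*` `]0%R, 1%R[%classic.

Definition cyl_boundary w : set (spacetime R d) :=
  match w with
  | OpenBase om =>
      let Om : set ('rV[R]_d * R) := om `*` `]0%R, 1%R[%classic in
      closure Om `\` interior Om
  | TorusBase => carrier w `*` [set 0; 1]
  end.

Definition partial_t (phi : 'rV[R]_d * R -> R) : 'rV[R]_d * R -> R :=
  'D_((0, 1) : 'rV[R]_d * R) phi.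

Definition unit_test w : set ('rV[R]_d * R -> R) :=
  [set phi | cyl_test w phi /\ forall p, `|phi p| <= 1].

Definition bounded_tvar w (E : set (spacetime R d)) : Prop :=
  (ereal_sup [set (\int[vol]_(p in E) partial_t phi p)%R%:E | phi in unit_test w]
   < +oo)%E.

Definition hahn_posset (nu : {charge set (spacetime R d) -> \bar R}) :
    set (spacetime R d) := sval (cid (Hahn_decomposition nu)).

Definition hahn_negset (nu : {charge set (spacetime R d) -> \bar R}) :
    set (spacetime R d) := sval (cid (svalP (cid (Hahn_decomposition nu)))).

Definition hahn_setsP (nu : {charge set (spacetime R d) -> \bar R}) :
    hahn_decomposition nu (hahn_posset nu) (hahn_negset nu) :=
  svalP (cid (svalP (cid (Hahn_decomposition nu)))).

Definition charge_abs (nu : {charge set (spacetime R d) -> \bar R})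
    (A : set (spacetime R d)) : \bar R := charge_variation (hahn_setsP nu) A.

Definition charge_integral (nu : {charge set (spacetime R d) -> \bar R})
    (A : set (spacetime R d)) (f : spacetime R d -> R) : R :=
  (\int[jordan_pos (hahn_setsP nu)]_(p in A) f p) -
  (\int[jordan_neg (hahn_setsP nu)]_(p in A) f p).

(* A finite signed Borel measure on T^d * R is a charge concentrated on
   [0, 1)^d * R. *)
Definition is_tderiv w (E : set (spacetime R d))
    (nu : {charge set (spacetime R d) -> \bar R}) : Prop :=
  match w with
  | OpenBase _ => True
  | TorusBase => forall A, measurable A -> A `&` (carrier w `*` setT) = set0 ->
                   nu A = 0%E
  end /\
  forall phi, cyl_test w phi ->
    \int[vol]_(p in E) partial_t phi p = charge_integral nu setT phi.

(* The measure mu_E.  It exists for every E such that [bounded_tvar w E], by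
   the Riesz representation theorem, so that [None] is never reached in the
   definition of F0 below. *)
Definition tderiv w (E : set (spacetime R d)) :
    option (charge (spacetime R d) R) :=
  if pselect (exists nu, is_tderiv w E nu) is left ex
  then Some (sval (cid ex)) else None.

Definition gap (z : R) (h0 h1 : 'rV[R]_d -> R) (x : 'rV[R]_d) : R :=
  z + h1 x - h0 x.

(* sigma_0 and sigma_1 are only given on the base; |mu_E| does not charge the
   lateral boundary, where sigma is set to 0. *)
Definition wetting w (sigma0 sigma1 : 'rV[R]_d -> R) : spacetime R d -> R :=
  patch (fun=> 0) (carrier w `*` setT)
    (fun p => ((p.2 : R) - 1) * sigma0 p.1 + (p.2 : R) * sigma1 p.1).

Definition F0_domain w (g : 'rV[R]_d -> R) (a : R) (E : set (spacetime R d)) :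
    Prop :=
  [/\ measurable E, E `<=` cylinder w, bounded_tvar w E &
      \int[vol]_(p in E) g p.1 = a].

Definition F0 w (g sigma0 sigma1 : 'rV[R]_d -> R) (a : R)
    (E : set (spacetime R d)) : \bar R :=
  if (`[< F0_domain w g a E >], tderiv w E) is (true, Some nu) then
    (charge_abs nu (cylinder w) +
     (charge_integral nu (cyl_boundary w) (wetting w sigma0 sigma1))%:E)%E
  else +oo%E.

Definition F0_minimiser w (g sigma0 sigma1 : 'rV[R]_d -> R) (a : R)
    (E : set (spacetime R d)) : Prop :=
  [/\ measurable E, E `<=` cylinder w &
      forall E' : set (spacetime R d), measurable E' -> E' `<=` cylinder w ->
        (F0 w g sigma0 sigma1 a E <= F0 w g sigma0 sigma1 a E')%E].

Definition lambda_star w (g sigmabar : 'rV[R]_d -> R) (a : R) : R :=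
  sup [set l : R |
    \int[leb]_(x in carrier w `&` [set x | sigmabar x < l * g x]) g x < a].

End setting.

(* Main.v *)
Require Import Defs.
From HB Require Import structures.
From mathcomp Require Import all_boot all_order all_algebra.
From mathcomp Require Import all_classical all_reals all_analysis.
From mathcomp Require Import measurable_realfun ess_sup_inf ring lra.

Set Implicit Arguments.
Unset Strict Implicit.
Unset Printing Implicit Defensive.

Import Order.TTheory GRing.Theory Num.Theory.
Import numFieldNormedType.Exports.
Local Open Scope classical_set_scope.
Local Open Scope ring_scope.

(* Since |sigma| <= c < 1 on the closure of Omega, sigma itself is a calibration:
   testing mu_E against sigma, which is affine in t with
   d sigma/dt = sigma_0 + sigma_1, gives
     F0 E >= int_E (sigma_0 + sigma_1) + (1 - c) |mu_E|(Omega),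
   with equality when |mu_E|(Omega) = 0.  Subtracting the multiplier
   lambda* int_E g = lambda* a, the right-hand side is minimised, by the bathtub
   principle, exactly when E contains {sigmabar < lambda* g} and is contained in
   {sigmabar <= lambda* g} up to null sets, and |mu_E|(Omega) = 0.  The latter
   says that E does not depend on t.  The lower bound is attained: as Lebesgue
   measure has no atoms and lambda* is a threshold value, some E_0 between the
   two level sets satisfies int_{E_0} g = a.

   Test functions are smooth, so the identity defining mu_E is first extended to
   products s(x) eta(t) with s bounded Borel by a monotone class argument. *)

(** [F0] evaluates a charge picked by choice in [tderiv], so each property is proved for an
    arbitrary [nu] with [is_tderiv w E nu]: the calibration inequality, the effect of zero variation
    and, conversely, zero variation when [E] is a vertical cylinder. For such sets a representing
    charge is also exhibited, carried by the two faces, which makes their energy finite. Two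
    features of sigma shape the testing step. Extended by 0 off the base it is only Borel in x and,
    being affine, it has no compact support in t. The first is met by sets [{chi > 0}] with chi a
    test function, whose indicators are limits of [bump (n chi)]; the second by plateaus equal to 1
    on [0, 1], which leave the integral over [E] unchanged and cut the charge down to the closed
    strip. On the torus the Borel sets are those of the half-open cell while test functions are
    smooth and periodic across its faces, so sets and functionals are compared on the cell only.
    Since [E] is known up to null sets, its horizontal slices cannot be compared one by one;
    invariance in t is expressed by integrals over [E]. *)

(** * Smooth functions: sums, products, composition, coordinates *)

Section smooth_calculus.
Context {R : realType}.
Implicit Types V W : normedModType R.

(** Coinduction: iterated derivatives never leave a class of differentiable functions stable under
    ['D_v]. The list of directions is peeled from its end, because [foldr] differentiates along the
    last direction first. *)
Lemma smooth_coind V (C : (V -> R) -> Prop) :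
  (forall f, C f -> (forall x, differentiable f x) /\ forall v, C ('D_v f)) ->
  forall f, C f -> smooth f.
Proof.
move=> HC f Cf s; elim/last_ind: s f Cf => [|s v IH] f Cf x /=.
  by have [+ _] := HC _ Cf; exact.
by rewrite foldr_rcons; apply: IH; have [_] := HC _ Cf; exact.
Qed.

Lemma smooth_differentiable V (f : V -> R) x : smooth f -> differentiable f x.
Proof. by move=> /(_ [::] x). Qed.

Lemma smooth_derive V (f : V -> R) v : smooth f -> smooth ('D_v f).
Proof. by move=> sf s x; have := sf (rcons s v) x; rewrite foldr_rcons. Qed.

Lemma smooth_continuous V (f : V -> R) : smooth f -> continuous f.
Proof.
by move=> sf x; apply: differentiable_continuous; exact: smooth_differentiable.
Qed.

(* A class of functions whose derivatives are polynomials in members of the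
   class consists of smooth functions. *)
Inductive ring_hull V (B : (V -> R) -> Prop) : (V -> R) -> Prop :=
| hull_gen f of B f : ring_hull B f
| hull_add f g of ring_hull B f & ring_hull B g :
    ring_hull B (fun x => f x + g x)
| hull_mul f g of ring_hull B f & ring_hull B g :
    ring_hull B (fun x => f x * g x).

Lemma smooth_hull V (B : (V -> R) -> Prop) :
  (forall f, B f -> (forall x, differentiable f x) /\
                    forall v, ring_hull B ('D_v f)) ->
  forall f, ring_hull B f -> smooth f.
Proof.
move=> HB; apply: smooth_coind => f.
elim=> [g /HB//|g h Hg [dg Dg] Hh [dh Dh]|g h Hg [dg Dg] Hh [dh Dh]].
- split=> [x|v]; first exact: differentiableD.
  suff -> : 'D_v (fun x => g x + h x) = (fun x => 'D_v g x + 'D_v h x).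
    exact: hull_add.
  apply/funext => x; rewrite -[LHS]/('D_v (g + h) x) deriveD//; exact: diff_derivable.
- split=> [x|v]; first exact: differentiableM.
  suff -> : 'D_v (fun x => g x * h x) =
      (fun x => g x * 'D_v h x + h x * 'D_v g x).
    by apply: hull_add; apply: hull_mul.
  apply/funext => x; rewrite -[LHS]/('D_v (g * h) x) deriveM//; exact: diff_derivable.
Qed.

Lemma smooth_smooth_hull V (f : V -> R) : ring_hull (@smooth R V) f -> smooth f.
Proof.
apply: smooth_hull => {}f sf; split=> [x|v]; first exact: smooth_differentiable.
by apply: hull_gen; exact: smooth_derive.
Qed.

Lemma smoothD V (f g : V -> R) :
  smooth f -> smooth g -> smooth (fun x => f x + g x).
Proof. by move=> sf sg; apply: smooth_smooth_hull; apply: hull_add; apply: hull_gen. Qed.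

Lemma smoothM V (f g : V -> R) :
  smooth f -> smooth g -> smooth (fun x => f x * g x).
Proof. by move=> sf sg; apply: smooth_smooth_hull; apply: hull_mul; apply: hull_gen. Qed.

Lemma smooth_cst V (r : R) : smooth (fun _ : V => r).
Proof.
apply: (@smooth_coind V (fun f => exists r, f = cst r)) => [f [k ->]|]; last by exists r.
split=> [x|v]; first exact: differentiable_cst.
by exists 0; apply/funext => x; rewrite derive_cst.
Qed.

Lemma smoothN V (f : V -> R) : smooth f -> smooth (fun x => - f x).
Proof.
move=> sf; rewrite (_ : (fun x => _) = (fun x => (-1) * f x)).
  by apply: smoothM => //; exact: smooth_cst.
by apply/funext => x; rewrite mulN1r.
Qed.

Lemma smooth_prod V I (s : seq I) (F : I -> V -> R) :
  (forall i, smooth (F i)) -> smooth (fun x => \prod_(i <- s) F i x).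
Proof.
move=> sF; elim: s => [|i s IH].
  by under eq_fun do rewrite big_nil; exact: smooth_cst.
by under eq_fun do rewrite big_cons; exact: smoothM.
Qed.

Lemma smooth_linear V (f : V -> R) : linear f -> continuous f -> smooth f.
Proof.
move=> lf cf; pose g : {linear V -> R} :=
  HB.pack f (GRing.isLinear.Build _ _ _ _ f lf).
have dg x : differentiable g x by apply: linear_differentiable; exact: cf.
apply: (@smooth_coind V (fun h => h = f \/ smooth h)); last by left.
move=> h [->|sh]; last first.
  by split=> [x|v]; [exact: smooth_differentiable|right; exact: smooth_derive].
split=> [x|v]; first exact: dg.
right; rewrite (_ : 'D_v f = cst (f v)); first exact: smooth_cst.
apply/funext => x; rewrite deriveE; last exact: dg.
by rewrite (_ : f = g :> (V -> R))// diff_lin//; exact: cf.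
Qed.

Lemma deriveE1 (f : R -> R) (x v : R) :
  differentiable f x -> 'D_v f x = v * 'D_1 f x.
Proof.
move=> df; rewrite !deriveE//.
by rewrite -[in LHS](mulr1 v) -[v * 1]/(v *: (1 : R)) linearZ.
Qed.

Lemma derive_comp V (f : R -> R) (g : V -> R) (x v : V) :
  differentiable g x -> differentiable f (g x) ->
  'D_v (fun y => f (g y)) x = 'D_1 f (g x) * 'D_v g x.
Proof.
move=> dg df; have dfg : differentiable (f \o g) x by exact: differentiable_comp.
rewrite -[LHS]/('D_v (f \o g) x) deriveE// diff_comp//= [in RHS]deriveE//.
rewrite (deriveE _ dg).
by rewrite mulrC -[in LHS](mulr1 ('d g x v)) -[_ * 1]/('d g x v *: (1 : R)) linearZ.
Qed.

(** The chain rule writes a derivative of [k \o g] as [k' \o g] times a derivative of [g], a product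
    of two generators; hence the hull over smooth functions and compositions with [g]. *)
Lemma smooth_comp V (f : R -> R) (g : V -> R) :
  smooth f -> smooth g -> smooth (fun x => f (g x)).
Proof.
move=> sf sg.
apply: (@smooth_hull V (fun h => smooth h \/
    exists2 k : R -> R, smooth k & h = fun x => k (g x))); last first.
  by apply: hull_gen; right; exists f.
move=> h [sh|[k sk ->]].
  split=> [x|v]; first exact: smooth_differentiable.
  by apply: hull_gen; left; exact: smooth_derive.
have dg x : differentiable g x by exact: smooth_differentiable.
have dk x : differentiable k x by exact: smooth_differentiable.
split=> [x|v]; first by apply: differentiable_comp.
rewrite (_ : 'D_v _ = fun x => 'D_1 k (g x) * 'D_v g x).
  apply: hull_mul; apply: hull_gen.
    by right; exists ('D_1 k) => //; exact: smooth_derive.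
  by left; exact: smooth_derive.
by apply/funext => x; exact: derive_comp.
Qed.

Lemma smooth_id : smooth (fun x : R => x).
Proof. apply: smooth_linear => // x; exact: cvg_id. Qed.

Lemma smooth_fst V W (f : V -> R) : smooth f -> smooth (fun p : V * W => f p.1).
Proof.
move=> sf; apply: (@smooth_coind _ (fun h => exists2 k : V -> R, smooth k &
   h = fun p : V * W => k p.1)); last by exists f.
move=> h [k sk ->].
have dk x : differentiable k x by exact: smooth_differentiable.
have dfst (x : V * W) : differentiable (fst : V * W -> V) x.
  by apply: linear_differentiable; move=> ?; exact: cvg_fst.
split=> [x|v]; first exact: differentiable_comp.
exists ('D_(v.1) k); first exact: smooth_derive.
apply/funext => x; rewrite deriveE; last exact: differentiable_comp.
rewrite -[fun p => _]/(k \o fst) diff_comp//= deriveE//.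
by rewrite (diff_lin (f := fst))//; move=> ?; exact: cvg_fst.
Qed.

Lemma smooth_snd V W (f : W -> R) : smooth f -> smooth (fun p : V * W => f p.2).
Proof.
move=> sf; apply: (@smooth_coind _ (fun h => exists2 k : W -> R, smooth k &
   h = fun p : V * W => k p.2)); last by exists f.
move=> h [k sk ->].
have dk x : differentiable k x by exact: smooth_differentiable.
have dsnd (x : V * W) : differentiable (snd : V * W -> W) x.
  by apply: linear_differentiable; move=> ?; exact: cvg_snd.
split=> [x|v]; first exact: differentiable_comp.
exists ('D_(v.2) k); first exact: smooth_derive.
apply/funext => x; rewrite deriveE; last exact: differentiable_comp.
rewrite -[fun p => _]/(k \o snd) diff_comp//= deriveE//.
by rewrite (diff_lin (f := snd))//; move=> ?; exact: cvg_snd.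
Qed.

Lemma smooth_coord n (i : 'I_n) (f : R -> R) : smooth f ->
  smooth (fun x : 'rV[R]_n => f (x ord0 i)).
Proof.
move=> sf; apply: (smooth_comp sf); apply: smooth_linear.
  by move=> a u v; rewrite !mxE.
exact: coord_continuous.
Qed.

End smooth_calculus.

(** * Smooth functions of one variable: bumps, periodisation, plateaus, primitives *)

Section smooth1.
Context {R : realType}.

Lemma smooth1_coind (C : (R -> R) -> Prop) :
  (forall f, C f -> exists2 g, C g & forall x : R, is_derive x (1 : R) f (g x)) ->
  forall f, C f -> smooth f.
Proof.
move=> HC f Cf.
apply: (@smooth_hull _ _ (fun h => C h \/ smooth h)); last first.
  by apply: hull_gen; left.
move=> h [/HC[g Cg hg]|sh]; last first.
  split=> [x|v]; first exact: smooth_differentiable.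
  by apply: hull_gen; right; exact: smooth_derive.
have dh x : differentiable h x.
  by apply/derivable1_diffP; have [] := hg x.
split=> // v; rewrite (_ : 'D_v h = fun x => v * g x).
  apply: hull_mul; apply: hull_gen; last by left.
  by right; exact: smooth_cst.
by apply/funext => x; rewrite deriveE1//; have [_ ->] := hg x.
Qed.

Lemma smooth_is_derive (f : R -> R) (x : R) : smooth f -> is_derive x (1 : R) f ('D_1 f x).
Proof.
move=> sf; split => //; apply/derivable1_diffP; exact: smooth_differentiable.
Qed.

(* The class of all P(1/x) exp(-1/x), extended by 0, is closed under
   differentiation. *)
Definition flat_exp (P : {poly R}) (x : R) : R :=
  if 0 < x then P.[x^-1] * expR (- x^-1) else 0.

(** The term of degree [k.+2] of the exponential series bounds [expR x^-1] from below; the two spare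
    powers leave the [x ^+ 2] that makes the derivative at 0 vanish. *)
Lemma exp_decay (k : nat) (x : R) : 0 < x ->
  x^-1 ^+ k * expR (- x^-1) <= (k.+2)`!%:R * x ^+ 2.
Proof.
move=> x0; rewrite expRN ler_pdivrMr ?expR_gt0//.
have := @expR_ge1Dxn R x^-1 k.+1; rewrite invr_ge0 => /(_ (ltW x0)) H.
have {H} : x^-1 ^+ k.+2 / k.+2`!%:R <= expR x^-1 by lra.
rewrite ler_pdivrMr ?ltr0n ?fact_gt0// => H.
rewrite -mulrA mulrCA (_ : x^-1 ^+ k = x ^+ 2 * x^-1 ^+ k.+2).
  by rewrite ler_wpM2l// ?sqr_ge0// mulrC.
by rewrite (exprD _ 2 k) mulrA -exprMn divff ?expr1n ?mul1r ?gt_eqF.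
Qed.

Lemma flat_exp_bound P : exists2 C, 0 <= C & forall x, `|flat_exp P x| <= C * x ^+ 2.
Proof.
exists (\sum_(i < size P) `|P`_i| * (i.+2)`!%:R).
  by apply: sumr_ge0 => i _; rewrite mulr_ge0.
move=> x; rewrite /flat_exp; case: ifPn => [x0|_]; last first.
  by rewrite normr0 mulr_ge0 ?sqr_ge0// sumr_ge0// => i _; rewrite mulr_ge0.
rewrite horner_coef big_distrl/= (le_trans (ler_norm_sum _ _ _))//.
rewrite big_distrl/= ler_sum// => i _.
rewrite -mulrA normrM -mulrA ler_wpM2l// ger0_norm ?exp_decay//.
by rewrite mulr_ge0 ?expR_ge0// exprn_ge0// invr_ge0 ltW.
Qed.

Lemma is_derive_square_bound (f : R -> R) C : f 0 = 0 ->
  (forall x, `|f x| <= C * x ^+ 2) -> is_derive (0 : R) (1 : R) f 0.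
Proof.
move=> f0 fC.
suff H : h^-1 *: (f (h *: 1 + 0) - f 0) @[h --> (0:R)^'] --> (0 : R).
  by split; [apply/cvg_ex; exists 0|apply/cvg_lim].
rewrite f0; apply/cvgr0Pnorm_lt => e e0.
have C0 : 0 <= C by have := fC 1; rewrite expr1n mulr1; apply: le_trans.
near=> h.
have h0 : h != 0 by near: h; exact: nbhs_dnbhs_neq.
rewrite subr0 addr0 normrZ normfV -[h *: 1]/(h * 1) mulr1.
rewrite mulrC ltr_pdivrMr ?normr_gt0// (le_lt_trans (fC _))//.
rewrite (_ : h ^+ 2 = `|h| * `|h|); last by rewrite -normrM -expr2 ger0_norm ?sqr_ge0.
rewrite mulrA ltr_pM2r ?normr_gt0//.
have : `|h| < e / (C + 1).
  near: h; apply: dnbhs0_lt; rewrite divr_gt0//; lra.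
rewrite ltr_pdivlMr; last lra.
by have := normr_ge0 h; nra.
Unshelve. all: by end_near. Qed.

(** For [x > 0], differentiating P(1/x) exp(-1/x) replaces P(1/x) by x^-2 (P - P')(1/x), again a
    polynomial in 1/x; at 0 the quadratic bound gives derivative 0. *)
Lemma is_derive_flat_exp P (x : R) :
  is_derive x (1 : R) (flat_exp P) (flat_exp ('X^2 * (P - P^`())) x).
Proof.
have [x0|x0|->] := ltgtP x 0.
- rewrite {2}/flat_exp ltNge ltW//=.
  apply: (@near_eq_is_derive _ _ _ (cst 0)).
  near=> y; rewrite /flat_exp ifF//; apply/negbTE; rewrite -leNgt ltW//.
  by near: y; exact: lt_nbhsl.
- have xn0 : x != 0 by rewrite gt_eqF.
  have dV : is_derive x (1 : R) (fun y : R => y^-1) (- x ^- 2).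
    apply: is_derive_eq (@is_deriveV _ id x 1 1 xn0 _) _.
 by rewrite /GRing.scale/= mulr1.
  have dP : is_derive x (1 : R) (fun y : R => P.[y^-1]) (P^`().[x^-1] * - x ^- 2).
    exact: (@is_derive1_comp _ (horner P) (fun y => y^-1) x).
  have dE : is_derive x (1 : R) (fun y : R => expR (- y^-1)) (expR (- x^-1) * (x ^- 2)).
    apply: (@is_derive1_comp _ expR (fun y => - y^-1) x).
    by rewrite -[x ^- 2]opprK; exact: is_deriveN.
  have dPE : is_derive x (1 : R) (fun y : R => P.[y^-1] * expR (- y^-1))
      (flat_exp ('X^2 * (P - P^`())) x).
    apply: is_derive_eq (is_deriveM dP dE) _.
    rewrite /flat_exp x0 !hornerE -!exprVn /GRing.scale/=.
    ring.
  refine (near_eq_is_derive _ dPE).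
  near=> y; rewrite /flat_exp ifT//.
  by near: y; exact: lt_nbhsr.
- rewrite {2}/flat_exp ltxx.
  have [C _ HC] := flat_exp_bound P.
  by apply: (is_derive_square_bound _ HC); rewrite /flat_exp ltxx.
Unshelve. all: by end_near. Qed.

Lemma smooth_flat_exp P : smooth (flat_exp P).
Proof.
apply: (@smooth1_coind (fun f => exists Q, f = flat_exp Q)); last by exists P.
move=> f [Q ->]; exists (flat_exp ('X^2 * (Q - Q^`()))); first by eexists.
by move=> x; exact: is_derive_flat_exp.
Qed.

Definition bump (x : R) : R := flat_exp 1 x.

Lemma bumpE x : bump x = if 0 < x then expR (- x^-1) else 0.
Proof. by rewrite /bump /flat_exp hornerC mul1r. Qed.

Lemma smooth_bump : smooth bump.
Proof. exact: smooth_flat_exp. Qed.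

Lemma bump_le0 x : x <= 0 -> bump x = 0.
Proof. by move=> x0; rewrite bumpE ltNge x0. Qed.

Lemma bump_ge0 x : 0 <= bump x.
Proof. by rewrite bumpE; case: ifP => // _; exact: expR_ge0. Qed.

Lemma bump_gt0 x : (0 < bump x) = (0 < x).
Proof. by rewrite bumpE; case: ifP => // _; rewrite ?expR_gt0// ltxx. Qed.

Lemma bump_lt1 x : bump x < 1.
Proof.
by rewrite bumpE; case: ifP => // x0; rewrite expR_lt1 oppr_lt0 invr_gt0.
Qed.

(** Purpose: the indicator of [{f > 0}], for [f] smooth, is a bounded pointwise limit of the smooth
    functions [bump (n f)]. *)
Lemma bump_cvg (x : R) :
  bump (n%:R * x) @[n --> \oo] --> ((0 < x)%R%:R : R).
Proof.
have [x0|x0] := ltP 0 x; last first.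
  rewrite (_ : (fun n : nat => _) = cst 0); first exact: cvg_cst.
  by apply/funext => n; rewrite bump_le0// mulr_ge0_le0.
rewrite -[X in _ --> X]expR0.
apply: (@cvg_trans _ ((fun n : nat => expR (- (n%:R * x)^-1)) @ \oo)).
  apply: near_eq_cvg; near=> n; rewrite bumpE mulr_gt0// ltr0n.
  by near: n; exact: nbhs_infty_gt.
apply: continuous_cvg; first exact: continuous_expR.
rewrite -oppr0; apply: cvgN.
rewrite (_ : (fun n => _) = (fun n : nat => n%:R^-1 * x^-1)); last first.
  by apply/funext => n; rewrite invfM.
rewrite -[X in _ --> X](mul0r x^-1); apply: cvgMl => //.
apply/gtr0_cvgV0; last exact: cvgr_idn.
by near=> n; rewrite ltr0n; near: n; exact: nbhs_infty_gt.
Unshelve. all: by end_near. Qed.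

Definition frac (x : R) : R := x - (Num.floor x)%:~R.

Lemma frac_itv x : 0 <= frac x < 1.
Proof.
have /andP[h1 h2] := floor_itv x.
by rewrite /frac subr_ge0 h1/= ltrBlDr addrC -[1]/(1%:~R) -intrD.
Qed.

Lemma fracDz x (k : int) : frac (x + k%:~R) = frac x.
Proof. by rewrite /frac floorDrz ?intr_int// intrKfloor intrD; ring. Qed.

Lemma frac_id x : 0 <= x < 1 -> frac x = x.
Proof. by move=> x01; rewrite /frac (@floor_def _ _ 0) ?subr0// add0r. Qed.

(** [frac] jumps at the integers, but [f] vanishes near 0 and near 1, so the composition vanishes
    around every integer; elsewhere [frac] is locally a translation. *)
Lemma smooth_frac (f : R -> R) (a b : R) : 0 < a -> b < 1 -> smooth f ->
  (forall x, ~ (a <= x <= b) -> f x = 0) -> smooth (fun x => f (frac x)).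
Proof.
move=> a0 b1 sf f0.
pose C (h : R -> R) := exists2 k : R -> R, h = (fun x => k (frac x)) &
  smooth k /\ forall x, ~ (a <= x <= b) -> k x = 0.
apply: (@smooth1_coind C); last by exists f.
move=> h [k -> [sk k0]].
have near0 (x : R) : ~ (a <= x <= b) -> \near x, ~ (a <= x <= b).
  move=> /negP; rewrite negb_and -!ltNge => /orP[xa|bx]; near=> y; apply/negP;
    rewrite negb_and -!ltNge; apply/orP; [left|right].
    by near: y; exact: lt_nbhsl.
  by near: y; exact: lt_nbhsr.
have dk0 x : ~ (a <= x <= b) -> 'D_1 k x = 0.
  move=> xab; rewrite (@near_eq_derive _ _ _ _ (cst 0)) ?derive_cst//.
  by near=> y; apply: k0; near: y; exact: near0.
exists (fun x => 'D_1 k (frac x)).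
  by exists ('D_1 k) => //; split => //; exact: smooth_derive.
move=> x; have /andP[fx0 fx1] := frac_itv x.
have [fx_eq0|fx_neq0] := eqVneq (frac x) 0.
  rewrite fx_eq0 dk0; last by move=> /andP[]; rewrite leNgt a0.
  refine (@near_eq_is_derive _ _ _ (cst 0) _ _ _ _ _ _) => //.
  have xE : x = (Num.floor x)%:~R by apply/eqP; rewrite -subr_eq0; apply/eqP.
  near=> y; rewrite k0// => /andP[ay yb].
  (* Within this distance of the integer [x], [frac y] is below [a] to the right of [x] and above
     [b] to the left. *)
  have : `|x - y| < Num.min a (1 - b).
    near: y; apply/nbhs_ballP; exists (Num.min a (1 - b)) => //=.
    by rewrite lt_min a0 subr_gt0.
  rewrite lt_min !ltr_norml => /andP[/andP[h1 h2] /andP[h3 h4]].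
  have [xy|yx] := leP x y.
    have yfl : Num.floor y = Num.floor x.
      by apply: floor_def; rewrite intrD -xE; lra.
    by move: ay yb; rewrite /frac yfl -xE; lra.
  have yfl : Num.floor y = Num.floor x - 1.
    by apply: floor_def; rewrite subrK intrB -xE; lra.
  by move: ay yb; rewrite /frac yfl intrB -xE; lra.
have fx_gt0 : 0 < frac x by rewrite lt_def fx_neq0.
have nearE : \forall y \near x, y - (Num.floor x)%:~R = frac y.
  near=> y; rewrite /frac; congr (_ - _%:~R); apply/esym.
  apply: floor_def; apply/andP; split.
    apply: ltW; near: y; apply: lt_nbhsr.
    by move: fx_gt0; rewrite /frac; lra.
  near: y; apply: lt_nbhsl; rewrite intrD.
  by move: fx1; rewrite /frac; lra.
refine (@near_eq_is_derive _ _ _ (fun y : R => k (y - (Num.floor x)%:~R)) _ _ _ _ _ _).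
  by near=> y; congr k; near: y.
rewrite -[X in is_derive _ _ _ X]mulr1.
apply: (@is_derive1_comp _ k); first exact: smooth_is_derive.
by rewrite -[1 in X in is_derive _ _ _ X]subr0; exact: is_deriveB.
Unshelve. all: by end_near. Qed.

(* Smooth, equal to 1 on [0, 1], and converging to its indicator: t (t - 1) is
   positive exactly off [0, 1]. *)
Definition plateau (n : nat) (t : R) : R :=
  expR 1 * bump (1 - expR 1 * bump (n%:R * (t * (t - 1)))).

Lemma smooth_plateau n : smooth (plateau n).
Proof.
apply: smoothM; first exact: smooth_cst.
apply: (smooth_comp smooth_bump); apply: smoothD; first exact: smooth_cst.
apply: smoothN; apply: smoothM; first exact: smooth_cst.
apply: (smooth_comp smooth_bump); apply: smoothM; first exact: smooth_cst.
apply: smoothM; first exact: smooth_id.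
by apply: smoothD; [exact: smooth_id|exact: smooth_cst].
Qed.

Lemma plateau1 n t : 0 <= t <= 1 -> plateau n t = 1.
Proof.
move=> /andP[t0 t1]; rewrite /plateau (@bump_le0 (n%:R * _)); last first.
  by rewrite mulr_ge0_le0// mulr_ge0_le0// subr_le0.
by rewrite mulr0 subr0 bumpE ltr01 invr1 expRxMexpNx_1.
Qed.

(** As [bump 1] is exp(-1), the inner [bump] is at least exp(-1) once its argument reaches 1, and
    the argument of the outer one is then nonpositive: hence the constant [expR 1]. *)
Lemma plateau0 n t : 1 <= n%:R * (t * (t - 1)) -> plateau n t = 0.
Proof.
move=> q1; rewrite /plateau (@bump_le0 (1 - _)) ?mulr0// subr_le0.
rewrite bumpE (lt_le_trans ltr01 q1) -[leLHS](@expRxMexpNx_1 _ 1).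
rewrite ler_wpM2l ?expR_ge0// ler_expR lerN2.
by rewrite invf_le1// (lt_le_trans ltr01).
Qed.

Lemma plateau_far n t : 2 < `|t| -> plateau n.+1 t = 0.
Proof.
move=> t2; apply: plateau0; have : 1 <= t * (t - 1).
  have [t0|t0] := leP 0 t; move: t2.
    by rewrite ger0_norm//; nra.
  by rewrite ltr0_norm//; nra.
have : 1 <= n.+1%:R :> R by rewrite ler1n.
nra.
Qed.

Lemma plateau_itv n t : 0 <= plateau n t <= 1.
Proof.
rewrite /plateau mulr_ge0 ?bump_ge0 ?expR_ge0//= bumpE.
case: ifPn => [u0|_]; last by rewrite mulr0.
rewrite -expRD expR_le1 subr_le0 -[leLHS]invr1 lef_pV2 ?posrE//.
by rewrite gerBl mulr_ge0 ?expR_ge0 ?bump_ge0.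
Qed.

Lemma plateau_cvg t :
  plateau n.+1 t @[n --> \oo] --> ((0 <= t <= 1)%R%:R : R).
Proof.
have [t01|t01] := boolP (0 <= t <= 1).
  rewrite (_ : (fun n => _) = cst 1); first exact: cvg_cst.
  by apply/funext => n; rewrite plateau1.
apply: cvg_near_cst.
have q0 : 0 < t * (t - 1).
  by move: t01; rewrite negb_and -!ltNge => /orP[|]; nra.
near=> n; rewrite plateau0// -ler_pdivrMr// ltW// mul1r.
apply: (@lt_le_trans _ _ n%:R); last by rewrite ler_nat.
by near: n; exact: nbhs_infty_gtr.
Unshelve. all: by end_near. Qed.

Lemma smooth_primitive (f : R -> R) : smooth f -> (forall t, t < 0 -> f t = 0) ->
  exists2 F : R -> R, smooth F & forall t : R, 'D_1 F t = f t.
Proof.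
move=> sf f0.
(* Any negative base point would do: [f] vanishes left of 0, and -1 leaves room for the fundamental
   theorem of calculus at [x = 0]. *)
pose F (x : R) := \int[lebesgue_measure]_(t in `[(-1)%R, x]) f t.
have cf : continuous f by exact: smooth_continuous.
have dF x : is_derive x (1 : R) F (f x).
  have [x0|x0] := ltP x 0.
    rewrite f0//; refine (@near_eq_is_derive _ _ _ (cst 0) _ _ _ _ _ _).
    near=> y; rewrite /F; apply/esym.
    have y0 : y < 0 by near: y; exact: lt_nbhsl.
    under eq_Rintegral => t.
      rewrite inE/= in_itv/= => /andP[_ ty]; rewrite f0 ?(le_lt_trans ty)//.
      over.
    by rewrite Rintegral_cst ?mul0r.
  have [| | |dFx FE] := @continuous_FTC1_closed _ f (-1) x (x + 1) _ _ _ (cf x).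
  - by rewrite ltrDl.
  - apply: continuous_compact_integrable; first exact: segment_compact.
    exact: continuous_subspaceT.
  - by rewrite (lt_le_trans _ x0).
  - by split=> //; rewrite -derive1E.
exists F; last by move=> t; have [] := dF t.
apply: (@smooth1_coind (fun h => h = F \/ smooth h)); last by left.
move=> h [->|sh]; first by exists f => //; right.
by exists ('D_1 h) => [|x]; [right; exact: smooth_derive|exact: smooth_is_derive].
Unshelve. all: by end_near. Qed.

Lemma smooth_FTC2 (F : R -> R) : smooth F ->
  \int[lebesgue_measure]_(t in `]0, 1[) 'D_1 F t = F 1 - F 0.
Proof.
move=> sF; have cF : continuous ('D_1 F).
  by apply: smooth_continuous; exact: smooth_derive.
have := @continuous_FTC2 R ('D_1 F) F 0 1 ltr01.
have -> : (\int[lebesgue_measure]_(x in `[0%R, 1%R]) ('D_1 F x)%:E =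
           \int[lebesgue_measure]_(x in `]0%R, 1%R[) ('D_1 F x)%:E)%E.
  rewrite integral_itv_bndo_bndc -?integral_itv_obnd_cbnd//;
    apply/measurable_EFinP; apply: measurable_funTS; exact: continuous_measurable_fun.
move=> H; rewrite /Rintegral H//.
- exact: continuous_subspaceT.
- split=> [x _||].
  + by have [] := smooth_is_derive x sF.
  + by apply: cvg_at_right_filter; exact: smooth_continuous.
  + by apply: cvg_at_left_filter; exact: smooth_continuous.
- by move=> x _; rewrite derive1E.
Qed.

End smooth1.

(** * Monotone class arguments for functionals on bounded functions *)

Section bounded_functional.
Context {R : realType} d (T : measurableType d).
Implicit Types (f g : T -> R) (J : (T -> R) -> R).

Definition bounded_measurable f :=
  measurable_fun setT f /\ exists M : R, forall x, `|f x| <= M.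

(* Abstracts a finite signed combination of integrals against finite
   measures, so that the monotone class argument is made once. *)
Definition sigma_linear J :=
  (forall a b f g, bounded_measurable f -> bounded_measurable g ->
     J (fun x => a * f x + b * g x) = a * J f + b * J g) /\
  (forall (F : (T -> R)^nat) f (M : R), (forall n, measurable_fun setT (F n)) ->
     (forall n x, `|F n x| <= M) ->
     (forall x, F n x @[n --> \oo] --> f x) ->
     J (F n) @[n --> \oo] --> J f).

Lemma bounded_measurable_indic (A : set T) :
  measurable A -> bounded_measurable (\1_A : T -> R).
Proof.
move=> mA; split=> //; exists 1 => x.
by rewrite indicE; case: (_ \in _); rewrite ?normr1 ?normr0.
Qed.

Lemma bounded_measurable_cst (r : R) : bounded_measurable (fun=> r).
Proof. by split; [exact: measurable_cst|exists `|r|]. Qed.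

Lemma bounded_measurableM f g : bounded_measurable f -> bounded_measurable g ->
  bounded_measurable (fun x => f x * g x).
Proof.
move=> [mf [M fM]] [mg [N gN]]; split; first exact: measurable_funM.
by exists (M * N) => x; rewrite normrM ler_pM.
Qed.

Lemma bounded_measurableD f g : bounded_measurable f -> bounded_measurable g ->
  bounded_measurable (fun x => f x + g x).
Proof.
move=> [mf [M fM]] [mg [N gN]]; split; first exact: measurable_funD.
by exists (M + N) => x; rewrite (le_trans (ler_normD _ _))// lerD.
Qed.

Lemma bounded_measurable_sum I (s : seq I) (F : I -> T -> R) :
  (forall i, bounded_measurable (F i)) ->
  bounded_measurable (fun x => \sum_(i <- s) F i x).
Proof.
move=> bF; elim: s => [|i s IH].
  by under eq_fun do rewrite big_nil; exact: bounded_measurable_cst.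
by under eq_fun do rewrite big_cons; exact: bounded_measurableD.
Qed.

Lemma cst_cvg_eq0 (l : R) : (cst 0 : nat -> R) @ \oo --> l -> l = 0.
Proof. by move=> /cvg_lim <- //; rewrite lim_cst. Qed.

Section zero.
Variable J : (T -> R) -> R.
Hypothesis J_lin : sigma_linear J.

Lemma sigma_linear_sum I (s : seq I) (F : I -> T -> R) :
  (forall i, bounded_measurable (F i)) -> J (fun=> 0) = 0 ->
  J (fun x => \sum_(i <- s) F i x) = \sum_(i <- s) J (F i).
Proof.
move=> bF J0; elim: s => [|i s IH].
  by rewrite big_nil; under eq_fun do rewrite big_nil.
rewrite big_cons -IH.
have := J_lin.1 1 1 _ _ (bF i) (bounded_measurable_sum s bF).
by rewrite !mul1r => <-; congr J; apply/funext => x; rewrite big_cons !mul1r.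
Qed.

Lemma sigma_linear0 : J (fun=> 0) = 0.
Proof.
have /(_ 0 0 _ _ (bounded_measurable_cst 0) (bounded_measurable_cst 0)) := J_lin.1.
by rewrite !mul0r addr0 => H; rewrite -[RHS]H; congr J; apply/funext => x; rewrite !mul0r addr0.
Qed.

(** For [0 <= y] this is the minimum of [n] and the integer part of [y], written as a sum of
    indicators so that [J] distributes over it. *)
Let step (n : nat) (y : R) :=
  \sum_(0 <= k < n) ((k.+1%:R <= y)%R%:R : R).

Let step_spec n y : 0 <= y ->
  [/\ step n y <= y, step n y <= n%:R & step n y = n%:R \/ y - 1 < step n y].
Proof.
move=> y0; elim: n => [|n [h1 h2 h3]].
  by rewrite /step big_geq//; split => //; left.
rewrite {1 2 3 4}/step !big_nat_recr//= -/(step n y).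
rewrite -[in n.+1%:R <= _]natr1 -natr1.
case: (leP (n%:R + 1) y) => ny /=; case: h3 => h3; split; try lra.
all: try by right; lra.
Qed.

(** After an affine rescaling to values in [0, 1], [f] is the limit of 1/(n+1) times the sum over k
    of the indicators of {k + 1 <= (n + 1) f}, with error at most 1/(n+1). *)
Lemma sigma_linear_indic_zero :
  (forall A, measurable A -> J (\1_A) = 0) ->
  forall f, bounded_measurable f -> J f = 0.
Proof.
move=> J1.
suff H01 f : measurable_fun setT f -> (forall x, 0 <= f x <= 1) -> J f = 0.
  move=> f [mf [M fM]].
  have M0 : 0 <= M by exact: le_trans (fM point).
  (* [M + 1] instead of [M] avoids a division by zero when [f] vanishes identically and [M = 0]. *)
  pose g x := (f x + (M + 1)) / (2 * (M + 1)).
  have mg : measurable_fun setT g.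
    by apply: measurable_funM => //; apply: measurable_funD.
  have g01 x : 0 <= g x <= 1.
    have := fM x; rewrite ler_norml => /andP[h1 h2].
    rewrite /g divr_ge0; [|lra|lra]; rewrite ler_pdivrMr; lra.
  have bg : bounded_measurable g.
    by split=> //; exists 1 => x; rewrite ger0_norm; have /andP[] := g01 x.
  have := J_lin.1 (2 * (M + 1)) (- (M + 1)) _ _ bg (bounded_measurable_indic measurableT).
  rewrite (H01 g mg g01) (J1 setT measurableT) !mulr0 addr0 => H.
  rewrite -[RHS]H; congr J; apply/funext => x.
  have ? : M + 1 != 0 by rewrite gt_eqF//; lra.
  by rewrite indicT /g /cst; field.
move=> mf f01.
pose F (n : nat) (x : T) : R :=
  \sum_(0 <= k < n.+1) (n.+1%:R^-1 * \1_[set x | k.+1%:R <= n.+1%:R * f x] x).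
have FE n x : F n x = n.+1%:R^-1 * step n.+1 (n.+1%:R * f x).
  rewrite /F /step big_distrr/=; apply: eq_bigr => k _; congr (_ * _).
  by rewrite indicE mem_setE.
have mA n (k : nat) : measurable [set x | k%:R <= n.+1%:R * f x].
  rewrite -[X in measurable X]setTI.
  apply: measurable_fun_le => //.
  exact: measurable_funM.
have bi n k : bounded_measurable (fun x =>
    n.+1%:R^-1 * (\1_[set x | k.+1%:R <= n.+1%:R * f x] x : R)).
  apply: bounded_measurableM; first exact: bounded_measurable_cst.
  exact: bounded_measurable_indic.
have bF n : bounded_measurable (F n) by exact: bounded_measurable_sum.
have JF n : J (F n) = 0.
  rewrite sigma_linear_sum//; last exact: sigma_linear0.
  rewrite big1// => k _.
  have := J_lin.1 n.+1%:R^-1 0 _ _ (bounded_measurable_indic (mA n k.+1))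
    (bounded_measurable_cst 0).
  rewrite (J1 _ (mA n k.+1)) !(mulr0, mul0r, addr0) => H.
  rewrite -[RHS]H; congr J; apply/funext => x.
  by rewrite ?mul0r ?addr0.
have Ff n x : f x - n.+1%:R^-1 <= F n x <= f x.
  have n0 : 0 < n.+1%:R :> R by rewrite ltr0n.
  have /andP[f0 f1] := f01 x.
  have nf0 : 0 <= n.+1%:R * f x by rewrite mulr_ge0.
  have [h1 h2 h3] := step_spec n.+1 nf0.
  rewrite FE; apply/andP; split; last by rewrite mulrC ler_pdivrMr// (mulrC (f x)).
  rewrite mulrC ler_pdivlMr// mulrBl mulVf ?gt_eqF// mulrC.
  by case: h3 => [->|]; nra.
have /(_ F f 1) := J_lin.2.
have -> : (fun n => J (F n)) = cst 0 by apply/funext => n; rewrite JF.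
move=> H; apply: (cst_cvg_eq0 (H _ _ _)) => //.
- by move=> n; have [] := bF n.
- move=> n x; rewrite ler_norml; have /andP[] := Ff n x; have /andP[] := f01 x.
  have : n.+1%:R^-1 <= 1 :> R by rewrite invf_le1// ler1n.
  by move: (n.+1%:R^-1) (F n x) => e y *; lra.
- move=> x; apply: (@squeeze_cvgr _ _ _ _ (fun n => f x - n.+1%:R^-1) (cst (f x))).
  + by near=> n.
  + rewrite -[X in _ --> X]subr0; apply: cvgB; first exact: cvg_cst.
    exact: cvg_harmonic.
  + exact: cvg_cst.
Unshelve. all: by end_near. Qed.

(** Linearity and bounded convergence make the sets with [J \1_A = 0] a Dynkin system; it contains
    the pi-system [G], hence the sigma-algebra that [G] generates. *)
Lemma sigma_linear_dynkin (G : set_system T) :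
  @measurable _ T = <<s G >> -> setI_closed G -> J (fun=> 1) = 0 ->
  (forall A, G A -> J (\1_A) = 0) ->
  forall f, bounded_measurable f -> J f = 0.
Proof.
move=> mG IG J1 JG; apply: sigma_linear_indic_zero => A mA.
move: (mA); rewrite mG; move: A {mA}.
apply: (dynkin_induction mG IG) => //.
- by rewrite indicT.
- move=> S mS JS.
  have := J_lin.1 1 (-1) _ _ (bounded_measurable_cst 1) (bounded_measurable_indic mS).
  rewrite J1 JS !mulr0 addr0 => H; rewrite -[RHS]H; congr J; apply/funext => x.
  rewrite !indicE in_setC; case: (x \in S) => /=; ring.
- move=> F mF tF JF.
  have := J_lin.2 (fun n x => \sum_(0 <= k < n) \1_(F k) x) (\1_(\bigcup_k F k)) 1.
  have -> : (fun n => J (fun x => \sum_(0 <= k < n) \1_(F k) x)) = cst 0.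
    apply/funext => n; rewrite sigma_linear_sum ?big1//.
    + by move=> i; exact: bounded_measurable_indic.
    + exact: sigma_linear0.
  have sumE n x : (\sum_(0 <= k < n) \1_(F k) x : R) = \1_(\bigcup_(k < n) F k) x.
    elim: n => [|n IH].
      by rewrite big_geq// bigcup_mkord big_ord0 indic0.
    rewrite big_nat_recr//= IH !indicE.
    rewrite [in RHS]bigcup_mkord big_ord_recr/= -bigcup_mkord in_setU.
    have [xn|xn] := boolP (x \in F n); last by rewrite orbF addr0.
    rewrite orbT (_ : _ \in _ = false) ?add0r//; apply/negbTE/negP.
    rewrite inE => -[k /= kn Fk]; rewrite inE in xn.
    have /trivIsetP/(_ k n I I) := tF.
    by rewrite neq_ltn kn => /(_ isT); apply/eqP/set0P; exists x.
  move=> H; apply: (cst_cvg_eq0 (H _ _ _)) => //.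
  + by move=> n; apply: measurable_sum => k; exact: measurable_indic.
  + move=> n x; rewrite sumE indicE; case: (_ \in _); by rewrite ?normr1 ?normr0.
  + move=> x; apply: cvg_near_cst.
    have [[k _ Fk]|nF] := pselect ((\bigcup_k F k) x).
      near=> n; rewrite sumE !indicE !mem_set//; first by exists k.
      by exists k => //=; near: n; exact: nbhs_infty_gt.
    near=> n; rewrite sumE !indicE !memNset//.
    by move=> [k _ Fk]; apply: nF; exists k.
Unshelve. all: by end_near. Qed.

End zero.

Lemma sigma_linearB J1 J2 : sigma_linear J1 -> sigma_linear J2 ->
  sigma_linear (fun f => J1 f - J2 f).
Proof.
move=> [l1 c1] [l2 c2]; split=> [a b f g bf bg|F f M mF FM Ff].
  by rewrite l1// l2//; ring.
by apply: cvgB; [apply: c1 FM _|apply: c2 FM _].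
Qed.

End bounded_functional.

(** * Integrals of bounded functions over sets of finite measure *)

Section Rintegral_bounded.
Context {R : realType} d (T : measurableType d) (mu : {measure set T -> \bar R}).
Implicit Types (D : set T) (f : T -> R).

Lemma bounded_integrable D f (M : R) : measurable D -> (mu D < +oo)%E ->
  measurable_fun D f -> (forall x, D x -> `|f x| <= M) ->
  mu.-integrable D (EFin \o f).
Proof.
move=> mD fD mf fM; apply: measurable_bounded_integrable => //.
exists M; split; first exact: num_real.
by move=> y My x Dx /=; rewrite (le_trans (fM _ Dx))// ltW.
Qed.

Lemma Rintegral_bounded_cvg D (F : (T -> R)^nat) f (M : R) : measurable D ->
  (mu D < +oo)%E -> (forall n, measurable_fun D (F n)) ->
  (forall n x, D x -> `|F n x| <= M) ->
  (forall x, D x -> F n x @[n --> \oo] --> f x) ->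
  \int[mu]_(x in D) F n x @[n --> \oo] --> \int[mu]_(x in D) f x.
Proof.
move=> mD fD mF FM Ff.
have mf : measurable_fun D f by exact: (measurable_fun_cvg mF).
have iM : mu.-integrable D (EFin \o cst M).
  by apply: (@bounded_integrable _ _ `|M|) => //; exact: measurable_cst.
have [|||||intf _] := @dominated_convergence _ _ _ mu _ mD
    (fun n => EFin \o F n) (EFin \o f) (EFin \o cst M).
- by move=> n; exact/measurable_EFinP.
- exact/measurable_EFinP.
- by apply: aeW => x Dx; apply: cvg_EFin; [exact: nearW|exact: Ff].
- exact: iM.
- by apply: aeW => x n Dx; rewrite /= lee_fin; exact: FM.
move=> H; apply: fine_cvg; rewrite fineK//.
exact: integrable_fin_num.
Qed.

(** The map [k] and the weight [w] let one factor of a product integrand vary while the other is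
    frozen, as in s(x) eta(t) with eta fixed. *)
Lemma sigma_linear_Rintegral d' (U : measurableType d') D (k : T -> U)
    (w : T -> R) (M : R) : measurable D -> (mu D < +oo)%E -> measurable_fun setT k ->
  measurable_fun D w -> (forall x, D x -> `|w x| <= M) ->
  sigma_linear (fun f : U -> R => \int[mu]_(x in D) (f (k x) * w x)).
Proof.
move=> mD fD mk mw wM; split=> [a b f g [mf [Mf fM]] [mg [Mg gM]]|F f N mF FN Ff].
  have mfk : measurable_fun D (fun x => f (k x) * w x).
    by apply: measurable_funM => //; apply: measurable_funTS; apply: measurableT_comp.
  have mgk : measurable_fun D (fun x => g (k x) * w x).
    by apply: measurable_funM => //; apply: measurable_funTS; apply: measurableT_comp.
  have ifk : mu.-integrable D (EFin \o (fun x => f (k x) * w x)).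
    apply: (@bounded_integrable _ _ (Mf * M)) => // x Dx.
    by rewrite normrM ler_pM// wM.
  have igk : mu.-integrable D (EFin \o (fun x => g (k x) * w x)).
    apply: (@bounded_integrable _ _ (Mg * M)) => // x Dx.
    by rewrite normrM ler_pM// wM.
  rewrite -!RintegralZl// -RintegralD//.
  - by apply: eq_Rintegral => x _; ring.
  - exact: (integrableZl mD a ifk).
  - exact: (integrableZl mD b igk).
apply: (@Rintegral_bounded_cvg _ _ _ (N * M)) => //.
- move=> n; apply: measurable_funM => //; apply: measurable_funTS.
  exact: measurableT_comp.
- by move=> n x Dx; rewrite normrM ler_pM// wM.
- by move=> x Dx; apply: cvgMl => //; exact: Ff.
Qed.

End Rintegral_bounded.

Lemma measurable_set_gt {R : realType} d (T : measurableType d) (f : T -> R) c :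
  measurable_fun setT f -> measurable [set x | c < f x].
Proof.
move=> mf; rewrite (_ : [set x | _] = setT `&` f @^-1` `]c, +oo[).
  exact: mf.
by rewrite setTI; apply/seteqP; split=> x /=; rewrite in_itv/= andbT.
Qed.

(** * Open sets and continuous functions are Borel *)

Section rowvec_topology.
Context {R : realType} {d : nat}.

Lemma measurable_rV_forall (A : 'I_d -> set R) :
  (forall i, measurable (A i)) ->
  measurable [set x : 'rV[R]_d | forall i, A i (x ord0 i)].
Proof.
move=> mA; rewrite (_ : [set x | _] =
    \big[setI/setT]_(i < d) (rowvec_coord i @^-1` A i)).
  apply: bigsetI_measurable => i _; rewrite -[X in measurable X]setTI.
  exact: measurable_rowvec_coord.
rewrite -bigcap_seq; apply/seteqP; split => x /= Hx i.
  by move=> _; exact: Hx.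
by apply: (Hx i); rewrite /= mem_index_enum.
Qed.

Lemma ball_rV (x y : 'rV[R]_d) (e : R) : 0 < e ->
  ball x e y <-> forall i, `|x ord0 i - y ord0 i| < e.
Proof.
move=> e0; split=> [[_ xy] i|xy]; first exact: xy.
by split=> // i j; rewrite ord1; exact: xy.
Qed.

Lemma coord_le_norm (x : 'rV[R]_d) i : `|x ord0 i| <= `|x|.
Proof.
by rewrite [leRHS]/Num.norm/= mx_normrE; apply/bigmax_geP; right; exists (ord0, i).
Qed.

Lemma norm_rV_le (x : 'rV[R]_d) (M : R) : 0 <= M ->
  (forall i, `|x ord0 i| <= M) -> `|x| <= M.
Proof.
move=> M0 xM; rewrite [leLHS]/Num.norm/= mx_normrE.
by apply/bigmax_leP; split=> // -[i j] _ /=; rewrite ord1.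
Qed.

(** The sigma-algebra is generated by coordinates; an open set is a countable union of boxes with
    rational centres and half-widths 1/(k+1), those not contained in [U] being replaced by the empty
    set. *)
Lemma open_measurable_spacetime (U : set ('rV[R]_d * R)) :
  open U -> measurable (U : set (spacetime R d)).
Proof.
move=> oU.
pose box (c : 'rV[rat]_d * rat * nat) : set (spacetime R d) :=
  [set x : 'rV[R]_d | forall i, `](ratr (c.1.1 ord0 i) - c.2.+1%:R^-1 : R),
      (ratr (c.1.1 ord0 i) + c.2.+1%:R^-1 : R)[%classic (x ord0 i)] `*`
  `](ratr c.1.2 - c.2.+1%:R^-1 : R), (ratr c.1.2 + c.2.+1%:R^-1 : R)[%classic.
have mbox c : measurable (box c).
  apply: measurableX => //.
  exact: (@measurable_rV_forall (fun i => `](ratr (c.1.1 ord0 i) - c.2.+1%:R^-1 : R),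
      (ratr (c.1.1 ord0 i) + c.2.+1%:R^-1 : R)[%classic)).
rewrite (_ : U = \bigcup_c (if `[< box c `<=` U >] then box c else set0)).
  apply: countable_bigcupT_measurable; first exact: countableP.
  by move=> c; case: ifP.
apply/seteqP; split=> [p Up|p [c _]]; last first.
  by case: ifPn => // /asboolP; apply.
have /nbhs_ballP[e /= e0 eU] : nbhs p U by apply: open_nbhs_nbhs.
(* The centre is within 1/(k+1) of [p] and the half-width is 1/(k+1), hence the factor 2. *)
have [k ke] : exists k : nat, 2 * k.+1%:R^-1 < e.
  have e2 : 0 < e / 2 by rewrite divr_gt0.
  near \oo => k; exists k.
  rewrite mulrC -ltr_pdivlMr//; near: k.
  exact: (near_infty_natSinv_lt (PosNum e2)).
have k0 : 0 < k.+1%:R^-1 :> R by rewrite invr_gt0.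
have [dl dlE] : exists dl : R, dl = k.+1%:R^-1 by eexists.
rewrite -dlE in ke k0.
have apx (y : R) : exists q : rat, `|y - ratr q| < dl.
  have : y - dl < y + dl by rewrite ltrD2l gtrN.
  move=> /rat_in_itvoo[q]; rewrite in_itv/= => /andP[h1 h2].
  by exists q; rewrite ltr_norml; apply/andP; split; lra.
pose q i := sval (cid (apx (p.1 ord0 i))).
have qP i : `|p.1 ord0 i - ratr (q i)| < dl by rewrite /q; case: cid.
have [r rP] := apx p.2.
exists (\row_i q i, r, k) => //.
rewrite ifT; last first.
  apply/asboolP => -[x t] []/=; rewrite -dlE => Hx Ht; apply: eU; split=> /=.
    apply/ball_rV => // i; have := Hx i; have := qP i.
    rewrite !mxE in_itv/= !ltr_norml => /andP[h1 h2] /andP[h3 h4].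
    by apply/andP; split; lra.
  move: Ht rP; rewrite /ball/= in_itv/= !ltr_norml => /andP[h1 h2] /andP[h3 h4].
  by apply/andP; split; lra.
rewrite /box/= -dlE; split=> /= [i|]; rewrite ?mxE in_itv/=.
  by have := qP i; rewrite ltr_norml => /andP[h1 h2]; apply/andP; split; lra.
by move: rP; rewrite ltr_norml => /andP[h1 h2]; apply/andP; split; lra.
Unshelve. all: by end_near. Qed.

Lemma continuous_measurable_spacetime (f : 'rV[R]_d * R -> R) :
  continuous f -> measurable_fun [set: spacetime R d] f.
Proof.
move=> /continuousP cf; apply: (measurability _ (RGenOpens.measurableE R)).
move=> _ [_ [a [b ->] <-]]; rewrite setTI; apply: open_measurable_spacetime.
exact/cf/interval_open.
Qed.

Lemma measurable_fun_slice (t : R) :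
  measurable_fun [set: 'rV[R]_d] (fun x => (x, t) : spacetime R d).
Proof. by apply: measurable_fun_pair => //; exact: measurable_id. Qed.

Lemma continuous_measurable_rV (f : 'rV[R]_d -> R) :
  continuous f -> measurable_fun setT f.
Proof.
move=> cf; rewrite (_ : f = (fun p : spacetime R d => f p.1) \o (fun x => (x, 0)))//.
apply: measurableT_comp; last exact: measurable_fun_slice.
apply: (@continuous_measurable_spacetime (fun p => f p.1)) => x.
by apply: continuous_comp; [exact: cvg_fst|exact: cf].
Qed.

Lemma open_measurable_rV (U : set 'rV[R]_d) : open U -> measurable U.
Proof.
move=> oU; rewrite (_ : U = setT `&` (fun x => (x, 0) : spacetime R d) @^-1` (U `*` setT)).
  apply: measurable_fun_slice => //; apply: open_measurable_spacetime.
  rewrite (_ : U `*` setT = fst @^-1` U); last by apply/seteqP; split=> x //= -[].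
  by apply: open_comp => // x _; exact: cvg_fst.
by rewrite setTI; apply/seteqP; split=> x //= -[].
Qed.

End rowvec_topology.

(** * Horizontal test functions determine functionals of Borel functions *)

Section horizontal_test.
Context {R : realType} {d : nat} (w : base R d).

(* Horizontal factors of product test functions; on an open base they need not
   vanish outside it. *)
Definition xtest (chi : 'rV[R]_d -> R) : Prop :=
  smooth chi /\
  match w with
  | OpenBase _ => exists M : R, forall x, M < `|x| -> chi x = 0
  | TorusBase => Defs.periodic chi
  end.

(* is_tderiv puts mu_E on the fundamental cell for the torus only; on an open
   base mu_E is a charge on all of R^d * R. *)
Definition cell : set 'rV[R]_d :=
  match w with OpenBase _ => setT | TorusBase => carrier w end.

Lemma measurable_cell : measurable cell.
Proof.
rewrite /cell; case: w => [_|]; first exact: measurableT.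
apply: (measurable_rV_forall (A := fun=> [set y : R | 0 <= y < 1])) => i.
by rewrite (_ : [set y | _] = `[0, 1[%classic).
Qed.

Lemma xtest0 : xtest (fun=> 0).
Proof.
split; first exact: smooth_cst.
by case: w => // _; exists 0.
Qed.

Lemma xtestM f g : xtest f -> xtest g -> xtest (fun x => f x * g x).
Proof.
move=> [sf Hf] [sg Hg]; split; first exact: smoothM.
case: w Hf Hg => [_ [M f0] _|pf pg]; last by move=> k x; rewrite pf pg.
by exists M => x /f0 ->; rewrite mul0r.
Qed.

Lemma xtest_bump r f : xtest f -> xtest (fun x => bump (r * f x)).
Proof.
move=> [sf Hf]; split.
  by apply: (smooth_comp smooth_bump); apply: smoothM => //; exact: smooth_cst.
case: w Hf => [_ [M f0]|pf]; last by move=> k x; rewrite pf.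
by exists M => x /f0 ->; rewrite mulr0 bump_le0.
Qed.

Definition cube_test (n : nat) (x : 'rV[R]_d) : R :=
  \prod_(j < d) bump ((n%:R - x ord0 j) * (n%:R + x ord0 j)).

Lemma prod_bump_gt0 (F : 'I_d -> R) :
  0 < \prod_(j < d) bump (F j) <-> forall j, 0 < F j.
Proof.
split=> [p0 j|F0]; last by apply: prodr_gt0 => j _; rewrite bump_gt0.
rewrite ltNge; apply: contraTN p0 => Fj0.
by rewrite (bigD1 j)//= bump_le0// mul0r ltxx.
Qed.

Lemma cube_test_gt0 n x : 0 < cube_test n x <-> forall j, `|x ord0 j| < n%:R.
Proof.
rewrite /cube_test prod_bump_gt0; split=> H j; have := H j.
  by have : 0 <= n%:R :> R by []; rewrite ltr_norml => ??; apply/andP; split; nra.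
by rewrite ltr_norml => /andP[h1 h2]; rewrite mulr_gt0//; lra.
Qed.

Lemma cube_test_ge0 n x : 0 <= cube_test n x.
Proof. by apply: prodr_ge0 => j _; exact: bump_ge0. Qed.

Lemma cube_test_far n x : n%:R < `|x| -> cube_test n x = 0.
Proof.
move=> nx; apply/eqP; rewrite eq_le cube_test_ge0 andbT leNgt; apply/negP.
move=> /cube_test_gt0 H; move: nx; apply/negP; rewrite -leNgt.
by apply: norm_rV_le => // i; rewrite ltW.
Qed.

Lemma smooth_cube_test n : smooth (cube_test n).
Proof.
apply: smooth_prod => j.
apply: (smooth_coord j (f := fun y => bump ((n%:R - y) * (n%:R + y)))).
apply: (smooth_comp smooth_bump); apply: smoothM; apply: smoothD;
  by [exact: smooth_cst|exact: smooth_id|apply: smoothN; exact: smooth_id].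
Qed.

(** Half-spaces generate the Borel sets, so each is exhausted by positivity sets of test functions.
    On the torus, for [c >= 0] the profile in x_i has compact support in (0, 1) and is periodised by
    [smooth_frac]; for [c < 0] the half-space contains the whole cell, and the constant 1 serves. *)
Lemma cell_ray_cover (i : 'I_d) (c : R) :
  exists2 p : nat -> 'rV[R]_d -> R, forall n, xtest (p n) &
    [set x : 'rV[R]_d | c < x ord0 i] `&` cell = \bigcup_n ([set x | 0 < p n x] `&` cell).
Proof.
rewrite /cell /xtest; case: w => [_|].
  exists (fun n (x : 'rV[R]_d) => bump (x ord0 i - c) * cube_test n x) => [n|].
    split; last by exists n%:R => x xn; rewrite cube_test_far// mulr0.
    apply: smoothM; last exact: smooth_cube_test.
    apply: (smooth_coord i (f := fun y => bump (y - c))).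
    apply: (smooth_comp smooth_bump).
    by apply: smoothD; [exact: smooth_id|exact: smooth_cst].
  apply/seteqP; split=> [x [/= cx _]|x [n _ [/= p0 _]]].
    have [n xn] : exists n : nat, `|x| < n%:R.
      near \oo => n; exists n; near: n; exact: nbhs_infty_gtr.
    exists n => //; split=> //=; rewrite mulr_gt0 ?bump_gt0 ?subr_gt0//.
    by apply/cube_test_gt0 => j; apply: le_lt_trans xn; exact: coord_le_norm.
  split=> //; move: p0; have [//|xc] := ltP c (x ord0 i).
  by rewrite bump_le0 ?mul0r ?ltxx// subr_le0.
have [dl dlE] : exists dl : nat -> R, forall n, dl n = n.+1%:R^-1 by eexists.
pose f (n : nat) (y : R) := bump (y - (Num.max c 0 + dl n)) * bump (1 - dl n - y).
have n0 (n : nat) : 0 < dl n :> R by rewrite dlE invr_gt0.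
have m0 : 0 <= Num.max c 0 by rewrite le_max lexx orbT.
have cm : c <= Num.max c 0 by rewrite le_max lexx.
exists (fun n (x : 'rV[R]_d) => if c < 0 then 1 else f n (frac (x ord0 i))) => [n|].
  split.
    case: (ltP c 0) => _; first exact: smooth_cst.
    apply: (smooth_coord i (f := fun y => f n (frac y))).
    apply: (@smooth_frac _ _ (Num.max c 0 + dl n) (1 - dl n)).
    - by have := n0 n; lra.
    - by have := n0 n; lra.
    - apply: smoothM; apply: (smooth_comp smooth_bump); apply: smoothD;
        by [exact: smooth_cst|exact: smooth_id|apply: smoothN; exact: smooth_id].
    - move=> y /negP; rewrite negb_and -!ltNge => /orP[h|h].
        by rewrite /f bump_le0 ?mul0r// subr_le0 ltW.
      by rewrite /f [X in _ * X]bump_le0 ?mulr0// subr_le0 ltW.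
  by move=> k x; rewrite !mxE fracDz.
have fgt0 n y : 0 < f n y -> Num.max c 0 < y.
  rewrite /f; have [h|h] := ltP (Num.max c 0 + dl n) y.
    by have := n0 n; lra.
  by rewrite bump_le0 ?mul0r ?ltxx// subr_le0.
apply/seteqP; split=> [x [/= cx xC]|x [n _ [/= p0 xC]]]; last first.
  split=> //; have /andP[x0 x1] := xC i.
  move: p0; case: ifPn => [c0 _|_ /fgt0]; first exact: lt_le_trans x0.
  by rewrite frac_id// => /(le_lt_trans cm).
have /andP[x0 x1] := xC i.
have [c0|c0] := ltP c 0; first by exists 0%N => //; split=> //=; rewrite ltr01.
have [n nx] : exists n : nat, dl n < Num.min (x ord0 i - c) (1 - x ord0 i).
  have e0 : 0 < Num.min (x ord0 i - c) (1 - x ord0 i).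
    by rewrite lt_min !subr_gt0 cx.
  near \oo => n; exists n; rewrite dlE; near: n.
  exact: (near_infty_natSinv_lt (PosNum e0)).
exists n => //; split=> //=; rewrite /f frac_id ?x0// (max_l c0).
move: nx; rewrite lt_min => /andP[h1 h2].
by rewrite mulr_gt0 ?bump_gt0//; lra.
Unshelve. all: by end_near. Qed.

(** The sets that agree on the cell with some [{chi > 0}] form a pi-system generating the Borel
    sets, and [J] vanishes on their indicators, which on the cell are limits of [bump (n chi)]. *)
Lemma xtest_zero (J : ('rV[R]_d -> R) -> R) : sigma_linear J ->
  (forall f g, {in cell, f =1 g} -> J f = J g) ->
  (forall chi, xtest chi -> J chi = 0) ->
  forall f, bounded_measurable f -> J f = 0.
Proof.
move=> JL Jloc Jtest.
pose G : set_system 'rV[R]_d := [set A | measurable A /\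
  exists2 chi, xtest chi & A `&` cell = [set x | 0 < chi x] `&` cell].
have measT chi : xtest chi -> measurable_fun setT chi.
  by move=> [schi _]; apply: continuous_measurable_rV; exact: smooth_continuous.
have mpos chi : xtest chi -> measurable [set x | 0 < chi x].
  by move=> /measT; exact: measurable_set_gt.
have JG A : G A -> J (\1_A) = 0.
  move=> [mA [chi tchi Achi]].
  rewrite (Jloc _ (\1_[set x | 0 < chi x])); last first.
    move=> x xC; rewrite !indicE; congr (nat_of_bool _)%:R.
    have : (x \in A `&` cell) = (x \in [set x | 0 < chi x] `&` cell) by rewrite Achi.
    by rewrite !in_setI xC !andbT.
  have := JL.2 (fun n x => bump (n%:R * chi x)) (\1_[set x | 0 < chi x]) 1.
  have -> : (fun n : nat => J (fun x => bump (n%:R * chi x))) = cst 0.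
    by apply/funext => n; rewrite Jtest//; exact: xtest_bump.
  move=> H; apply: (cst_cvg_eq0 (H _ _ _)).
  - by move=> n; apply: measT; exact: xtest_bump.
  - by move=> n x; rewrite ger0_norm ?bump_ge0// ltW// bump_lt1.
  - by move=> x; rewrite indicE mem_setE; exact: bump_cvg.
have IG : setI_closed G.
  move=> A B [mA [f tf Af]] [mB [g tg Bg]]; split; first exact: measurableI.
  (* The plain product of [f] and [g] would be positive also where both are negative; [bump]
     truncates first. *)
  exists (fun x => bump (1 * f x) * bump (1 * g x)).
    by apply: xtestM; exact: xtest_bump.
  rewrite setIIl Af Bg -setIIl; congr (_ `&` _).
  apply/seteqP; split=> x /=; rewrite !mul1r.
    by move=> [f0 g0]; rewrite mulr_gt0// bump_gt0.
  have [f0|f0] := ltP 0 (f x); last by rewrite bump_le0 ?mul0r ?ltxx.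
  have [g0|g0] := ltP 0 (g x); last by rewrite (bump_le0 g0) ?mulr0 ?ltxx.
  by [].
have mG : @measurable _ 'rV[R]_d = <<s G >>.
  apply/seteqP; split; last first.
    by apply: smallest_sub; [exact: sigma_algebra_measurable|move=> A []].
  have mid : measurable_fun [set: g_sigma_algebraType G] (id : g_sigma_algebraType G -> 'rV[R]_d).
    apply: measurable_fun_rowvecP => i.
    apply: (measurability _ (RGenOInfty.measurableE R)) => //.
    move=> _ [_ [c ->] <-]; rewrite setTI.
    have [p tp cover] := cell_ray_cover i c.
    (* The part of the half-space off the cell belongs to [G] with [chi = 0]; the part in the cell
       is the countable union given by [cell_ray_cover]. *)
    rewrite (_ : _ @^-1` _ = ([set x : 'rV[R]_d | c < x ord0 i] `&` ~` cell) `|`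
       \bigcup_n ([set x | 0 < p n x] `&` cell)); last first.
      rewrite -cover -setIUr setUC setUv setIT.
      by apply/seteqP; split=> x /=; rewrite in_itv/= andbT.
    apply: measurableU.
      apply: sub_sigma_algebra; split.
        apply: measurableI; last by apply: measurableC; exact: measurable_cell.
        exact: (measurable_set_gt _ (measurable_rowvec_coord i)).
      exists (fun=> 0); first exact: xtest0.
      rewrite -setIA setICl setI0; apply/esym/seteqP; split=> x //= -[].
      by rewrite ltxx.
    apply: bigcupT_measurable => n; apply: sub_sigma_algebra; split.
      by apply: measurableI; [exact: mpos|exact: measurable_cell].
    by exists (p n) => //; rewrite -setIA setIid.
  move=> A mA; have := mid measurableT A mA.
  by rewrite setTI.
apply: (sigma_linear_dynkin JL mG IG) => //.
(* The constant 1 is a test function on the torus. On an open base it lacks bounded support and is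
   reached through the cubes [{cube_test n > 0}]. *)
move: Jloc Jtest JG; rewrite /G /cell /xtest; case: w => [_|] Jloc Jtest JG; last first.
  by apply: Jtest; split; [exact: smooth_cst|].
have := JL.2 (fun n => \1_[set x | 0 < cube_test n x]) (fun=> 1) 1.
have tc n : smooth (cube_test n) /\ exists M : R, forall x, M < `|x| -> cube_test n x = 0.
  by split; [exact: smooth_cube_test|exists n%:R => x; exact: cube_test_far].
have mc n : measurable [set x | 0 < cube_test n x].
  apply: measurable_set_gt; apply: continuous_measurable_rV; apply: smooth_continuous.
  exact: smooth_cube_test.
have -> : (fun n : nat => J \1_[set x | 0 < cube_test n x]) = cst 0.
  by apply/funext => n; apply: JG; split=> //; exists (cube_test n).
move=> H; apply: (cst_cvg_eq0 (H _ _ _)).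
- by move=> n; exact: measurable_indic.
- by move=> n x; rewrite indicE; case: (_ \in _); rewrite ?normr1 ?normr0.
- move=> x; apply: cvg_near_cst; near=> n; rewrite indicE mem_set//=.
  apply/cube_test_gt0 => j; apply: (le_lt_trans (coord_le_norm x j)).
  by near: n; exact: nbhs_infty_gtr.
Unshelve. all: by end_near. Qed.

End horizontal_test.

(** * Compactness, and finite measure of the base *)

Section compact_bounds.
Context {R : realType}.

Lemma continuous_compact_bound (V : normedModType R) (f : V -> R) (A : set V) :
  compact A -> continuous f -> exists M : R, forall x, A x -> `|f x| <= M.
Proof.
move=> cA cf; have cfA : compact (f @` A).
  by apply: continuous_compact => //; exact: continuous_subspaceT.
have [M [_ HM]] := compact_bounded cfA.
exists (M + 1) => x Ax; apply: (HM (M + 1)); first by rewrite ltrDl.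
by exists x.
Qed.

Lemma compact_ball_rV d (M : R) : compact [set x : 'rV[R]_d | `|x| <= M].
Proof.
apply: bounded_closed_compact.
  exists M; split; first exact: num_real.
  by move=> y My x /= xM; rewrite (le_trans xM)// ltW.
rewrite (_ : [set x | _] = (fun x => `|x|) @^-1` [set y | y <= M])//.
apply: closed_comp; last exact: closed_le.
by move=> x _; exact: norm_continuous.
Qed.

Lemma compact_ball_spacetime d (M N : R) :
  compact ([set x : 'rV[R]_d | `|x| <= M] `*` `[- N, N]%classic).
Proof. by apply: compact_setX; [exact: compact_ball_rV|exact: segment_compact]. Qed.

End compact_bounds.

Lemma periodic_frac {R : realType} d (f : 'rV[R]_d -> R) x :
  Defs.periodic f -> f x = f (\row_i frac (x ord0 i)).
Proof.
move=> /(_ (\row_i - Num.floor (x ord0 i)) x) <-; congr f.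
by apply/rowP => i; rewrite !mxE /frac intrN.
Qed.

Lemma norm_row_frac {R : realType} d (x : 'rV[R]_d) :
  `|\row_i frac (x ord0 i)| <= 1.
Proof.
apply: norm_rV_le => // i; rewrite mxE.
by have /andP[h0 h1] := frac_itv (x ord0 i); rewrite ger0_norm// ltW.
Qed.

Lemma xtest_bounded {R : realType} d (w : base R d) chi : xtest w chi ->
  exists C : R, forall x, `|chi x| <= C.
Proof.
move=> [/smooth_continuous cchi].
have H M := continuous_compact_bound (@compact_ball_rV R d M) cchi.
case: w => [_ [M chi0]|pchi].
  have [C HC] := H M; exists (Num.max C 0) => x.
  rewrite le_max; have [xM|xM] := leP `|x| M; first by rewrite HC.
  by rewrite chi0// normr0 lexx orbT.
have [C HC] := H 1; exists C => x; rewrite periodic_frac//.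
exact/HC/norm_row_frac.
Qed.

Section carrier_measure.
Context {R : realType} {d : nat} (w : base R d).
Hypothesis hw : wf_base w.

Lemma measurable_carrier : measurable (carrier w).
Proof.
case: w hw => [om [oom _]|_]; first exact: open_measurable_rV.
exact: (measurable_cell TorusBase).
Qed.

Lemma carrier_norm_le : exists2 M : R, 0 <= M & forall x, carrier w x -> `|x| <= M.
Proof.
case: w hw => [om [_ [M [_ HM]]]|_].
  exists (Num.max 0 M + 1); first by rewrite addr_ge0// le_max lexx.
  move=> x omx; apply: (HM (Num.max 0 M + 1)) => //.
  by rewrite (@le_lt_trans _ _ (Num.max 0 M)) ?ltrDl// le_max lexx orbT.
exists 1 => // x Hx; apply: norm_rV_le => // i.
by have /andP[x0 x1] := Hx i; rewrite ger0_norm// ltW.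
Qed.

Lemma carrier_lty : (lebesgue_rV R d (carrier w) < +oo)%E.
Proof.
have [M M0 cM] := carrier_norm_le.
pose B := [set x : 'rV[R]_d | forall i, `[- M, M]%classic (x ord0 i)].
apply: (@le_lt_trans _ _ (lebesgue_rV R d B)).
  apply: le_measure; rewrite ?inE; first exact: measurable_carrier.
    exact: (@measurable_rV_forall _ _ (fun=> `[- M, M]%classic)).
  move=> x /cM xM i /=; rewrite in_itv/= -ler_norml.
  by rewrite (le_trans (coord_le_norm _ _)).
rewrite /B (lebesgue_rV_box (A := fun=> `[- M, M]%classic))//.
rewrite ltey_eq; apply/orP; left.
apply: (big_ind (fun x : \bar R => x \is a fin_num)) => //.
  by move=> x y; exact: fin_numM.
by move=> i _; rewrite lebesgue_measure_itv/=; case: ifP.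
Qed.

Lemma measurable_cylinder : measurable (cylinder w).
Proof. by apply: measurableX; [exact: measurable_carrier|exact: measurable_itv]. Qed.

Lemma lebesgue_measure01 : lebesgue_measure (`]0%R, 1%R[%classic : set R) = 1%E.
Proof. by rewrite lebesgue_measure_itv/= lte_fin ltr01 sube0. Qed.

Lemma lebesgue01_lty : (lebesgue_measure (`]0%R, 1%R[%classic : set R) < +oo)%E.
Proof. by rewrite lebesgue_measure01 ltry. Qed.

Lemma volX (A : set 'rV[R]_d) : measurable A ->
  vol (A `*` `]0%R, 1%R[%classic) = lebesgue_rV R d A.
Proof.
move=> mA; rewrite /vol/= product_measure1E//=.
by rewrite lebesgue_measure01 mule1.
Qed.

Lemma vol_lty (E : set (spacetime R d)) : measurable E -> E `<=` cylinder w ->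
  (vol E < +oo)%E.
Proof.
move=> mE Ec; apply: (@le_lt_trans _ _ (vol (cylinder w))).
  by apply: le_measure; rewrite ?inE//; exact: measurable_cylinder.
by rewrite volX; [exact: carrier_lty|exact: measurable_carrier].
Qed.

Lemma carrier_cell : carrier w `<=` cell w.
Proof. by rewrite /cell; case: w. Qed.

End carrier_measure.

(** * Testing the derivative measure against products s(x) eta(t) *)

Section tderiv_core.
Context {R : realType} {d : nat} (w : base R d).
Hypothesis hw : wf_base w.
Variables (E : set (spacetime R d)) (nu : {charge set (spacetime R d) -> \bar R}).
Hypotheses (mE : measurable E) (Ew : E `<=` cylinder w) (hnu : is_tderiv w E nu).

Let jp := jordan_pos (hahn_setsP nu).
Let jn := jordan_neg (hahn_setsP nu).

Lemma finite_measure_lty d' (T : measurableType d') (m : {finite_measure set T -> \bar R}) A :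
  measurable A -> (m A < +oo)%E.
Proof. by move=> mA; rewrite ltey_eq fin_num_measure. Qed.

(** On the torus [nu] vanishes on every measurable set off the cell, in particular on intersections
    with the Hahn sets; on an open base the complement is empty. *)
Lemma jordan_cell0 : jp (~` (cell w `*` setT)) = 0%E /\ jn (~` (cell w `*` setT)) = 0%E.
Proof.
have mC : measurable (~` (cell w `*` setT) : set (spacetime R d)).
  by apply: measurableC; apply: measurableX => //; exact: measurable_cell.
have [mP mN] : measurable (hahn_posset nu) /\ measurable (hahn_negset nu).
  by have [[mP _] [mN _] _ _] := hahn_setsP nu.
have H B : measurable B -> nu (~` (cell w `*` setT) `&` B) = 0%E.
  move=> mB; move: hnu.1 mC; rewrite /cell; case: (w) => [om _|H] mC.
    by rewrite setXTT setCT set0I charge0.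
  apply: H; first exact: measurableI.
  by rewrite setIAC setICl set0I.
rewrite /jp /jn jordan_posE jordan_negE cjordan_posE cjordan_negE /crestr0.
by rewrite !mem_set// /crestr !H// oppe0.
Qed.

(** [xtest_zero] requires a functional that depends on values over the cell only; this brings the
    charge integral into that form. *)
Lemma Rintegral_cell (f : spacetime R d -> R) : measurable_fun setT f ->
  (exists M : R, forall p, `|f p| <= M) ->
  \int[jp]_p f p = \int[jp]_(p in cell w `*` setT) f p /\
  \int[jn]_p f p = \int[jn]_(p in cell w `*` setT) f p.
Proof.
move=> mf [M fM].
have mC : measurable (~` (cell w `*` setT) : set (spacetime R d)).
  by apply: measurableC; apply: measurableX => //; exact: measurable_cell.
have [p0 n0] := jordan_cell0.
rewrite -[cell w `*` setT]setCK -setTD.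
split; congr fine; apply: negligible_integral => //;
  by apply: (@bounded_integrable _ _ _ _ _ _ M) => //; exact: finite_measure_lty.
Qed.

Lemma tsupport_compact (phi : 'rV[R]_d * R -> R) (M N : R) :
  (forall x t, M < `|x| \/ N < `|t| -> phi (x, t) = 0) -> compact (tsupport phi).
Proof.
move=> phi0; apply: (subclosed_compact _ (@compact_ball_spacetime R d M N)).
  exact: closed_closure.
have cB := compact_closed (@norm_hausdorff _ _) (@compact_ball_spacetime R d M N).
rewrite [X in _ `<=` X](closure_id _).1//; apply: closure_subset => -[x t] /= nz.
split => /=; first by rewrite leNgt; apply: contra_neqN nz => ?; apply: phi0; left.
rewrite in_itv/= -ler_norml leNgt; apply: contra_neqN nz => ?.
by apply: phi0; right.
Qed.

Lemma xtest_cyl_test (chi : 'rV[R]_d -> R) (eta : R -> R) (N : R) :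
  xtest w chi -> smooth eta -> (forall t, N < `|t| -> eta t = 0) ->
  cyl_test w (fun p => chi p.1 * eta p.2).
Proof.
move=> [schi Hchi] seta eta0; split.
  by apply: smoothM; [exact: smooth_fst|exact: smooth_snd].
case: (w) Hchi => [_ [M chi0]|pchi].
  apply: (@tsupport_compact _ M N) => x t /= [/chi0 ->|/eta0 ->].
    by rewrite mul0r.
  by rewrite mulr0.
split=> [t k x|]; first by rewrite /= pchi.
by exists N => x t /eta0 /= ->; rewrite mulr0.
Qed.

Lemma partial_t_prod (chi : 'rV[R]_d -> R) (eta : R -> R) p :
  smooth chi -> smooth eta ->
  partial_t (fun p => chi p.1 * eta p.2) p = chi p.1 * 'D_1 eta p.2.
Proof.
move=> schi seta; rewrite /partial_t.
have df : differentiable (fun p : 'rV[R]_d * R => chi p.1) p.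
  exact/smooth_differentiable/smooth_fst.
have dg : differentiable (fun p : 'rV[R]_d * R => eta p.2) p.
  exact/smooth_differentiable/smooth_snd.
rewrite -[LHS]/('D_(0, 1) ((fun p => chi p.1) * (fun p => eta p.2)) p).
rewrite deriveM; [|exact: diff_derivable..].
have -> : 'D_(0, 1) (fun p : 'rV[R]_d * R => chi p.1) p = 0.
  have dc : differentiable chi p.1 by exact: smooth_differentiable.
  have dfst : differentiable (fst : 'rV[R]_d * R -> _) p.
    by apply: linear_differentiable; move=> ?; exact: cvg_fst.
  rewrite deriveE// -[fun p => _]/(chi \o fst) diff_comp//=.
  by rewrite (diff_lin (f := fst))//=; [rewrite linear0|move=> ?; exact: cvg_fst].
have -> : 'D_(0, 1) (fun p : 'rV[R]_d * R => eta p.2) p = 'D_1 eta p.2.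
  have de : differentiable eta p.2 by exact: smooth_differentiable.
  have dsnd : differentiable (snd : 'rV[R]_d * R -> _) p.
    by apply: linear_differentiable; move=> ?; exact: cvg_snd.
  rewrite deriveE// -[fun p => _]/(eta \o snd) diff_comp//= deriveE//.
  by rewrite (diff_lin (f := snd))//; move=> ?; exact: cvg_snd.
by rewrite scaler0 addr0.
Qed.

Lemma smooth_continuous1 (eta : R -> R) : smooth eta -> continuous ('D_1 eta).
Proof. by move=> seta; apply: smooth_continuous; exact: smooth_derive. Qed.

Let mcell : measurable (cell w `*` setT : set (spacetime R d)).
Proof. by apply: measurableX => //; exact: measurable_cell. Qed.

Lemma measurable_snd_comp (D : set (spacetime R d)) (eta : R -> R) : continuous eta ->
  measurable_fun D (fun p => eta p.2).
Proof.
move=> ce; apply: measurable_funTS; apply: measurableT_comp => //.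
exact: continuous_measurable_fun.
Qed.

(** With [eta] fixed, the difference of the two sides is a [sigma_linear] functional of [s] that
    vanishes on horizontal test functions, so [xtest_zero] applies. *)
Lemma tderiv_identity (s : 'rV[R]_d -> R) (eta : R -> R) (N : R) :
  bounded_measurable s -> smooth eta -> (forall t, N < `|t| -> eta t = 0) ->
  \int[vol]_(p in E) (s p.1 * 'D_1 eta p.2) =
  charge_integral nu (cell w `*` setT) (fun p => s p.1 * eta p.2).
Proof.
move=> bs seta eta0.
have ceta : continuous eta by exact: smooth_continuous.
have cD : continuous ('D_1 eta) by exact: smooth_continuous1.
have [B HB] := continuous_compact_bound (@segment_compact _ (-N) N) ceta.
have {}HB t : `|eta t| <= Num.max B 0.
  rewrite le_max; have [tN|tN] := leP `|t| N; last by rewrite eta0// normr0 lexx orbT.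
  by rewrite HB//= in_itv/= -ler_norml.
have [B' HB'] := continuous_compact_bound (@segment_compact _ 0 1) cD.
have {}HB' p : E p -> `|'D_1 eta p.2| <= B'.
  move=> /Ew[_] /=; rewrite in_itv/= => /andP[p0 p1].
  by apply: HB'; rewrite /= in_itv/= !ltW.
apply/eqP; rewrite -subr_eq0; apply/eqP; move: s bs.
apply: (@xtest_zero _ _ w) => /=.
- apply: sigma_linearB; last apply: sigma_linearB.
  + apply: (sigma_linear_Rintegral (M := B') mE (vol_lty hw mE Ew)) => //.
    apply: (@measurable_snd_comp _ _ cD).
  + apply: (sigma_linear_Rintegral (M := Num.max B 0) mcell) => //;
      [exact: finite_measure_lty|apply: (@measurable_snd_comp _ _ ceta)].
  + apply: (sigma_linear_Rintegral (M := Num.max B 0) mcell) => //;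
      [exact: finite_measure_lty|apply: (@measurable_snd_comp _ _ ceta)].
- move=> f g fg; congr (_ - (_ - _)); apply: eq_Rintegral => p; rewrite inE => Hp;
    rewrite fg// inE.
  + by apply: carrier_cell; have [] := Ew Hp.
  + by have [] := Hp.
  + by have [] := Hp.
- move=> chi tchi; have schi := tchi.1.
  have := hnu.2 _ (xtest_cyl_test tchi seta eta0).
  under eq_Rintegral do rewrite partial_t_prod//.
  move=> ->; rewrite /charge_integral.
  have [] := @Rintegral_cell (fun p => chi p.1 * eta p.2).
  + apply: (@continuous_measurable_spacetime _ _ (fun p => chi p.1 * eta p.2)).
    apply: smooth_continuous.
    by apply: smoothM; [exact: smooth_fst|exact: smooth_snd].
  + have [C HC] := xtest_bounded tchi.
    by exists (C * Num.max B 0) => p; rewrite normrM ler_pM.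
  + by move=> -> ->; rewrite subrr.
Qed.

End tderiv_core.

(** * Functionals vanishing on rays and on rectangles *)

Section generation.
Context {R : realType}.

Lemma sigma_linear_ray (J : (measurableTypeR R -> R) -> R) : sigma_linear J ->
  (forall b : R, J \1_`]b, +oo[%classic = 0) ->
  forall f, bounded_measurable f -> J f = 0.
Proof.
move=> JL Jray; apply: (sigma_linear_dynkin JL (RGenOInfty.measurableE R)).
- move=> _ _ [a ->] [b ->]; exists (Num.max a b); apply/seteqP; split=> x /=;
    rewrite !in_itv/= !andbT gt_max; first by move=> [-> ->].
  by move=> /andP[].
- have := JL.2 (fun n : nat => \1_`](- n%:R)%R, +oo[%classic) (fun=> 1) 1.
  have -> : (fun n : nat => J \1_`](- n%:R)%R, +oo[%classic) = cst 0.
    by apply/funext => n; rewrite Jray.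
  move=> H; apply: (cst_cvg_eq0 (H _ _ _)).
  + by move=> n; exact: measurable_indic.
  + by move=> n x; rewrite indicE; case: (_ \in _); rewrite ?normr1 ?normr0.
  + move=> x; apply: cvg_near_cst; near=> n; rewrite indicE mem_set//=.
    rewrite in_itv/= andbT ltrNl; apply: (@le_lt_trans _ _ `|x|).
      by rewrite -normrN ler_norm.
    by near: n; exact: nbhs_infty_gtr.
- by move=> _ [b ->].
Unshelve. all: by end_near. Qed.

Lemma sigma_linear_rect d1 d2 (T1 : measurableType d1) (T2 : measurableType d2)
    (J : (T1 * T2 -> R) -> R) : sigma_linear J ->
  (forall A B, measurable A -> measurable B ->
     J (fun p => \1_A p.1 * \1_B p.2) = 0) ->
  forall f, bounded_measurable f -> J f = 0.
Proof.
move=> JL Jrect; apply: (sigma_linear_dynkin JL (measurable_prod_measurableType T1 T2)).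
- move=> _ _ [A mA [B mB <-]] [A' mA' [B' mB' <-]].
  exists (A `&` A'); first exact: measurableI.
  by exists (B `&` B'); [exact: measurableI|rewrite setXI].
- rewrite -(Jrect _ _ measurableT measurableT); congr J.
  by apply/funext => p; rewrite !indicT mulr1.
- move=> _ [A mA [B mB <-]]; rewrite -(Jrect _ _ mA mB); congr J.
  apply/funext => p; rewrite !indicE in_setX.
  by do 2 case: (_ \in _); rewrite /= ?mulr0 ?mul0r ?mulr1.
Qed.

End generation.

(** * The test identity on the closed strip *)

Section strip.
Context {R : realType} {d : nat} (w : base R d).
Hypothesis hw : wf_base w.
Variables (E : set (spacetime R d)) (nu : {charge set (spacetime R d) -> \bar R}).
Hypotheses (mE : measurable E) (Ew : E `<=` cylinder w) (hnu : is_tderiv w E nu).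

Let mcell : measurable (cell w `*` setT : set (spacetime R d)).
Proof. by apply: measurableX => //; exact: measurable_cell. Qed.

Definition strip : set (spacetime R d) := cell w `*` `[0%R, 1%R]%classic.

Lemma measurable_strip : measurable strip.
Proof. by apply: measurableX; [exact: measurable_cell|exact: measurable_itv]. Qed.

(** The integral over [E] does not depend on the plateau index, so it equals the limit of the charge
    integrals. In this form affine [eta] are admissible. *)
Lemma tderiv_strip (s : 'rV[R]_d -> R) (eta : R -> R) :
  bounded_measurable s -> smooth eta ->
  \int[vol]_(p in E) (s p.1 * 'D_1 eta p.2) =
  charge_integral nu strip (fun p => s p.1 * eta p.2).
Proof.
move=> bs seta; have [ms [Ms sM]] := bs.
pose etan (n : nat) (t : R) : R := eta t * plateau n.+1 t.
have setan n : smooth (etan n) by apply: smoothM => //; exact: smooth_plateau.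
have etan0 n t : 2 < `|t| -> etan n t = 0.
  by move=> t2; rewrite /etan plateau_far// mulr0.
have ceta : continuous eta by exact: smooth_continuous.
have [B HB] := continuous_compact_bound (@segment_compact _ (-2) 2) ceta.
have B0 : 0 <= B.
  by apply: le_trans (HB 0 _); rewrite //= in_itv/= oppr_le0 !ler0n.
have etanB n t : `|etan n t| <= B.
  have [t2|/etan0 ->] := leP `|t| 2; last by rewrite normr0.
  rewrite /etan normrM -[leRHS]mulr1 ler_pM//.
    by apply: HB; rewrite /= in_itv/= -ler_norml.
  by have /andP[h0 h1] := plateau_itv n.+1 t; rewrite ger0_norm.
pose lim (p : spacetime R d) : R := s p.1 * (eta p.2 * (0 <= p.2 <= 1)%R%:R).
have cvg_strip (m : {finite_measure set (spacetime R d) -> \bar R}) :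
    \int[m]_(p in cell w `*` setT) (s p.1 * etan n p.2) @[n --> \oo] -->
    \int[m]_(p in strip) (s p.1 * eta p.2).
  rewrite (_ : \int[m]_(p in strip) _ = \int[m]_(p in cell w `*` setT) lim p).
    apply: (@Rintegral_bounded_cvg _ _ _ _ _ _ _ (Ms * B)) => //.
    - exact: finite_measure_lty.
    - move=> n; apply: measurable_funM.
        by apply: measurable_funTS; exact: measurableT_comp.
      exact: (@measurable_snd_comp _ _ _ _ (smooth_continuous (setan n))).
    - by move=> n p _; rewrite normrM ler_pM.
    - move=> p _; apply: cvgMr; apply: cvgMr; exact: plateau_cvg.
  rewrite (_ : strip = (cell w `*` setT) `&` (setT `*` `[0, 1]%classic)).
    rewrite Rintegral_mkcondr; apply: eq_Rintegral => p _.
    rewrite patchE /lim in_setX in_setT/= mem_setE in_itv/=.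
    by case: ifP => _; rewrite ?mulr1 ?mulr0.
  by rewrite /strip; apply/seteqP; split=> -[x t] /= [h1 h2]; split=> //; [exact: h1.1|exact: h2.2].
have const n : charge_integral nu (cell w `*` setT) (fun p => s p.1 * etan n p.2) =
    \int[vol]_(p in E) (s p.1 * 'D_1 eta p.2).
  rewrite -(tderiv_identity hw mE Ew hnu bs (setan n) (@etan0 n)).
  apply: eq_Rintegral => p; rewrite inE => /Ew[_ /=]; rewrite in_itv/= => /andP[p0 p1].
  congr (_ * _); apply: near_eq_derive; near=> t.
  rewrite /etan plateau1 ?mulr1//; apply/andP; split; apply: ltW; near: t.
    exact: lt_nbhsr.
  exact: lt_nbhsl.
have H : charge_integral nu (cell w `*` setT) (fun p => s p.1 * etan n p.2)
    @[n --> \oo] --> charge_integral nu strip (fun p => s p.1 * eta p.2).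
  by apply: cvgB; exact: cvg_strip.
move: H; under eq_fun do rewrite const.
by move=> /cvg_lim <-//; rewrite lim_cst.
Unshelve. all: by end_near. Qed.

End strip.

(** * The two horizontal faces of the cylinder *)

Section boundary.
Context {R : realType} {d : nat} (w : base R d).
Hypothesis hw : wf_base w.

(** Lateral boundary points of an open base project outside [om], so only the two faces lie over it.
    As sigma is 0 off the carrier, only these faces enter the boundary term. *)
Lemma cyl_boundary_carrier :
  cyl_boundary w `&` (carrier w `*` setT) = carrier w `*` [set 0; 1].
Proof.
case: w hw => [om [oom _]|_] /=; last first.
  by apply/seteqP; split=> -[x t] /=; [move=> [[]]|move=> []].
set Om : set ('rV[R]_d * R) := om `*` _.
have oOm : open Om.
  rewrite (_ : Om = fst @^-1` om `&` snd @^-1` `]0, 1[%classic); last first.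
    by apply/seteqP; split=> -[x t] [].
  apply: openI; apply: open_comp => //; try exact: interval_open.
  - by move=> ? _; exact: cvg_fst.
  - by move=> ? _; exact: cvg_snd.
have cl1 x t : closure Om (x, t) -> 0 <= t <= 1.
  move=> clO; have : closure (setT `*` `[0, 1]%classic : set ('rV[R]_d * R)) (x, t).
    apply: closure_subset clO => -[y u] [_ /=]; rewrite !in_itv/= => /andP[u0 u1].
    by rewrite !ltW.
  rewrite -(closure_id _).1; first by move=> [_]; rewrite /= in_itv.
  rewrite (_ : _ `*` _ = snd @^-1` `[0, 1]%classic).
    by apply: closed_comp => [y _|]; [exact: cvg_snd|exact: interval_closed].
  by apply/seteqP; split=> -[y u] //= [].
have cl2 x t : om x -> 0 <= t <= 1 -> closure Om (x, t).
  move=> omx /andP[t0 t1] B /nbhs_ballP[e /= e0 eB].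
  (* [u] moves [t] towards 1/2 by a fraction at most [e / 2]: it lands strictly inside (0, 1) and
     within [e] of [t]. *)
  pose u := t + (2^-1 - t) * Num.min 1 (e / 2).
  have m0 : 0 < Num.min 1 (e / 2) by rewrite lt_min ltr01 divr_gt0.
  have m1 : Num.min 1 (e / 2) <= 1 by rewrite ge_min lexx.
  have me : Num.min 1 (e / 2) <= e / 2 by rewrite ge_min lexx orbT.
  exists (x, u); split.
    split=> //=; rewrite in_itv/= /u; move: (Num.min _ _) m0 m1 me => m *.
    by apply/andP; split; nra.
  apply: eB; split=> /=; first exact: ballxx.
  rewrite /ball/= /u opprD addNKr normrN normrM.
  have : `|2^-1 - t| <= 1 by rewrite ler_norml; apply/andP; split; lra.
  rewrite (gtr0_norm m0); have := normr_ge0 (2^-1 - t).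
  by move: (Num.min _ _) (`|_|) m0 m1 me => m k *; nra.
rewrite (interior_id _).1//.
apply/seteqP; split=> -[x t] /=.
  move=> [[clO nO] [omx _]]; split=> //.
  have /andP[t0 t1] := cl1 _ _ clO.
  have [->|tn0] := eqVneq t 0; first by left.
  have [->|tn1] := eqVneq t 1; first by right.
  exfalso; apply: nO; split=> //=; rewrite in_itv/=.
  by rewrite lt_def tn0 t0/= lt_neqAle tn1.
move=> [omx t01]; split; last by [].
split; first by apply: cl2 => //; case: t01 => ->; rewrite ?lexx ler01.
by move=> [_ /=]; case: t01 => ->; rewrite in_itv/= ltxx ?andbF.
Qed.

Lemma strip_carrier : strip w `&` (carrier w `*` setT) =
  cylinder w `|` (carrier w `*` [set 0; 1]).
Proof.
rewrite /strip /cylinder; apply/seteqP; split=> -[x t] /=.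
  move=> [[_]]; rewrite !in_itv/= => /andP[t0 t1] [Cx _].
  have [->|tn0] := eqVneq t 0; first by right; split => //; left.
  have [->|tn1] := eqVneq t 1; first by right; split => //; right.
  by left; split=> //; rewrite lt_def tn0 t0/= lt_neqAle tn1.
rewrite !in_itv/= => -[[Cx /andP[t0 t1]]|[Cx]].
  by split; split=> //; [exact: carrier_cell|rewrite !ltW].
by case=> ->; split; split=> //; rewrite ?lexx ?ler01//; exact: carrier_cell.
Qed.

Lemma measurable_faces :
  measurable (carrier w `*` [set 0; 1] : set (spacetime R d)).
Proof.
apply: measurableX; first exact: measurable_carrier.
by apply: measurableU; exact: measurable_set1.
Qed.

End boundary.

(** * Calibration by the wetting density *)

Section calibration.
Context {R : realType} {d : nat} (w : base R d).
Hypothesis hw : wf_base w.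
Variables (E : set (spacetime R d)) (nu : {charge set (spacetime R d) -> \bar R}).
Hypotheses (mE : measurable E) (Ew : E `<=` cylinder w) (hnu : is_tderiv w E nu).
Variables (s0 s1 : 'rV[R]_d -> R) (c : R).
Hypotheses (ms0 : measurable_fun (carrier w) s0) (ms1 : measurable_fun (carrier w) s1).
Hypotheses (s0c : forall x, carrier w x -> `|s0 x| <= c)
  (s1c : forall x, carrier w x -> `|s1 x| <= c).

Let jp := jordan_pos (hahn_setsP nu).
Let jn := jordan_neg (hahn_setsP nu).
Local Notation sigma := (wetting w s0 s1).

Let ext (f : 'rV[R]_d -> R) : 'rV[R]_d -> R := f \_ (carrier w).

Lemma bounded_measurable_ext (f : 'rV[R]_d -> R) (M : R) : measurable_fun (carrier w) f ->
  (forall x, carrier w x -> `|f x| <= M) -> bounded_measurable (f \_ (carrier w) : _ -> R).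
Proof.
move=> mf fM; split.
  by apply/(measurable_restrictT _ _).1 => //; exact: measurable_carrier.
exists (Num.max M 0) => x; rewrite patchE le_max; case: ifPn => [|_].
  by rewrite inE => /fM ->.
by rewrite normr0 lexx orbT.
Qed.

Lemma wettingE p : sigma p = (p.2 - 1) * ext s0 p.1 + p.2 * ext s1 p.1.
Proof.
rewrite /wetting /ext !patchE in_setX in_setT andbT.
by case: ifP => // _; rewrite !mulr0 addr0.
Qed.

Lemma measurable_wetting : measurable_fun setT sigma.
Proof.
rewrite (_ : sigma = fun p => (p.2 - 1) * ext s0 p.1 + p.2 * ext s1 p.1); last first.
  by apply/funext => p; exact: wettingE.
have m2 : measurable_fun [set: spacetime R d] (fun p => p.2 : R) by exact: measurable_snd.
have [me0 _] := bounded_measurable_ext ms0 s0c.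
have [me1 _] := bounded_measurable_ext ms1 s1c.
apply: measurable_funD; apply: measurable_funM => //.
- exact: measurable_funB.
- by apply: (measurableT_comp me0).
- by apply: (measurableT_comp me1).
Qed.

(** Up to the sign of [s0], sigma is a convex combination of [s0] and [s1] at such heights. The
    maximum with 0 covers points off the carrier, where sigma is 0: nothing makes [c] nonnegative
    when the carrier is empty. *)
Lemma wetting_le p : 0 <= p.2 <= 1 -> `|sigma p| <= Num.max c 0.
Proof.
move=> /andP[t0 t1]; rewrite /wetting patchE; case: ifPn => [|_]; last first.
  by rewrite normr0 le_max lexx orbT.
rewrite inE => -[Cp _]; rewrite le_max; apply/orP; left.
have := s0c Cp; have := s1c Cp; rewrite !ler_norml => /andP[h1 h2] /andP[h3 h4].
by apply/andP; split; nra.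
Qed.

(** The strip and the topological boundary reach beyond the carrier, but sigma is 0 there; over the
    carrier the strip is the disjoint union of the open cylinder and the two faces. *)
Lemma Rintegral_wetting (m : {finite_measure set (spacetime R d) -> \bar R}) :
  \int[m]_(p in strip w) sigma p =
  \int[m]_(p in cylinder w) sigma p + \int[m]_(p in cyl_boundary w) sigma p.
Proof.
have restr D : \int[m]_(p in D) sigma p =
    \int[m]_(p in D `&` (carrier w `*` setT)) sigma p.
  rewrite Rintegral_mkcondr; apply: eq_Rintegral => p _.
  by rewrite /wetting !patchE; case: ifP.
have cylC : cylinder w `&` (carrier w `*` setT) = cylinder w.
  by apply: setIidl => -[x t] [].
have mcyl : measurable (cylinder w) by exact: measurable_cylinder.
have mfac := measurable_faces hw.
rewrite restr (restr (cyl_boundary w)) strip_carrier (cyl_boundary_carrier hw).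
rewrite Rintegral_setU//.
- apply: (@bounded_integrable _ _ _ _ _ _ (Num.max c 0)).
  + exact: measurableU.
  + by apply: finite_measure_lty; exact: measurableU.
  + by apply: measurable_funTS; exact: measurable_wetting.
  + move=> [x t] Hp; apply: wetting_le => /=.
    case: Hp => -[_ /=]; first by rewrite in_itv/= => /andP[? ?]; rewrite !ltW.
    by case=> ->; rewrite lexx ler01.
- apply/eqP/seteqP; split=> -[x t] //= [[_ /=]]; rewrite in_itv/= => /andP[t0 t1] [_].
  by case=> tE; move: t0 t1; rewrite tE ltxx.
Qed.

Lemma integrable_strip (m : {finite_measure set (spacetime R d) -> \bar R})
    (s : 'rV[R]_d -> R) (eta : R -> R) : bounded_measurable s -> continuous eta ->
  m.-integrable (strip w) (EFin \o (fun p => s p.1 * eta p.2)).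
Proof.
move=> [ms [M sM]] ceta.
have [B HB] := continuous_compact_bound (@segment_compact _ 0 1) ceta.
apply: (@bounded_integrable _ _ _ _ _ _ (M * B)).
- exact: measurable_strip.
- by apply: finite_measure_lty; exact: measurable_strip.
- apply: measurable_funM.
    by apply: measurable_funTS; exact: measurableT_comp.
  exact: (@measurable_snd_comp _ _ _ _ ceta).
- by move=> [x t] [_ /= t01]; rewrite normrM ler_pM// HB.
Qed.

Lemma charge_integral_stripD (f g : spacetime R d -> R) :
  jp.-integrable (strip w) (EFin \o f) -> jp.-integrable (strip w) (EFin \o g) ->
  jn.-integrable (strip w) (EFin \o f) -> jn.-integrable (strip w) (EFin \o g) ->
  charge_integral nu (strip w) (fun p => f p + g p) =
  charge_integral nu (strip w) f + charge_integral nu (strip w) g.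
Proof.
move=> *; rewrite /charge_integral !RintegralD//; try exact: measurable_strip.
by ring.
Qed.

Lemma calibration :
  charge_integral nu (cylinder w) sigma + charge_integral nu (cyl_boundary w) sigma =
  \int[vol]_(p in E) (s0 p.1 + s1 p.1).
Proof.
have b0 := bounded_measurable_ext ms0 s0c.
have b1 := bounded_measurable_ext ms1 s1c.
have sA : smooth (fun t : R => t - 1).
  by apply: smoothD; [exact: smooth_id|exact: smooth_cst].
have DA t : 'D_1 (fun t : R => t - 1) t = 1.
  rewrite -[LHS]/('D_1 ((id : R -> R) - (cst 1 : R -> R)) t) deriveB//.
  by rewrite derive_id derive_cst subr0.
have cA := smooth_continuous sA.
have sB : smooth (fun t : R => t) by exact: smooth_id.
have cB := smooth_continuous sB.
rewrite /charge_integral addrACA -opprD -!Rintegral_wetting.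
transitivity (charge_integral nu (strip w)
    (fun p => ext s0 p.1 * (p.2 - 1) + ext s1 p.1 * p.2)).
  by rewrite /charge_integral; congr (_ - _); apply: eq_Rintegral => p _;
    rewrite wettingE; ring.
rewrite (charge_integral_stripD (integrable_strip _ b0 cA) (integrable_strip _ b1 cB)
  (integrable_strip _ b0 cA) (integrable_strip _ b1 cB)).
rewrite -(tderiv_strip hw mE Ew hnu b0 sA) -(tderiv_strip hw mE Ew hnu b1 sB).
have bE (s : 'rV[R]_d -> R) : bounded_measurable s -> vol.-integrable E (EFin \o (fun p => s p.1)).
  move=> [ms [M sM]]; apply: (@bounded_integrable _ _ _ _ _ _ M) => //.
  - exact: (vol_lty hw mE Ew).
  - by apply: measurable_funTS; exact: measurableT_comp.
transitivity (\int[vol]_(p in E) ext s0 p.1 + \int[vol]_(p in E) ext s1 p.1).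
  by congr (_ + _); apply: eq_Rintegral => p _; rewrite ?DA ?derive_id mulr1.
rewrite -RintegralD//; [|exact: bE|exact: bE].
apply: eq_Rintegral => p; rewrite inE => /Ew[Cp _].
by rewrite /ext !patchE mem_set.
Qed.

Lemma charge_integral_le (D : set (spacetime R d)) (f : spacetime R d -> R) (k : R) :
  measurable D -> measurable_fun D f -> (forall p, D p -> `|f p| <= k) ->
  `|charge_integral nu D f| <= k * fine (charge_abs nu D).
Proof.
move=> mD mf fk.
have bound (m : {finite_measure set (spacetime R d) -> \bar R}) :
    `|\int[m]_(p in D) f p| <= k * fine (m D).
  have mfin : (m D < +oo)%E by exact: finite_measure_lty.
  have iF : m.-integrable D (EFin \o f) by exact: (bounded_integrable mD mfin mf fk).
  rewrite -Rintegral_cst//; apply: le_trans (le_normr_Rintegral mD iF) _.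
  apply: le_Rintegral => //.
  - apply: (@bounded_integrable _ _ _ _ _ _ k) => //; first exact: measurableT_comp.
    by move=> p /fk; rewrite normr_id.
  - by apply: (@bounded_integrable _ _ _ _ _ _ `|k|) => //; exact: measurable_cst.
rewrite /charge_abs /charge_variation /charge_integral/= fineD; last 2 first.
- exact: (@fin_num_measure _ _ _ jp).
- exact: (@fin_num_measure _ _ _ jn).
rewrite mulrDr (le_trans (ler_normB _ _))// lerD//.
- exact: (bound jp).
- exact: (bound jn).
Qed.

Lemma charge_abs_fin (D : set (spacetime R d)) : measurable D ->
  (0 <= charge_abs nu D)%E /\ charge_abs nu D \is a fin_num.
Proof.
move=> mD; rewrite /charge_abs /charge_variation/=; split.
  by apply: adde_ge0; exact: measure_ge0.
rewrite fin_numD; apply/andP; split.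
  exact: (@fin_num_measure _ _ _ jp).
exact: (@fin_num_measure _ _ _ jn).
Qed.

Lemma calibrated_bound :
  \int[vol]_(p in E) (s0 p.1 + s1 p.1) +
    (1 - Num.max c 0) * fine (charge_abs nu (cylinder w)) <=
  fine (charge_abs nu (cylinder w)) + charge_integral nu (cyl_boundary w) sigma.
Proof.
rewrite -calibration.
have mcyl : measurable (cylinder w) by exact: measurable_cylinder.
have : `|charge_integral nu (cylinder w) sigma| <=
    Num.max c 0 * fine (charge_abs nu (cylinder w)).
  apply: charge_integral_le => //.
    by apply: measurable_funTS; exact: measurable_wetting.
  move=> [x t] [_ /=]; rewrite in_itv/= => /andP[? ?].
  by apply: wetting_le; rewrite /= !ltW.
by rewrite ler_norml => /andP[_ ?]; lra.
Qed.

Lemma calibrated_eq : charge_abs nu (cylinder w) = 0%E ->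
  charge_integral nu (cyl_boundary w) sigma = \int[vol]_(p in E) (s0 p.1 + s1 p.1).
Proof.
move=> v0; rewrite -calibration -[LHS]add0r; congr (_ + _); apply/esym/eqP.
rewrite -normr_le0.
have mcyl : measurable (cylinder w) by exact: measurable_cylinder.
apply: (@le_trans _ _ (Num.max c 0 * fine (charge_abs nu (cylinder w)))).
  apply: charge_integral_le => //.
    by apply: measurable_funTS; exact: measurable_wetting.
  move=> [x t] [_ /=]; rewrite in_itv/= => /andP[? ?].
  by apply: wetting_le; rewrite /= !ltW.
by rewrite v0 mulr0.
Qed.

End calibration.

(** * Null sets from vanishing integrals *)

Section integral_facts.
Context {R : realType} d (T : measurableType d) (mu : {measure set T -> \bar R}).

Lemma Rintegral_indic (D A : set T) : measurable D -> measurable A ->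
  \int[mu]_(x in D) (\1_A x : R) = fine (mu (A `&` D)).
Proof. by move=> mD mA; rewrite /Rintegral integral_indic. Qed.

Lemma Rintegral_eq0 (D : set T) (f : T -> R) : measurable D ->
  mu.-integrable D (EFin \o f) -> (forall x, D x -> 0 <= f x) ->
  \int[mu]_(x in D) f x = 0 -> mu (D `&` [set x | f x != 0]) = 0%E.
Proof.
move=> mD iF f0 If0; have mf := measurable_int _ iF.
have mS : measurable (D `&` [set x | f x != 0]).
  have := emeasurable_neq mD mf 0%E.
  by congr measurable; apply/seteqP; split=> x /= [Dx]; rewrite eqe.
have : (\int[mu]_(x in D) `|(EFin \o f) x| = 0)%E.
  rewrite -[RHS]/(0%R%:E) -If0 /Rintegral fineK; last exact: integrable_fin_num.
  by apply: eq_integral => x; rewrite inE => /f0 fx0; rewrite /= ger0_norm.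
move/(ae_eq_integral_abs mu mD mf) => [N [mN N0 sub]].
apply: subset_measure0 N0 => // x [Dx /= fx]; apply: sub => /= /(_ Dx) [].
by move/eqP; apply/negP.
Qed.

End integral_facts.

(** * Zero variation forces a vertical cylinder *)

Section zero_variation.
Context {R : realType} {d : nat} (w : base R d).
Hypothesis hw : wf_base w.
Variables (E : set (spacetime R d)) (nu : {charge set (spacetime R d) -> \bar R}).
Hypotheses (mE : measurable E) (Ew : E `<=` cylinder w) (hnu : is_tderiv w E nu).
Hypothesis nu0 : charge_abs nu (cylinder w) = 0%E.

Let jp := jordan_pos (hahn_setsP nu).
Let jn := jordan_neg (hahn_setsP nu).

Let mcyl : measurable (cylinder w). Proof. exact: measurable_cylinder. Qed.

Let jp0 : jp (cylinder w) = 0%E.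
Proof.
apply/eqP; rewrite eq_le measure_ge0 andbT -nu0 /charge_abs /charge_variation/=.
by rewrite leeDl// measure_ge0.
Qed.

Let jn0 : jn (cylinder w) = 0%E.
Proof.
apply/eqP; rewrite eq_le measure_ge0 andbT -nu0 /charge_abs /charge_variation/=.
by rewrite leeDr// measure_ge0.
Qed.

(* mu_E then lives on the two faces, where eta agrees with its affine
   interpolant. *)
Lemma zero_variation_slope (A : set 'rV[R]_d) (eta : R -> R) :
  measurable A -> smooth eta ->
  \int[vol]_(p in E) (\1_A p.1 * 'D_1 eta p.2) =
  (eta 1 - eta 0) * \int[vol]_(p in E) \1_A p.1.
Proof.
move=> mA seta.
(* Cutting [A] down to the carrier does not change the integrals over [E], and a contributing point
   of the strip off the cylinder then lies on a face. *)
have mAw : measurable (A `&` carrier w) by apply: measurableI => //; exact: measurable_carrier.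
have bs := @bounded_measurable_indic R _ _ _ mAw.
pose k := eta 1 - eta 0.
pose zeta (t : R) := eta 0 + k * t.
have szeta : smooth zeta.
  by apply: smoothD; [|apply: smoothM]; [exact: smooth_cst..|exact: smooth_id].
have Dzeta t : 'D_1 zeta t = k.
  have H : is_derive t (1 : R) zeta (0 + k *: 1).
    apply: is_deriveD; exact: is_deriveZ.
  by have [_ ->] := H; rewrite add0r -[k *: 1]/(k * 1) mulr1.
have restr (f : R -> R) : \int[vol]_(p in E) (\1_A p.1 * f p.2) =
    \int[vol]_(p in E) (\1_(A `&` carrier w) p.1 * f p.2).
  apply: eq_Rintegral => p; rewrite inE => /Ew[Cp _]; rewrite !indicE in_setI.
  by rewrite (mem_set Cp) andbT.
rewrite (restr ('D_1 eta)) (tderiv_strip hw mE Ew hnu bs seta).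
transitivity (charge_integral nu (strip w) (fun p => \1_(A `&` carrier w) p.1 * zeta p.2)).
  have cut (m : {finite_measure set (spacetime R d) -> \bar R}) (f : R -> R) :
      continuous f -> m (cylinder w) = 0%E ->
      \int[m]_(p in strip w) (\1_(A `&` carrier w) p.1 * f p.2) =
      \int[m]_(p in strip w `\` cylinder w) (\1_(A `&` carrier w) p.1 * f p.2).
    move=> cf m0; congr fine; apply: negligible_integral => //.
      exact: measurable_strip.
    exact: integrable_strip.
  have ceta := smooth_continuous seta; have czeta := smooth_continuous szeta.
  have eqf (m : {finite_measure set (spacetime R d) -> \bar R}) :
      m (cylinder w) = 0%E ->
      \int[m]_(p in strip w) (\1_(A `&` carrier w) p.1 * eta p.2) =
      \int[m]_(p in strip w) (\1_(A `&` carrier w) p.1 * zeta p.2).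
    move=> m0; rewrite !cut//; apply: eq_Rintegral => -[x t]; rewrite inE.
    move=> [[_ /=]]; rewrite in_itv/= => /andP[t0 t1] nC.
    rewrite indicE in_setI; have [xC|_] := boolP (x \in carrier w); last first.
      by rewrite andbF !mul0r.
    congr (_ * _); rewrite /zeta /k.
    have [->|tn0] := eqVneq t 0; first by ring.
    have [->|tn1] := eqVneq t 1; first by ring.
    exfalso; apply: nC; split; first by rewrite inE in xC.
    by rewrite /= in_itv/= lt_def tn0 t0/= lt_neqAle tn1.
  by rewrite /charge_integral (eqf jp jp0) (eqf jn jn0).
rewrite -(tderiv_strip hw mE Ew hnu bs szeta) -(restr ('D_1 zeta)).
under eq_Rintegral do rewrite Dzeta mulrC.
rewrite RintegralZl//.
apply: (@bounded_integrable _ _ _ _ _ _ 1) => //.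
- exact: (vol_lty hw mE Ew).
- apply: measurable_funTS; apply: measurableT_comp => //; exact: measurable_indic.
- by move=> p _; rewrite indicE; case: (_ \in _); rewrite ?normr1 ?normr0.
Qed.

(** A primitive of [f] turns [zero_variation_slope] into the statement that f(t) averages over [E]
    as it does over (0, 1). Smooth [f] vanishing left of 0 suffice, as they approximate indicators
    of rays. *)
Lemma zero_variation_vertical (A : set 'rV[R]_d) : measurable A ->
  forall f : measurableTypeR R -> R, bounded_measurable f ->
  \int[vol]_(p in E) (f p.2 * \1_A p.1) =
  \int[lebesgue_measure]_(t in `]0, 1[) (f t * \int[vol]_(p in E) \1_A p.1).
Proof.
move=> mA f bf; set k := \int[vol]_(p in E) \1_A p.1.
apply/eqP; rewrite -subr_eq0; apply/eqP; move: f bf.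
have mA1 : measurable_fun E (fun p : spacetime R d => \1_A p.1 : R).
  apply: measurable_funTS; apply: measurableT_comp => //; exact: measurable_indic.
have l01 := @lebesgue01_lty R.
pose J (f : measurableTypeR R -> R) := \int[vol]_(p in E) (f p.2 * \1_A p.1) -
  \int[lebesgue_measure]_(t in `]0, 1[) (f t * k).
rewrite -/(forall f, bounded_measurable f -> J f = 0).
have JL : sigma_linear J.
  apply: sigma_linearB.
    apply: (sigma_linear_Rintegral (M := 1) mE (vol_lty hw mE Ew)) => //.
    by move=> p _; rewrite indicE; case: (_ \in _); rewrite ?normr1 ?normr0.
  by apply: (sigma_linear_Rintegral (k := id) (w := fun=> k) (M := `|k|)
    (mu := lebesgue_measure) (measurable_itv _) l01).
apply: sigma_linear_ray => // b.
(* Heights in [E] are positive, so only rays starting at [b' >= 0] matter, and [smooth_primitive]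
   asks for functions vanishing on negative numbers. *)
pose b' := Num.max b 0.
have J_eq : J \1_`]b, +oo[%classic = J \1_`]b', +oo[%classic.
  have ind t : 0 < t -> \1_`]b, +oo[%classic t = \1_`]b', +oo[%classic t :> R.
    by move=> t0; rewrite !indicE !mem_setE !in_itv/= !andbT /b' gt_max t0 andbT.
  rewrite /J; congr (_ - _); apply: eq_Rintegral => p; rewrite inE.
    by move=> /Ew[_ /=]; rewrite in_itv/= => /andP[p0 _]; rewrite ind.
  by rewrite /= in_itv/= => /andP[p0 _]; rewrite ind.
rewrite J_eq.
have := JL.2 (fun n t => bump (n%:R * (t - b'))) \1_`]b', +oo[%classic 1.
have sb n : smooth (fun t : R => bump (n%:R * (t - b'))).
  apply: (smooth_comp smooth_bump); apply: smoothM; first exact: smooth_cst.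
  by apply: smoothD; [exact: smooth_id|exact: smooth_cst].
have -> : (fun n : nat => J (fun t => bump (n%:R * (t - b')))) = cst 0.
  apply/funext => n.
  have [F sF DF] : exists2 F : R -> R, smooth F &
      forall t : R, 'D_1 F t = bump (n%:R * (t - b')).
    apply: smooth_primitive; first exact: sb.
    move=> t t0; rewrite bump_le0// mulr_ge0_le0// subr_le0.
    by rewrite (le_trans (ltW t0))// le_max lexx orbT.
  rewrite /J/=.
  have := zero_variation_slope mA sF.
  rewrite -smooth_FTC2// -/k.
  under eq_Rintegral do rewrite DF mulrC.
  move=> ->; rewrite RintegralZr//.
    by under eq_Rintegral do rewrite DF; rewrite subrr.
  apply: (@bounded_integrable _ _ _ _ _ _ 1) => //.
    by apply: measurable_funTS; apply: continuous_measurable_fun; exact: smooth_continuous.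
  by move=> t _; rewrite ger0_norm ?bump_ge0// ltW// bump_lt1.
move=> H; apply: (cst_cvg_eq0 (H _ _ _)).
- by move=> n; apply: continuous_measurable_fun; exact: smooth_continuous.
- by move=> n t; rewrite ger0_norm ?bump_ge0// ltW// bump_lt1.
- move=> t; rewrite indicE mem_setE in_itv/= andbT -subr_gt0; exact: bump_cvg.
Qed.

(* Vertical invariance of E, as resampling: replacing the height of a point of E
   by an independent uniform one preserves the distribution. *)
Lemma zero_variation_fubini (C : set (spacetime R d)) : measurable C ->
  fine (vol (C `&` E)) =
  fine ((vol \x lebesgue_measure)%E
    ([set q : spacetime R d * measurableTypeR R | C (q.1.1, q.2)] `&`
      (E `*` `]0%R, 1%R[%classic))).
Proof.
move=> mC.
have l01 := @lebesgue01_lty R.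
pose k (q : spacetime R d * measurableTypeR R) : spacetime R d := (q.1.1, q.2).
have mk : measurable_fun setT k.
  apply: measurable_fun_pair => //.
  by apply: measurableT_comp => //; exact: measurable_fst.
have mE01 : measurable (E `*` `]0%R, 1%R[%classic : set (spacetime R d * measurableTypeR R)).
  by apply: measurableX => //; exact: measurable_itv.
have fE01 : ((vol \x lebesgue_measure) (E `*` `]0%R, 1%R[%classic :
    set (spacetime R d * measurableTypeR R)) < +oo)%E.
  rewrite product_measure1E//=.
  by rewrite lebesgue_measure01 mule1; exact: (vol_lty hw mE Ew).
pose J (f : spacetime R d -> R) := \int[vol]_(p in E) (f p * 1) -
  \int[(vol \x lebesgue_measure)%E]_(q in E `*` `]0, 1[%classic) (f (k q) * 1).
have JL : sigma_linear J.
  apply: sigma_linearB.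
    by apply: (sigma_linear_Rintegral (k := id) (w := fun=> 1) (M := 1) mE
      (vol_lty hw mE Ew)) => // ? _; rewrite normr1.
  by apply: (sigma_linear_Rintegral (k := k) (w := fun=> 1) (M := 1) mE01
    fE01) => // ? _; rewrite normr1.
have J0 f : bounded_measurable f -> J f = 0.
  apply: sigma_linear_rect => // A B mA mB.
  rewrite /J; apply/eqP; rewrite subr_eq0; apply/eqP.
  transitivity (\int[vol]_(p in E) (\1_B p.2 * \1_A p.1 : R)).
    by apply: eq_Rintegral => p _; rewrite mulr1 mulrC.
  rewrite (zero_variation_vertical mA (bounded_measurable_indic mB)).
  rewrite RintegralZr//; last first.
    apply: (@bounded_integrable _ _ _ _ _ _ 1) => //.
    by move=> t _; rewrite indicE; case: (_ \in _); rewrite ?normr1 ?normr0.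
  rewrite Rintegral_indic//.
  transitivity (\int[(vol \x lebesgue_measure)%E]_(q in E `*` `]0, 1[%classic)
      (\1_((A `*` setT) `*` B) q : R)); last first.
    apply: eq_Rintegral => q _; rewrite mulr1 /k !indicE !in_setX in_setT andbT.
    by do 2 case: (_ \in _); rewrite ?mulr1 ?mulr0.
  have mAT : measurable (A `*` setT : set (spacetime R d)) by exact: measurableX.
  rewrite [RHS]Rintegral_indic//; last exact: measurableX.
  rewrite -setXI /= product_measure1E//; [|exact: measurableI|exact: measurableI].
  transitivity (fine (lebesgue_measure (B `&` `]0, 1[%classic)) * fine (vol ((A `*` setT) `&` E))).
    congr (_ * _); rewrite -Rintegral_indic//; apply: eq_Rintegral => p _.
    by rewrite !indicE in_setX in_setT andbT.
  rewrite mulrC fineM//.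
  - rewrite ge0_fin_numE ?measure_ge0//; apply: (@le_lt_trans _ _ (vol E)).
      by apply: le_measure; rewrite ?inE//; exact: measurableI.
    exact: (vol_lty hw mE Ew).
  - rewrite ge0_fin_numE ?measure_ge0//.
    apply: (@le_lt_trans _ _ (lebesgue_measure (`]0%R, 1%R[%classic : set R))).
      by apply: le_measure; rewrite ?inE//; apply: measurableI.
    exact: l01.
have := J0 _ (bounded_measurable_indic mC).
rewrite /J; under eq_Rintegral do rewrite mulr1.
rewrite Rintegral_indic// => /eqP; rewrite subr_eq0 => /eqP ->.
rewrite -Rintegral_indic//.
  by apply: eq_Rintegral => q _; rewrite mulr1 !indicE.
by rewrite -[X in measurable X]setTI; exact: mk.
Qed.

End zero_variation.

(* Let phi x be the length of the vertical section of E at x.  Applied to E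
   itself, zero_variation_fubini gives int_E (1 - phi) = 0, hence phi = 1 on E. *)
Lemma zero_variation_cylinder {R : realType} {d : nat} (w : base R d)
    (E : set (spacetime R d)) (nu : {charge set (spacetime R d) -> \bar R}) :
  wf_base w -> measurable E -> E `<=` cylinder w -> is_tderiv w E nu ->
  charge_abs nu (cylinder w) = 0%E ->
  exists E0 : set 'rV[R]_d, [/\ measurable E0, E0 `<=` carrier w &
    ae_eqset vol E (E0 `*` `]0%R, 1%R[%classic)].
Proof.
move=> hw mE Ew hnu nu0.
have l01 := @lebesgue01_lty R.
pose phi (x : 'rV[R]_d) : \bar R := lebesgue_measure (xsection E x).
have sec01 x : xsection E x `<=` `]0%R, 1%R[%classic.
  by move=> t /xsectionP /Ew[].
have mphi : measurable_fun setT phi by exact: measurable_fun_xsection.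
have msec x : measurable (xsection E x) by exact: measurable_xsection.
have phi01 x : (0 <= phi x <= 1)%E.
  rewrite measure_ge0/= -lebesgue_measure01; apply: le_measure; rewrite ?inE//.
pose phir x := fine (phi x).
have phirE x : phi x = (phir x)%:E.
  have /andP[h0 h1] := phi01 x.
  by rewrite fineK// ge0_fin_numE// (le_lt_trans h1)// ltry.
have phir01 x : 0 <= phir x <= 1.
  by have := phi01 x; rewrite phirE !lee_fin.
have mphir : measurable_fun setT phir by exact: measurableT_comp.
have mphir1 : measurable_fun setT (fun p : spacetime R d => phir p.1).
  exact: measurableT_comp.
have Efin : (vol E < +oo)%E by exact: (vol_lty hw mE Ew).
have iphi : vol.-integrable E (EFin \o (fun p => phir p.1)).
  apply: (bounded_integrable (M := 1) mE Efin); first exact: measurable_funTS.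
  by move=> p _; have /andP[h0 h1] := phir01 p.1; rewrite ger0_norm.
have i1 : vol.-integrable E (EFin \o (fun p => 1 : R)).
  by apply: (bounded_integrable (M := 1) mE Efin) => // p _; rewrite normr1.
have int1 : \int[vol]_(p in E) (1 - phir p.1) = 0.
  rewrite RintegralB// Rintegral_cst// mul1r.
  have := zero_variation_fubini hw mE Ew hnu nu0 mE; rewrite setIid => ->.
  apply/eqP; rewrite subr_eq0; apply/eqP; congr fine.
  rewrite /product_measure1/= [RHS]integral_mkcond; apply: eq_integral => p _.
  rewrite patchE; set S := (X in xsection X _).
  case: ifPn => pE.
    rewrite -phirE /phi; congr (lebesgue_measure _); apply/seteqP; split=> t.
      by move=> /xsectionP[/= Et _]; exact/xsectionP.
    move=> Et; apply/xsectionP; split; first exact/xsectionP.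
    by split => /=; [rewrite inE in pE|exact: sec01 Et].
  rewrite (_ : xsection S p = set0) ?measure0//.
  apply/seteqP; split=> t // /xsectionP[_ [/= Ep _]].
  by move/negP : pE; apply; rewrite inE.
pose E0 := carrier w `&` ~` [set x | 0 < 1 - phir x].
have mE0 : measurable E0.
  apply: measurableI; first exact: measurable_carrier.
  by apply: measurableC; apply: measurable_set_gt; exact: measurable_funB.
have E0phi x : E0 x -> phir x = 1.
  move=> [_ /= /negP]; rewrite -leNgt => h; have := phir01 x; lra.
exists E0; split=> //; first by move=> x [].
have mE01 : measurable (E0 `*` `]0%R, 1%R[%classic : set (spacetime R d)).
  by apply: measurableX => //; exact: measurable_itv.
split.
  exists (E `&` [set p | 1 - phir p.1 != 0]); split.
  - apply: measurableI => //; rewrite (_ : [set p | _] =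
        [set p : spacetime R d | 0 < 1 - phir p.1]).
      by apply: measurable_set_gt; exact: measurable_funB.
    apply/seteqP; split=> p /=; have /andP[h0 h1] := phir01 p.1; last by move=> /gt_eqF ->.
    by move=> h; rewrite lt_def h subr_ge0.
  - apply: Rintegral_eq0 => //.
      exact: (integrableB mE i1 iphi).
    by move=> p _; have /andP[h0 h1] := phir01 p.1; rewrite subr_ge0.
  - move=> p [Ep nE0]; split=> //=; apply/eqP => phi1; apply: nE0.
    have [Cp p01] := Ew _ Ep; split=> //; split=> //=.
    by rewrite phi1 ltxx.
exists ((E0 `*` `]0%R, 1%R[%classic) `\` E); split => //.
- exact: measurableD.
(* Over a point of [E0] the section of [E] has full length 1, so what it misses of (0, 1) is null;
   Fubini concludes. *)
- rewrite /vol/= /product_measure1/=; apply: integral0_eq => x _.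
  rewrite xsectionD.
  have [xE0|xE0] := boolP (x \in E0); last first.
    by rewrite notin_xsectionX// set0D measure0.
  rewrite in_xsectionX// measureD//.
  + have phi1 : phi x = 1%E by rewrite phirE E0phi//; rewrite inE in xE0.
    rewrite (setIidr (@sec01 x)) [X in (_ - X)%E]phi1.
    by rewrite [X in (X - _)%E]lebesgue_measure01 subee.
Qed.

Lemma Rintegral_ae_eqset {R : realType} d (T : measurableType d)
    (mu : {measure set T -> \bar R}) (D A B : set T) (f : T -> R) :
  measurable D -> measurable A -> measurable B -> A `<=` D -> B `<=` D ->
  measurable_fun D f -> ae_eqset mu A B ->
  \int[mu]_(x in A) f x = \int[mu]_(x in B) f x.
Proof.
move=> mD mA mB AD BD mf [[N [mN N0 AN]] [M [mM M0 BM]]].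
rewrite Rintegral_mkcond [RHS]Rintegral_mkcond; congr fine.
have mfr C : measurable C -> C `<=` D -> measurable_fun setT (EFin \o (f \_ C)).
  move=> mC CD; apply/measurable_EFinP; apply/(measurable_restrictT _ _).1 => //.
  exact: measurable_funS mf.
apply: ae_eq_integral => //; [exact: mfr|exact: mfr|].
exists (N `|` M); split; first exact: measurableU.
  by rewrite null_set_setU.
move=> x /= /not_implyP[_ fx]; apply: contrapT => nx; apply: fx; congr EFin.
rewrite !patchE; have [xA|xA] := boolP (x \in A); have [xB|xB] := boolP (x \in B) => //.
- exfalso; apply: nx; left; apply: AN; split; first by rewrite inE in xA.
  by move=> xB'; move/negP : xB; apply; rewrite inE.
- exfalso; apply: nx; right; apply: BM; split; first by rewrite inE in xB.
  by move=> xA'; move/negP : xA; apply; rewrite inE.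
Qed.

(** * A vertical cylinder has no variation inside *)

Section product_set.
Context {R : realType} {d : nat} (w : base R d).
Hypothesis hw : wf_base w.
Variable E0 : set 'rV[R]_d.
Hypotheses (mE0 : measurable E0) (E0w : E0 `<=` carrier w).

Lemma base_lty : (lebesgue_rV R d E0 < +oo)%E.
Proof.
apply: le_lt_trans (carrier_lty hw); apply: le_measure; rewrite ?inE//.
exact: measurable_carrier.
Qed.

Lemma measurable_slab : measurable (E0 `*` `]0%R, 1%R[%classic : set (spacetime R d)).
Proof. by apply: measurableX => //; exact: measurable_itv. Qed.

Lemma slab_cylinder : E0 `*` `]0%R, 1%R[%classic `<=` cylinder w.
Proof. by move=> p [/E0w]. Qed.

Lemma Rintegral_slab (f : spacetime R d -> R) (M : R) : measurable_fun setT f ->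
  (forall p, E0 p.1 -> 0 < p.2 < 1 -> `|f p| <= M) ->
  \int[vol]_(p in E0 `*` `]0, 1[%classic) f p =
  \int[lebesgue_rV R d]_(x in E0) \int[lebesgue_measure]_(t in `]0, 1[) f (x, t).
Proof.
move=> mf fM.
set D := E0 `*` `]0%R, 1%R[%classic.
have mD : measurable D by exact: measurable_slab.
have iD : vol.-integrable D (EFin \o f).
  apply: (@bounded_integrable _ _ _ _ _ _ M) => //.
  - exact: (vol_lty hw mD slab_cylinder).
  - exact: measurable_funTS.
  - by move=> -[x t] [/= Ex]; rewrite in_itv/=; exact: (fM (x, t)).
have iT : vol.-integrable setT ((EFin \o f) \_ D).
  by apply/(integrable_mkcond _ _).1.
rewrite {1}/Rintegral integral_mkcond -integral12_prod_meas1//.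
rewrite Rintegral_mkcond; congr fine; apply: eq_integral => x _.
rewrite patchE; case: ifPn => xE.
  rewrite /fubini_F.
  rewrite (_ : (\int[lebesgue_measure]_y ((EFin \o f) \_ D) (x, y) =
     \int[lebesgue_measure]_(y in `]0%R, 1%R[) (f (x, y))%:E)%E).
    rewrite /Rintegral fineK//; apply: integrable_fin_num => //.
    apply: (@bounded_integrable _ _ _ _ _ (fun y => f (x, y)) M) => //.
    - exact: lebesgue01_lty.
    - apply: measurable_funTS; apply: (measurableT_comp mf).
      exact: measurable_pair1.
    - move=> t /=; rewrite in_itv/= => t01; apply: (fM (x, t)) => //=.
      by rewrite inE in xE.
  rewrite [RHS]integral_mkcond; apply: eq_integral => y _.
  by rewrite !patchE in_setX xE.
rewrite /fubini_F integral0_eq// => y _.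
by rewrite patchE in_setX (negbTE xE).
Qed.

Variable E : set (spacetime R d).
Hypotheses (mE : measurable E) (Ew : E `<=` cylinder w)
  (EE0 : ae_eqset vol E (E0 `*` `]0%R, 1%R[%classic)).

Lemma Rintegral_slab_ae (f : spacetime R d -> R) : measurable_fun (cylinder w) f ->
  \int[vol]_(p in E) f p = \int[vol]_(p in E0 `*` `]0, 1[%classic) f p.
Proof.
move=> mf; apply: (Rintegral_ae_eqset (measurable_cylinder hw)) => //.
- exact: measurable_slab.
- exact: slab_cylinder.
Qed.

(** Fubini on the slab and the fundamental theorem of calculus on each vertical segment: the
    counterpart of [zero_variation_slope] when [E] is known to be a cylinder up to a null set. *)
Lemma product_slope (A : set 'rV[R]_d) (eta : R -> R) : measurable A -> smooth eta ->
  \int[vol]_(p in E) (\1_A p.1 * 'D_1 eta p.2) =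
  (eta 1 - eta 0) * \int[lebesgue_rV R d]_(x in E0) \1_A x.
Proof.
move=> mA seta; have cD := smooth_continuous1 seta.
have mA1 : measurable_fun [set: spacetime R d] (fun p => \1_A p.1 : R).
  by apply: measurableT_comp => //; exact: measurable_indic.
have mf : measurable_fun [set: spacetime R d] (fun p => \1_A p.1 * 'D_1 eta p.2 : R).
  by apply: measurable_funM => //; exact: (@measurable_snd_comp _ _ _ _ cD).
rewrite Rintegral_slab_ae; last exact: measurable_funTS.
have [B HB] := continuous_compact_bound (@segment_compact _ 0 1) cD.
have indle (x : 'rV[R]_d) : `|\1_A x : R| <= 1.
  by rewrite indicE; case: (_ \in _); rewrite ?normr1 ?normr0.
rewrite (Rintegral_slab (M := B) mf); last first.
  move=> p _ /andP[p0 p1]; rewrite normrM -[leRHS]mul1r ler_pM//.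
  by apply: HB; rewrite /= in_itv/= !ltW.
have iA : (lebesgue_rV R d).-integrable E0 (EFin \o (\1_A : _ -> R)).
  apply: (bounded_integrable (M := 1) mE0 base_lty) => //.
rewrite -RintegralZl//; apply: eq_Rintegral => x _ /=.
rewrite RintegralZl//; first by rewrite smooth_FTC2// mulrC.
apply: (@bounded_integrable _ _ _ _ _ _ B) => //.
- exact: lebesgue01_lty.
- by apply: measurable_funTS; exact: continuous_measurable_fun.
- by move=> t /=; rewrite in_itv/= => /andP[? ?]; apply: HB; rewrite /= in_itv/= !ltW.
Qed.

Variable nu : {charge set (spacetime R d) -> \bar R}.
Hypothesis hnu : is_tderiv w E nu.

Let jp := jordan_pos (hahn_setsP nu).
Let jn := jordan_neg (hahn_setsP nu).
Let ostrip : set (spacetime R d) := cell w `*` `]0%R, 1%R[%classic.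

Let mostrip : measurable ostrip.
Proof. by apply: measurableX; [exact: measurable_cell|exact: measurable_itv]. Qed.

(** When [eta 0 = eta 1] both sides of [product_slope] vanish, so the charge annihilates 1_A(x)
    eta(t) on the strip. The functions [bump (n q)] vanish at both ends, hence see only the open
    strip, and inside (0, 1) they tend to the indicator of the ray. *)
Lemma product_vertical (A : set 'rV[R]_d) : measurable A ->
  forall f : measurableTypeR R -> R, bounded_measurable f ->
  charge_integral nu ostrip (fun p => f p.2 * \1_A p.1) = 0.
Proof.
move=> mA.
pose J (f : measurableTypeR R -> R) :=
  \int[jp]_(p in ostrip) (f p.2 * \1_A p.1) - \int[jn]_(p in ostrip) (f p.2 * \1_A p.1).
rewrite -/(forall f, bounded_measurable f -> J f = 0).
have mA1 : measurable_fun [set: spacetime R d] (fun p => \1_A p.1 : R).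
  by apply: measurableT_comp => //; exact: measurable_indic.
have indle (x : 'rV[R]_d) : `|\1_A x : R| <= 1.
  by rewrite indicE; case: (_ \in _); rewrite ?normr1 ?normr0.
have JL : sigma_linear J.
  apply: sigma_linearB.
    apply: (sigma_linear_Rintegral (M := 1) mostrip) => //.
    + exact: finite_measure_lty.
    + exact: measurable_funTS.
  apply: (sigma_linear_Rintegral (M := 1) mostrip) => //.
  + exact: finite_measure_lty.
  + exact: measurable_funTS.
apply: sigma_linear_ray => // b.
pose b' := Num.max b 0.
have b'0 : 0 <= b' by rewrite le_max lexx orbT.
pose q (t : R) := bump (t - b') * bump (1 - t).
have J_eq : J \1_`]b, +oo[%classic = J \1_[set t | 0 < q t].
  have ind t : 0 < t -> t < 1 -> \1_`]b, +oo[%classic t = \1_[set t | 0 < q t] t :> R.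
    move=> t0 t1; have qt : (t \in [set t | 0 < q t]) = (0 < q t).
      by apply/idP/idP; rewrite inE.
    rewrite !indicE qt mem_setE in_itv/= andbT /q pmulr_lgt0 ?bump_gt0 ?subr_gt0//.
    by rewrite gt_max t0 andbT.
  by rewrite /J; congr (_ - _); apply: eq_Rintegral => p; rewrite inE => -[_ /=];
    rewrite in_itv/= => /andP[p0 p1]; rewrite ind.
have sq : smooth q.
  apply: smoothM; apply: (smooth_comp smooth_bump); apply: smoothD;
    by [exact: smooth_id|exact: smooth_cst|apply: smoothN; exact: smooth_id].
have sn n : smooth (fun t : R => bump (n%:R * q t)).
  by apply: (smooth_comp smooth_bump); apply: smoothM => //; exact: smooth_cst.
have q0 : q 0 = 0 by rewrite /q bump_le0 ?mul0r// subr_le0.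
have q1 : q 1 = 0 by rewrite /q subrr (@bump_le0 _ 0)// mulr0.
rewrite J_eq.
have := JL.2 (fun n t => bump (n%:R * q t)) \1_[set t | 0 < q t] 1.
have -> : (fun n : nat => J (fun t => bump (n%:R * q t))) = cst 0.
  apply/funext => n; pose eta (t : R) := bump (n%:R * q t).
  have := product_slope mA (sn n).
  rewrite q0 q1 subrr mul0r (tderiv_strip hw mE Ew hnu (bounded_measurable_indic mA) (sn n)).
  move=> <-; rewrite /J /charge_integral.
  have ends (m : {finite_measure set (spacetime R d) -> \bar R}) :
      \int[m]_(p in ostrip) (eta p.2 * \1_A p.1) =
      \int[m]_(p in strip w) (\1_A p.1 * eta p.2).
    rewrite Rintegral_mkcond [RHS]Rintegral_mkcond; apply: eq_Rintegral => -[x t] _.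
    rewrite !patchE /ostrip /strip !in_setX /= mulrC.
    case: (x \in _) => //=; rewrite !mem_setE !in_itv/=.
    have [->|t0] := eqVneq t 0; first by rewrite /eta q0 mulr0 bump_le0// mulr0 !if_same.
    have [->|t1] := eqVneq t 1; first by rewrite /eta q1 mulr0 bump_le0// mulr0 !if_same.
    by rewrite lt_def t0/= (lt_neqAle t) t1.
  by rewrite (ends jp) (ends jn).
move=> H; apply: (cst_cvg_eq0 (H _ _ _)).
- by move=> n; apply: continuous_measurable_fun; apply: smooth_continuous.
- by move=> n t; rewrite ger0_norm ?bump_ge0// ltW// bump_lt1.
- by move=> t; rewrite indicE mem_setE; exact: bump_cvg.
Qed.

Lemma product_ostrip (f : spacetime R d -> R) : bounded_measurable f ->
  charge_integral nu ostrip f = 0.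
Proof.
move: f.
pose J (f : spacetime R d -> R) :=
  \int[jp]_(p in ostrip) (f p * 1) - \int[jn]_(p in ostrip) (f p * 1).
have JL : sigma_linear J.
  apply: sigma_linearB.
    apply: (sigma_linear_Rintegral (k := id) (w := fun=> 1) (M := 1) mostrip) => //.
    + exact: finite_measure_lty.
    + by move=> ? _; rewrite normr1.
  apply: (sigma_linear_Rintegral (k := id) (w := fun=> 1) (M := 1) mostrip) => //.
  + exact: finite_measure_lty.
  + by move=> ? _; rewrite normr1.
suff J0 f : bounded_measurable f -> J f = 0.
  move=> f /J0 <-; rewrite /J /charge_integral.
  by congr (_ - _); apply: eq_Rintegral => p _; rewrite mulr1.
apply: sigma_linear_rect => // A B mA mB.
rewrite -(product_vertical mA (bounded_measurable_indic mB)) /J /charge_integral.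
by congr (_ - _); apply: eq_Rintegral => p _; rewrite mulr1 mulrC.
Qed.

(** [nu] vanishes on every Borel subset of the open strip, in particular on the two Hahn pieces of
    the cylinder, whose values make up the variation. *)
Lemma product_zero_variation : charge_abs nu (cylinder w) = 0%E.
Proof.
have nu0 (C : set (spacetime R d)) : measurable C -> C `<=` ostrip -> nu C = 0%E.
  move=> mC Co; have := product_ostrip (bounded_measurable_indic mC).
  rewrite /charge_integral !Rintegral_indic// !(setIidl Co).
  rewrite (jordan_decomp (hahn_setsP nu) mC) /cadd/= cscaleN1.
  have fp : jp C \is a fin_num by exact: fin_num_measure.
  have fn : jn C \is a fin_num by exact: fin_num_measure.
  rewrite -/jp -/jn => /eqP; rewrite subr_eq0 => /eqP pn.
  have -> : jp C = jn C by rewrite -(fineK fp) -(fineK fn) pn.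
  by rewrite subee.
have mcyl : measurable (cylinder w) by exact: measurable_cylinder.
have cylo : cylinder w `<=` ostrip.
  by move=> p [Cp p01]; split=> //; exact: carrier_cell.
have [mP mN] : measurable (hahn_posset nu) /\ measurable (hahn_negset nu).
  by have [[mP _] [mN _] _ _] := hahn_setsP nu.
rewrite /charge_abs /charge_variation/= jordan_posE jordan_negE cjordan_posE cjordan_negE.
rewrite /crestr0 mem_set// /crestr !nu0 ?oppe0 ?adde0//; try exact: measurableI.
- by move=> p [/cylo].
- by move=> p [/cylo].
Qed.

End product_set.

(** * Bounds and vertical sections of test functions *)

Section test_functions.
Context {R : realType} {d : nat} (w : base R d).

Lemma cyl_test_bounded phi : cyl_test w phi -> exists B : R, forall p, `|phi p| <= B.
Proof.
move=> [/smooth_continuous cphi].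
case: w => [_ cK|[pphi [M phi0]]].
  have [B HB] := continuous_compact_bound cK cphi.
  exists (Num.max B 0) => p; rewrite le_max.
  have [->|nz] := eqVneq (phi p) 0; first by rewrite normr0 lexx orbT.
  by rewrite HB//; exact: subset_closure.
have [B HB] := continuous_compact_bound (@compact_ball_spacetime R d 1 M) cphi.
exists (Num.max B 0) => -[x t]; rewrite le_max.
have [tM|tM] := leP `|t| M; last by rewrite phi0// normr0 lexx orbT.
rewrite (@periodic_frac _ _ (fun x => phi (x, t)) x (pphi t)).
rewrite HB//; split; first exact: norm_row_frac.
by rewrite /= in_itv/= -ler_norml.
Qed.

Lemma is_derive_vertical (psi : 'rV[R]_d * R -> R) x (t : R) : smooth psi ->
  is_derive t (1 : R) (fun t => psi (x, t)) (partial_t psi (x, t)).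
Proof.
move=> spsi.
have dpsi : derivable psi (x, t) (0, 1).
  by apply: diff_derivable; exact: smooth_differentiable.
have E : (fun h : R => h^-1 *: (psi (x, h *: (1 : R) + t) - psi (x, t))) =
         (fun h : R => h^-1 *: (psi (h *: ((0, 1) : 'rV[R]_d * R) + (x, t)) - psi (x, t))).
  apply/funext => h; congr (_ *: (psi _ - _)); congr pair.
  by rewrite /= scaler0 add0r.
split; first by rewrite /derivable E.
by rewrite /partial_t /derive E.
Qed.

Lemma smooth_vertical (phi : 'rV[R]_d * R -> R) x : smooth phi ->
  smooth (fun t => phi (x, t)).
Proof.
move=> sphi; apply: (@smooth1_coind _ (fun h => exists2 psi : 'rV[R]_d * R -> R,
    smooth psi & h = fun t => psi (x, t))); last by exists phi.
move=> h [psi spsi ->]; exists (fun t => partial_t psi (x, t)).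
  by exists (partial_t psi) => //; exact: smooth_derive.
by move=> t; exact: is_derive_vertical.
Qed.

End test_functions.

(** * A derivative measure for vertical cylinders *)

Section product_tderiv.
Context {R : realType} {d : nat} (w : base R d).
Hypothesis hw : wf_base w.
Variable E0 : set 'rV[R]_d.
Hypotheses (mE0 : measurable E0) (E0w : E0 `<=` carrier w).
Variable E : set (spacetime R d).
Hypotheses (mE : measurable E) (Ew : E `<=` cylinder w)
  (EE0 : ae_eqset vol E (E0 `*` `]0%R, 1%R[%classic)).

Lemma product_partial_t phi : cyl_test w phi ->
  \int[vol]_(p in E) partial_t phi p =
  \int[lebesgue_rV R d]_(x in E0) (phi (x, 1) - phi (x, 0)).
Proof.
move=> [sphi _]; have sD : smooth (partial_t phi) by exact: smooth_derive.
have cD := smooth_continuous sD.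
have mD := continuous_measurable_spacetime cD.
rewrite (Rintegral_slab_ae hw mE0 E0w mE Ew EE0); last exact: measurable_funTS.
have [M M0 cM] := carrier_norm_le hw.
have [B HB] := continuous_compact_bound (@compact_ball_spacetime R d M 1) cD.
rewrite (Rintegral_slab hw mE0 E0w (M := B) mD); last first.
  move=> [x t] /= /E0w/cM xM /andP[t0 t1]; apply: HB; split=> //=.
  by rewrite in_itv/=; apply/andP; split; lra.
apply: eq_Rintegral => x _; rewrite -(smooth_FTC2 (smooth_vertical x sphi)).
by apply: eq_Rintegral => t _; have [_ ->] := is_derive_vertical x t sphi.
Qed.

Lemma product_bounded_tvar : bounded_tvar w E.
Proof.
rewrite /bounded_tvar.
apply: (@le_lt_trans _ _ (2 * fine (lebesgue_rV R d E0))%:E); last exact: ltry.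
apply: ge_ereal_sup => _ [phi [tphi phi1] <-]; rewrite lee_fin product_partial_t//.
have sphi := tphi.1; have cphi := smooth_continuous sphi.
have mphi t : measurable_fun [set: 'rV[R]_d] (fun x => phi (x, t)).
  apply: (measurableT_comp (continuous_measurable_spacetime cphi)).
  exact: measurable_fun_slice.
have E0lt := base_lty hw mE0 E0w.
have ld x : `|phi (x, 1) - phi (x, 0)| <= 2.
  by rewrite (le_trans (ler_normB _ _))// -[leRHS]/(1 + 1) lerD.
rewrite -Rintegral_cst//; apply: le_Rintegral => //.
- apply: (bounded_integrable (M := 2) mE0 E0lt) => //.
  by apply: measurable_funTS; exact: measurable_funB.
- by apply: (bounded_integrable (M := 2) mE0 E0lt) => // x _; rewrite ger0_norm.
- by move=> x _; exact: le_trans (ler_norm _) (ld x).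
Qed.

(** The derivative of a vertical cylinder: Lebesgue measure of [E0] on the face t = 1 minus the same
    on t = 0, each a push-forward of Lebesgue measure restricted to [E0]. *)
Lemma face_charge : exists nu : {charge set (spacetime R d) -> \bar R},
  forall C, nu C = (lebesgue_rV R d ((fun x => (x, 1%R)) @^-1` C `&` E0) -
                    lebesgue_rV R d ((fun x => (x, 0%R)) @^-1` C `&` E0))%E.
Proof.
pose c : {charge set 'rV[R]_d -> \bar R} :=
  charge_of_finite_measure (mfrestr mE0 (base_lty hw mE0 E0w)).
have p t : exists p : {charge set (spacetime R d) -> \bar R},
    forall C, p C = c ((fun x => (x, t)) @^-1` C).
  unshelve eexists (pushforward c (fun x => (x, t) : spacetime R d)); first exact: measurable_fun_slice.
  by [].
have [p1 p1E] := p 1; have [p0 p0E] := p 0.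
exists (cadd p1 (cscale (-1) p0)) => C.
by rewrite -[LHS]/(p1 C + cscale (-1) p0 C)%E /cscale p1E p0E mulN1e.
Qed.

(** [charge_integral] goes through Hahn sets obtained by choice, so the two face terms cannot be
    read off directly. On an indicator both expressions equal [nu C], and [sigma_linear_indic_zero]
    extends the identity to [phi]. *)
Lemma product_is_tderiv : exists nu, is_tderiv w E nu.
Proof.
have [nu nuE] := face_charge; exists nu.
have E0lt := base_lty hw mE0 E0w.
split.
  move: E0w; case: (w) => // E0w' A mA Aw; rewrite nuE.
  have H t : (fun x => (x, t)) @^-1` A `&` E0 = set0.
    apply/seteqP; split=> x //= [Ax E0x].
    by have : set0 (x, t) by rewrite -Aw; split=> //; split=> //; exact: E0w'.
  by rewrite !H !measure0 sube0.
move=> phi tphi; rewrite product_partial_t//.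
have [B phiB] := cyl_test_bounded tphi.
have mphi : measurable_fun [set: spacetime R d] phi.
  by apply: continuous_measurable_spacetime; exact: smooth_continuous tphi.1.
pose J (f : spacetime R d -> R) :=
  (\int[lebesgue_rV R d]_(x in E0) (f (x, 1) * 1) -
   \int[lebesgue_rV R d]_(x in E0) (f (x, 0) * 1)) -
  (\int[jordan_pos (hahn_setsP nu)]_(p in setT) (f p * 1) -
   \int[jordan_neg (hahn_setsP nu)]_(p in setT) (f p * 1)).
have JL : sigma_linear J.
  apply: sigma_linearB; apply: sigma_linearB.
  - apply: (sigma_linear_Rintegral (k := fun x => (x, 1%R) : spacetime R d)
      (w := fun=> 1) (M := 1) mE0 E0lt) => //.
    by move=> ? _; rewrite normr1.
  - apply: (sigma_linear_Rintegral (k := fun x => (x, 0%R) : spacetime R d)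
      (w := fun=> 1) (M := 1) mE0 E0lt) => //.
    by move=> ? _; rewrite normr1.
  - apply: (sigma_linear_Rintegral (k := id) (w := fun=> 1) (M := 1) measurableT) => //.
      exact: finite_measure_lty.
    by move=> ? _; rewrite normr1.
  - apply: (sigma_linear_Rintegral (k := id) (w := fun=> 1) (M := 1) measurableT) => //.
      exact: finite_measure_lty.
    by move=> ? _; rewrite normr1.
have : J phi = 0.
  apply: sigma_linear_indic_zero => //; last by split=> //; exists B.
  move=> C mC; rewrite /J.
  have ms t : measurable ((fun x => (x, t) : spacetime R d) @^-1` C).
    by rewrite -[X in measurable X]setTI; exact: measurable_fun_slice.
  have intC t : \int[lebesgue_rV R d]_(x in E0) (\1_C (x, t) * 1 : R) =
      fine (lebesgue_rV R d ((fun x => (x, t)) @^-1` C `&` E0)).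
    rewrite -Rintegral_indic//; first by apply: eq_Rintegral => x _; rewrite mulr1 !indicE.
  have fE t : lebesgue_rV R d ((fun x => (x, t)) @^-1` C `&` E0) \is a fin_num.
    rewrite ge0_fin_numE ?measure_ge0//; apply: le_lt_trans E0lt.
    by apply: le_measure; rewrite ?inE//; exact: measurableI.
  rewrite !intC -fineB// -nuE.
  have fp : jordan_pos (hahn_setsP nu) C \is a fin_num by exact: fin_num_measure.
  have fn : jordan_neg (hahn_setsP nu) C \is a fin_num by exact: fin_num_measure.
  have intT (m : {finite_measure set (spacetime R d) -> \bar R}) :
      \int[m]_(p in setT) (\1_C p * 1 : R) = fine (m C).
    by rewrite -{2}(setIT C) -Rintegral_indic//; apply: eq_Rintegral => p _; rewrite mulr1.
  rewrite (intT (jordan_pos (hahn_setsP nu))) (intT (jordan_neg (hahn_setsP nu))) -fineB//.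
  by rewrite (jordan_decomp (hahn_setsP nu) mC) /cadd/= cscaleN1 subrr.
rewrite /J => /eqP; rewrite subr_eq0 => /eqP.
have m1 (T : Type) (f : T -> R) : (fun x => f x * 1) = f by apply/funext => x; rewrite mulr1.
rewrite !m1 => JE; rewrite /charge_integral -JE RintegralB//.
- apply: (bounded_integrable (M := B) mE0 E0lt) => //.
  apply: measurable_funTS; apply: (measurableT_comp mphi); exact: measurable_fun_slice.
- apply: (bounded_integrable (M := B) mE0 E0lt) => //.
  apply: measurable_funTS; apply: (measurableT_comp mphi); exact: measurable_fun_slice.
Qed.

End product_tderiv.

(** * Threshold levels of a weighted distribution function *)

Section threshold.
Context {R : realType} d (T : measurableType d) (mu : {measure set T -> \bar R}).
Variables (D : set T) (g v : T -> R).
Hypotheses (mD : measurable D) (ig : mu.-integrable D (EFin \o g))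
  (g0 : forall x, D x -> 0 <= g x) (mv : measurable_fun D v).

Let mg : measurable_fun D g.
Proof. by apply/measurable_EFinP; exact: measurable_int ig. Qed.

Lemma Rintegral_sets_cvg (A : nat -> set T) (B : set T) :
  (forall n, measurable (D `&` A n)) ->
  (forall x, D x -> \forall n \near \oo, A n x <-> B x) ->
  \int[mu]_(x in D `&` A n) g x @[n --> \oo] --> \int[mu]_(x in D `&` B) g x.
Proof.
move=> mA AB; rewrite Rintegral_mkcond; under eq_fun do rewrite Rintegral_mkcond.
have cvgx x : (g \_ (D `&` A n)) x @[n --> \oo] --> (g \_ (D `&` B)) x.
  apply: cvg_near_cst; have [Dx|nDx] := pselect (D x); last first.
    by near=> n; rewrite !patchE !memNset// => -[].
  near=> n; rewrite !patchE; have : A n x <-> B x by near: n; exact: AB.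
  by move=> [h1 h2]; congr (if _ then _ else _); apply/idP/idP; rewrite !inE => -[_ ?];
    split=> //; [exact: h1|exact: h2].
have mgA n : measurable_fun setT (g \_ (D `&` A n)).
  by apply/(measurable_restrictT _ _).1 => //; apply: measurable_funS mg.
have mgB : measurable_fun setT (g \_ (D `&` B)).
  by apply: (measurable_fun_cvg mgA) => x _; exact: cvgx.
have igD : mu.-integrable setT (EFin \o (Num.norm \o g) \_ D).
  rewrite -restrict_EFin; apply/(integrable_mkcond _ mD).1.
  exact: integrable_norm ig.
have [] := @dominated_convergence _ _ _ mu _ measurableT
    (fun n => EFin \o (g \_ (D `&` A n))) (EFin \o (g \_ (D `&` B)))
    (EFin \o (Num.norm \o g) \_ D).
- by move=> n; exact/measurable_EFinP.
- exact/measurable_EFinP.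
- by apply: aeW => x _; apply: cvg_EFin; [exact: nearW|exact: cvgx].
- exact: igD.
- apply: aeW => x n _; rewrite /= lee_fin !patchE in_setI.
  by case: (x \in D) => //=; case: (x \in A n) => //=; rewrite normr0.
move=> intB _ cvgB.
apply: fine_cvg; rewrite fineK//; exact: integrable_fin_num.
Unshelve. all: by end_near. Qed.

Let mlt l : measurable (D `&` [set x | v x < l]).
Proof.
rewrite (_ : _ `&` _ = D `&` v @^-1` `]-oo, l[); first exact: mv.
by apply/seteqP; split=> x /=; rewrite in_itv.
Qed.

Let G l := \int[mu]_(x in D `&` [set x | v x < l]) g x.

Let G_mono l l' : l <= l' -> G l <= G l'.
Proof.
move=> ll'; rewrite /G Rintegral_mkcond [leRHS]Rintegral_mkcond.
have iG r : mu.-integrable setT (EFin \o g \_ (D `&` [set x | v x < r])).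
  rewrite -restrict_EFin; apply/(integrable_mkcond _ _).1 => //.
  by apply: integrableS ig.
apply: le_Rintegral => // x _; rewrite !patchE !in_setI.
have E r : (x \in [set x | v x < r]) = (v x < r) by apply/idP/idP; rewrite inE.
have [xD|] := boolP (x \in D) => //=; rewrite !E.
have [xl|xl] := ltP (v x) l; first by rewrite (lt_le_trans xl).
by case: ifP => // _; apply: g0; rewrite inE in xD.
Qed.

(** As l runs from -oo to +oo the integral over {v < l} increases from 0 to the integral over [D],
    so the supremum is finite. At [l - dl n] and [l + dl n], dominated convergence produces the sets
    {v < l} and {v <= l}. The lemma serves both the ratio sigmabar / g and a coordinate function. *)
Lemma threshold (a : R) : 0 < a -> a < \int[mu]_(x in D) g x ->
  let l := sup [set l | \int[mu]_(x in D `&` [set x | v x < l]) g x < a] in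
  \int[mu]_(x in D `&` [set x | v x < l]) g x <= a /\
  a <= \int[mu]_(x in D `&` [set x | v x <= l]) g x.
Proof.
move=> a0 a1; cbv zeta; set S := [set l | _ < a]; set l := sup S.
have S0 : S !=set0.
  have := @Rintegral_sets_cvg (fun n => [set x | v x < - n%:R]) set0.
  rewrite setI0 Rintegral_set0 => /(_ (fun n => mlt _)) H.
  have {}H : G (- n%:R) @[n --> \oo] --> 0.
    apply: H => x _; near=> n; split=> //= vn; move: vn; apply/negP.
    rewrite -leNgt lerNl; apply: ltW; apply: (@le_lt_trans _ _ `|v x|).
      by rewrite -normrN ler_norm.
    by near: n; exact: nbhs_infty_gtr.
  near \oo => n; exists (- n%:R); rewrite /S/=; near: n.
  exact: (cvgr_lt _ H).
have Sub : has_ubound S.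
  have := @Rintegral_sets_cvg (fun n => [set x | v x < n%:R]) setT.
  rewrite setIT => /(_ (fun n => mlt _)) H.
  have {}H : G n%:R @[n --> \oo] --> \int[mu]_(x in D) g x.
    apply: H => x _; near=> n; split=> //= _.
    by apply: (@le_lt_trans _ _ `|v x|); [exact: ler_norm|near: n; exact: nbhs_infty_gtr].
  have [n an] : exists n : nat, a < G n%:R.
    by near \oo => n; exists n; near: n; exact: (cvgr_gt _ H).
  exists n%:R => r /= Sr; rewrite leNgt; apply/negP => nr.
  by move: Sr; apply/negP; rewrite -leNgt ltW// (lt_le_trans an)// G_mono// ltW.
have [dl dlE] : exists dl : nat -> R, forall n, dl n = n.+1%:R^-1 by eexists.
have dl0 n : 0 < dl n by rewrite dlE invr_gt0.
have near_dl e : 0 < e -> \forall n \near \oo, dl n < e.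
  by move=> e0; near=> n; rewrite dlE; near: n; exact: (near_infty_natSinv_lt (PosNum e0)).
have below n : G (l - dl n) < a.
  have [r Sr lr] := sup_adherent (dl0 n) (conj S0 Sub).
  by apply: le_lt_trans Sr; apply: G_mono; exact: ltW.
have above n : a <= G (l + dl n).
  rewrite leNgt; apply/negP => Sl.
  have : l + dl n <= l by apply: ub_le_sup.
  by rewrite -subr_ge0 opprD addNKr oppr_ge0 leNgt dl0.
split.
  have H : G (l - dl n) @[n --> \oo] --> G l.
    apply: Rintegral_sets_cvg => [n|x _]; first exact: mlt.
    have [vl|lv] := ltP (v x) l.
      have e0 : 0 < l - v x by rewrite subr_gt0.
      near=> n; split=> //= _; rewrite ltrBrDr -ltrBrDl.
      by near: n; exact: near_dl.
    near=> n; split=> //= vn; first by rewrite (lt_trans vn)// gtrBl.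
    by move: vn; rewrite ltNge lv.
  rewrite -/(G l) -(cvg_lim _ H)//; apply: limr_le; first by apply/cvg_ex; exists (G l).
  by near=> n; exact/ltW/below.
have H : G (l + dl n) @[n --> \oo] --> \int[mu]_(x in D `&` [set x | v x <= l]) g x.
  apply: Rintegral_sets_cvg => [n|x _]; first exact: mlt.
  have [vl|lv] := leP (v x) l.
    by near=> n; split=> //= _; rewrite (le_lt_trans vl)// ltrDl.
  have e0 : 0 < v x - l by rewrite subr_gt0.
  near=> n; split=> //= [vn|vn]; exfalso.
    move: vn; apply/negP; rewrite -leNgt -lerBrDl; apply: ltW.
    by near: n; exact: near_dl.
  by move: vn; rewrite leNgt lv.
rewrite -(cvg_lim _ H)//; apply: limr_ge; first by apply/cvg_ex; eexists; exact: H.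
by near=> n; exact: above.
Unshelve. all: by end_near. Qed.

End threshold.

(** * From essential bounds to pointwise bounds *)

Section essential_bounds.
Context {R : realType} {d : nat} (w : base R d).
Implicit Types f : 'rV[R]_d -> R.

Lemma Linfty_ae f (c : R) : (Linfty_norm w f <= c%:E)%E ->
  {ae lebesgue_rV R d, forall x, carrier w x -> `|f x| <= c}.
Proof.
rewrite /Linfty_norm unlock; case: ifPn => [_ /ess_supP|T0 _].
  apply: filterS => x /= + Cx; by rewrite patchE mem_set.
(* Here the whole space is null, and every property holds almost everywhere. *)
exists setT; split => //.
by apply/eqP; rewrite eq_le measure_ge0 andbT leNgt.
Qed.

Lemma right_box_gt0 (x : 'rV[R]_d) (e : R) : 0 < e ->
  (0 < lebesgue_rV R d
    [set y : 'rV[R]_d | forall i, `[x ord0 i, (x ord0 i + e)%R[%classic (y ord0 i)])%E.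
Proof.
move=> e0; rewrite (lebesgue_rV_box (A := fun i => `[x ord0 i, (x ord0 i + e)%R[%classic))//.
apply: (big_ind (fun y : \bar R => (0 < y)%E)) => //; first exact: mule_gt0.
by move=> i _; rewrite lebesgue_measure_itv/= lte_fin ltrDl e0 -EFinD addrAC subrr add0r.
Qed.

(** Right boxes x + [0, e)^d replace balls: at a point of the cell with a zero coordinate no ball
    fits into [0, 1)^d, while a small right box does. *)
Lemma carrier_right_box (x : 'rV[R]_d) (P : set 'rV[R]_d) : wf_base w ->
  carrier w x -> nbhs x P -> exists2 e : R, 0 < e &
  [set y : 'rV[R]_d | forall i, `[x ord0 i, (x ord0 i + e)%R[%classic (y ord0 i)] `<=`
    carrier w `&` P.
Proof.
move=> hw Cx nP.
have [e1 e10 He1] : exists2 e : R, 0 < e &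
    [set y : 'rV[R]_d | forall i, `[x ord0 i, (x ord0 i + e)%R[%classic (y ord0 i)] `<=` carrier w.
  case: w hw Cx => [om [oom _] omx|_ Cx].
    have /nbhs_ballP[e /= e0 eB] : nbhs x om by exact: open_nbhs_nbhs.
    exists e => // y Hy; apply: eB; apply/ball_rV => // i.
    have := Hy i; rewrite /= in_itv/= => /andP[h1 h2].
    by rewrite ltr_norml; apply/andP; split; lra.
  pose e := \big[Num.min/1]_(i < d) (1 - x ord0 i).
  exists e.
    rewrite /e; apply: (big_ind (fun y => 0 < y)) => // [y z y0 z0|i _].
      by rewrite lt_min y0.
    by have /andP[_ x1] := Cx i; rewrite subr_gt0.
  move=> y Hy i; have := Hy i; rewrite /= in_itv/= => /andP[h1 h2].
  have /andP[x0 x1] := Cx i; rewrite (le_trans x0)//= (lt_le_trans h2)//.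
  rewrite -lerBrDl /e; exact: bigmin_le_cond.
have /nbhs_ballP[e2 /= e20 eB] := nP.
exists (Num.min e1 e2); first by rewrite lt_min e10.
move=> y Hy; split.
  apply: He1 => i; have := Hy i; rewrite /= !in_itv/= => /andP[h1 h2].
  by rewrite h1 (lt_le_trans h2)// lerD2l ge_min lexx.
apply: eB; apply/ball_rV => // i.
have := Hy i; rewrite /= in_itv/= => /andP[h1 h2].
have : Num.min e1 e2 <= e2 by rewrite ge_min lexx orbT.
by move=> h3; rewrite ltr_norml; apply/andP; split; lra.
Qed.

(** If the bound failed at [x], continuity would make it fail on a right box, which has positive
    measure. The bound is wanted at every point because it is integrated against the Jordan parts of
    [nu]. *)
Lemma Linfty_pointwise f (c : R) : wf_base w -> continuous_on w f ->
  measurable_fun (carrier w) f -> (Linfty_norm w f <= c%:E)%E ->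
  forall x, carrier w x -> `|f x| <= c.
Proof.
move=> hw cf mf /Linfty_ae [N [mN N0 subN]] x Cx; rewrite leNgt; apply/negP => cx.
have cfx : {for x, continuous f}.
  move: cf Cx hw; case: (w) => [om|] /= cf; last by move=> _ _; exact: cf.
  move=> omx [oom _].
  by move: cf; rewrite continuous_open_subspace// => cf; apply: cf; rewrite inE.
have nP : nbhs x [set y | c < `|f y|].
  have : {for x, continuous (fun y => `|f y|)}.
    by apply: continuous_comp => //; exact: norm_continuous.
  by move=> /cvgr_gt; exact.
have [e e0 HB] := carrier_right_box hw Cx nP.
have := right_box_gt0 x e0; rewrite ltNge -N0; apply/negP; rewrite negbK.
set B := [set y | _].
have mB : measurable B.
  exact: (@measurable_rV_forall _ _ (fun i => `[x ord0 i, (x ord0 i + e)%R[%classic)).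
apply: le_measure; rewrite ?inE// => y /HB[Cy cy]; apply: subN => /= /(_ Cy).
by rewrite leNgt cy.
Qed.

Lemma Linfty_integrable f : wf_base w -> Linfty w f ->
  (lebesgue_rV R d).-integrable (carrier w) (EFin \o f).
Proof.
move=> hw [_ mf fy].
have mC := measurable_carrier hw.
have fge0 : (0 <= Linfty_norm w f)%E by exact: Lnorm_ge0.
have ffin : Linfty_norm w f \is a fin_num by rewrite ge0_fin_numE.
apply/integrableP; split; first exact/measurable_EFinP.
have := @Linfty_ae f (fine (Linfty_norm w f)); rewrite fineK// => /(_ (lexx _)) Hae.
apply: (@le_lt_trans _ _ (Linfty_norm w f * lebesgue_rV R d (carrier w))%E).
  apply: integral_le_bound => //; first exact/measurable_EFinP.
  by apply: filterS Hae => x Hx /Hx; rewrite -lee_fin fineK.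
by rewrite lte_mul_pinfty//; exact: carrier_lty.
Qed.

End essential_bounds.

(** * Integrals over slabs of functions on the base *)

Section base_integral.
Context {R : realType} {d : nat}.

(** Tonelli for integrands that are integrable but not known to be bounded, unlike in
    [Rintegral_slab]. The indicator in [h] makes the vertical integral of a constant [r] equal to
    [r]. *)
Lemma vol_base_integral (E0 : set 'rV[R]_d) (s : 'rV[R]_d -> R) : measurable E0 ->
  (lebesgue_rV R d).-integrable E0 (EFin \o s) ->
  vol.-integrable (E0 `*` `]0%R, 1%R[%classic) (EFin \o (fun p => s p.1)) /\
  \int[vol]_(p in E0 `*` `]0, 1[%classic) s p.1 = \int[lebesgue_rV R d]_(x in E0) s x.
Proof.
move=> mE0 iS; have ms : measurable_fun E0 s by apply/measurable_EFinP; exact: measurable_int iS.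
set D := E0 `*` `]0%R, 1%R[%classic.
have mD : measurable (D : set (spacetime R d)) by exact: measurable_slab.
pose h (r : R) (y : measurableTypeR R) : R := r * \1_`]0%R, 1%R[%classic y.
pose f (p : spacetime R d) : \bar R := (h (s \_ E0 p.1) p.2)%:E.
have ms0 : measurable_fun setT (s \_ E0) by exact/(measurable_restrictT _ _).1.
have fE : f = (EFin \o (fun p : spacetime R d => s p.1)) \_ D.
  apply/funext => p; rewrite /f /h !patchE in_setX indicE -[point]/(0 : R) -[point]/(0%:E).
  by case: (p.1 \in E0); case: (p.2 \in _); rewrite /= ?mulr1 ?mulr0 ?mul0r.
have mf : measurable_fun setT f.
  apply/measurable_EFinP; apply: measurable_funM; first exact: measurableT_comp.
  by apply: measurableT_comp => //; exact: measurable_indic.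
have in2 (r : R) : (\int[lebesgue_measure]_y (h r y)%:E = r%:E)%E.
  rewrite /h.
  under eq_integral do rewrite EFinM.
  rewrite integralZl//; last first.
    apply/integrableP; split; first by apply/measurable_EFinP; exact: measurable_indic.
    under eq_integral do rewrite /= ger0_norm//.
    by rewrite integral_indic// setIT; exact: lebesgue01_lty.
  rewrite integral_indic// setIT.
  by rewrite [X in (_ * X)%E](_ : _ = 1%E) ?mule1//; exact: lebesgue_measure01.
have iT : vol.-integrable setT f.
  apply/integrable12ltyP => //.
  have -> : (\int[lebesgue_rV R d]_x \int[lebesgue_measure]_y `|f (x, y)| =
             \int[lebesgue_rV R d]_x `|(s \_ E0 x)%:E|)%E.
    apply: eq_integral => x _; rewrite -[RHS]in2; apply: eq_integral => y _.
    by rewrite /f /h /= normrM (@ger0_norm _ (\1__ _)).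
  have /(integrable_mkcond _ mE0).1 := iS.
  by rewrite restrict_EFin => /integrableP[].
split; first by apply/(integrable_mkcond _ mD).2; rewrite -fE.
rewrite {1}/Rintegral integral_mkcond -fE -integral12_prod_meas1//.
rewrite Rintegral_mkcond; congr fine; apply: eq_integral => x _.
by rewrite -[RHS](in2 ((s \_ E0) x)).
Qed.

End base_integral.

(** * Bathtub principle with its equality case *)

Section bathtub.
Context {R : realType} d (T : measurableType d) (mu : {measure set T -> \bar R}).
Variables (D : set T) (u : T -> R) (E : set T).
Hypotheses (mD : measurable D) (iu : mu.-integrable D (EFin \o u))
  (mE : measurable E) (ED : E `<=` D).

Let N := D `&` [set x | u x < 0].
Let mu' : measurable_fun D u.
Proof. by apply/measurable_EFinP; exact: measurable_int iu. Qed.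

Lemma measurable_sublevel : measurable N.
Proof.
rewrite /N (_ : _ `&` _ = D `&` u @^-1` `]-oo, 0[); first exact: mu'.
by apply/seteqP; split=> x /=; rewrite in_itv.
Qed.

(** The function [dd] is the positive part of [u] on [E] and the negative part off [E]: it is
    nonnegative, and nonzero exactly on the displayed set. *)
Lemma bathtub : \int[mu]_(x in N) u x <= \int[mu]_(x in E) u x /\
  (\int[mu]_(x in E) u x = \int[mu]_(x in N) u x <->
   mu.-negligible ((E `&` [set x | 0 < u x]) `|` (N `\` E))).
Proof.
have mN := measurable_sublevel.
have ND : N `<=` D by move=> x [].
have iC C : measurable C -> C `<=` D -> mu.-integrable D (EFin \o (u \_ C)).
  move=> mC CD; rewrite -restrict_EFin; apply: (integrableS measurableT) => //.
  by apply/(integrable_mkcond _ mC).1; apply: integrableS iu.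
have intE C : C `<=` D -> \int[mu]_(x in C) u x = \int[mu]_(x in D) (u \_ C) x.
  by move=> CD; rewrite -Rintegral_mkcondr (setIidr CD).
pose dd x := (u \_ E) x - (u \_ N) x.
have xN x : D x -> (x \in N) = (u x < 0).
  by move=> Dx; apply/idP/idP; rewrite inE; [move=> []|].
have ddE x : D x -> dd x = if x \in E then (if u x < 0 then 0 else u x)
                           else (if u x < 0 then - u x else 0).
  move=> Dx; rewrite /dd !patchE xN//.
  by case: (x \in E); case: (u x < 0); rewrite ?subrr ?subr0 ?sub0r.
have dd0 x : D x -> 0 <= dd x.
  move=> Dx; rewrite ddE//; case: (x \in E); case: ltP => // h.
  by rewrite oppr_ge0 ltW.
have idd : mu.-integrable D (EFin \o dd).
  exact: (integrableB mD (iC _ mE ED) (iC _ mN ND)).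
have Idd : \int[mu]_(x in D) dd x = \int[mu]_(x in E) u x - \int[mu]_(x in N) u x.
  by rewrite /dd RintegralB//; [rewrite !intE|exact: iC|exact: iC].
have setE : (E `&` [set x | 0 < u x]) `|` (N `\` E) = D `&` [set x | dd x != 0].
  apply/seteqP; split=> x.
    move=> [[Ex /= u0]|[[Dx /= u0] nE]]; split; rewrite /= ?ddE//; try exact: ED.
    - by rewrite mem_set// ltNge (ltW u0)/= gt_eqF.
    - by rewrite memNset// u0 oppr_eq0 lt_eqF.
  move=> [Dx /=]; rewrite ddE//; case: ifPn => xE; rewrite ?inE in xE; case: ltP => u0 //.
  - by rewrite eqxx.
  - by move=> un0; left; split=> //=; rewrite lt_def un0.
  - move=> _; right; split=> // Ex.
    by move/negP : xE; apply; rewrite inE.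
  - by rewrite eqxx.
split; first by rewrite -subr_ge0 -Idd; apply: Rintegral_ge0.
split=> [H|].
  apply/negligibleP.
    rewrite setE (_ : _ `&` _ = D `&` [set x | (EFin \o dd) x != 0%E]); last first.
      by apply/seteqP; split=> x [Dx /=]; rewrite eqe.
    by apply: emeasurable_neq => //; exact: measurable_int idd.
  rewrite setE; apply: Rintegral_eq0 => //.
  by rewrite Idd H subrr.
rewrite setE => -[Z [mZ Z0 sZ]]; apply/eqP; rewrite -subr_eq0 -Idd; apply/eqP.
rewrite /Rintegral (ae_eq_integral (cst 0%E))//.
- by rewrite integral_cst// mul0e.
- exact: measurable_int idd.
- exists Z; split=> // x /= /not_implyP[Dx nz]; apply: sZ; split=> //=.
  by apply/eqP => z; apply: nz; rewrite /= z.
Qed.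

End bathtub.

(** * Null sets in the base and in the cylinder *)

Section negligible_slabs.
Context {R : realType} {d : nat}.
Local Notation leb := (lebesgue_rV R d).
Local Notation slab A := (A `*` `]0%R, 1%R[%classic).

Lemma negligible_slab (Z : set 'rV[R]_d) :
  leb.-negligible Z -> vol.-negligible (slab Z).
Proof.
move=> [Y [mY Y0 ZY]]; exists (slab Y); split; first exact: measurable_slab.
  by rewrite volX.
by move=> p [/ZY].
Qed.

Lemma slab_negligible (Z : set 'rV[R]_d) : measurable Z ->
  vol.-negligible (slab Z) -> leb.-negligible Z.
Proof.
move=> mZ nZ; apply/negligibleP => //; rewrite -[LHS](volX mZ).
by apply/negligibleP => //; exact: measurable_slab.
Qed.

Lemma hyperplane_null (i : 'I_d) (l : R) :
  leb [set x : 'rV[R]_d | x ord0 i = l] = 0%E.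
Proof.
pose A (j : 'I_d) : set R := if j == i then [set l] else setT.
have mA j : measurable (A j) by rewrite /A; case: ifP.
have -> : [set x : 'rV[R]_d | x ord0 i = l] =
    [set x : 'rV[R]_d | forall j, A j (x ord0 j)].
  apply/seteqP; split=> x /= xl; last by have := xl i; rewrite /A eqxx.
  by move=> j; rewrite /A; case: eqP => // ->.
rewrite lebesgue_rV_box// (bigD1 i)//= {1}/A eqxx.
by rewrite lebesgue_measure_set1 mul0e.
Qed.

End negligible_slabs.

(** * Sets of prescribed weight between two given sets *)

Section weighted_interpolation.
Context {R : realType} {d : nat} (i : 'I_d).
Local Notation leb := (lebesgue_rV R d).
Variables (A B : set 'rV[R]_d) (g : 'rV[R]_d -> R) (a : R).
Hypotheses (mA : measurable A) (mB : measurable B) (AB : A `<=` B)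
  (ig : leb.-integrable B (EFin \o g)) (g0 : forall x, B x -> 0 <= g x)
  (gA : \int[leb]_(x in A) g x <= a) (gB : a <= \int[leb]_(x in B) g x).

(* Lebesgue measure has no atoms: sweep B \ A by a half-space. *)
Lemma intermediate_set : exists E0, [/\ measurable E0, A `<=` E0, E0 `<=` B &
  \int[leb]_(x in E0) g x = a].
Proof.
pose D := B `\` A.
have mD : measurable D by exact: measurableD.
have iD : leb.-integrable D (EFin \o g).
  by apply: integrableS ig => // x [].
have gU (C : set 'rV[R]_d) : measurable C -> C `<=` D ->
    \int[leb]_(x in A `|` C) g x = \int[leb]_(x in A) g x + \int[leb]_(x in C) g x.
  move=> mC CD; apply: Rintegral_setU => //.
    apply: integrableS ig => //; first exact: measurableU.
    by move=> x [/AB//|/CD[]].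
  by apply/eqP/seteqP; split=> x // [Ax /CD[_]].
have BE : A `|` D = B.
  apply/seteqP; split=> x; first by move=> [/AB//|[]].
  by move=> Bx; have [Ax|nAx] := pselect (A x); [left|right].
(* [threshold] needs strict inequalities, so the two extreme values of [a] are settled by [A] and
   [B] themselves. *)
have [aA|aA] := eqVneq a (\int[leb]_(x in A) g x); first by exists A; split.
have [aB|aB] := eqVneq a (\int[leb]_(x in B) g x); first by exists B; split.
have gBE : \int[leb]_(x in B) g x = \int[leb]_(x in A) g x + \int[leb]_(x in D) g x.
  by rewrite -[in LHS]BE gU.
pose a' := a - \int[leb]_(x in A) g x.
have a'0 : 0 < a' by rewrite subr_gt0 lt_neqAle eq_sym aA gA.
have a'1 : a' < \int[leb]_(x in D) g x.
  by rewrite ltrBlDl -gBE lt_neqAle aB gB.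
have g0D x : D x -> 0 <= g x by move=> [/g0].
have mv : measurable_fun D (fun x : 'rV[R]_d => x ord0 i).
  by apply: measurable_funTS; exact: measurable_rowvec_coord.
have := threshold mD iD g0D mv a'0 a'1.
cbv zeta; set l := sup _ => -[h1 h2].
pose C := D `&` [set x : 'rV[R]_d | x ord0 i < l].
have mC : measurable C.
  rewrite /C (_ : _ `&` _ = D `&` (fun x : 'rV[R]_d => x ord0 i) @^-1` `]-oo, l[).
    exact: mv.
  by apply/seteqP; split=> x /=; rewrite in_itv.
have mCl : measurable (D `&` [set x : 'rV[R]_d | x ord0 i <= l]).
  rewrite (_ : _ `&` _ = D `&` (fun x : 'rV[R]_d => x ord0 i) @^-1` `]-oo, l]).
    exact: mv.
  by apply/seteqP; split=> x /=; rewrite in_itv.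
exists (A `|` C); split.
- exact: measurableU.
- by move=> x; left.
- by move=> x [/AB//|[[]]].
rewrite gU//; last by move=> x [].
suff -> : \int[leb]_(x in C) g x = a' by rewrite addrC subrK.
apply/eqP; rewrite eq_le h1/=; apply: le_trans h2 _.
rewrite le_eqVlt; apply/orP; left; apply/eqP.
(* The strict and the large sublevel set differ by a piece of the hyperplane x_i = l, which is
   null. *)
apply: (Rintegral_ae_eqset mD mCl mC); [by move=> x []|by move=> x []| |].
  by apply/measurable_EFinP; exact: measurable_int iD.
split.
  exists [set x : 'rV[R]_d | x ord0 i = l]; split.
  - rewrite (_ : [set x | _] = setT `&` (fun x : 'rV[R]_d => x ord0 i) @^-1` [set l]).
      by apply: (measurable_rowvec_coord i) => //; exact: measurable_set1.
    by rewrite setTI.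
  - exact: hyperplane_null.
  - move=> x [[Dx /= xl] nC]; apply/eqP; rewrite eq_le xl/= leNgt.
    by apply/negP => lx; apply: nC.
rewrite /ae_subset (_ : _ `\` _ = set0); first exact: negligible_set0.
by apply/seteqP; split=> x // [[Dx /= xl] []]; split=> //=; exact: ltW.
Qed.

End weighted_interpolation.

(** * Energy bounds and characterisation of the minimisers *)

Section wetting_energy.
Context {R : realType} {d : nat} (i : 'I_d) (w : base R d).
Hypothesis hw : wf_base w.
Local Notation leb := (lebesgue_rV R d).
Local Notation slab A := (A `*` `]0%R, 1%R[%classic).
Variables (g s0 s1 : 'rV[R]_d -> R) (c a lam : R).
Hypotheses (ig : leb.-integrable (carrier w) (EFin \o g))
  (is0 : leb.-integrable (carrier w) (EFin \o s0))
  (is1 : leb.-integrable (carrier w) (EFin \o s1)).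
Hypotheses (g0 : forall x, carrier w x -> 0 <= g x) (c1 : c < 1)
  (s0c : forall x, carrier w x -> `|s0 x| <= c)
  (s1c : forall x, carrier w x -> `|s1 x| <= c).

(** The calibrated density after subtraction of the multiplier. Its negative set over the cylinder
    is the slab over [A], the optimal set of the bathtub principle; [lam] may be any number for
    which [A] and [B] bracket the mass [a]. *)
Let u (x : 'rV[R]_d) : R := s0 x + s1 x - lam * g x.
Let U (p : spacetime R d) : R := u p.1.
Let A := carrier w `&` [set x : 'rV[R]_d | s0 x + s1 x < lam * g x].
Let B := carrier w `&` [set x : 'rV[R]_d | s0 x + s1 x <= lam * g x].
Let N := cylinder w `&` [set p : spacetime R d | U p < 0].

Hypotheses (gA : \int[leb]_(x in A) g x <= a) (gB : a <= \int[leb]_(x in B) g x).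

Let energy (nu : {charge set (spacetime R d) -> \bar R}) : R :=
  fine (charge_abs nu (cylinder w)) +
  charge_integral nu (cyl_boundary w) (wetting w s0 s1).

Let mC : measurable (carrier w). Proof. exact: measurable_carrier. Qed.
Let mW : measurable (cylinder w). Proof. exact: measurable_cylinder. Qed.

Let measurable_of_integrable (f : 'rV[R]_d -> R) :
  leb.-integrable (carrier w) (EFin \o f) -> measurable_fun (carrier w) f.
Proof. by move=> fi; apply/measurable_EFinP; exact: measurable_int fi. Qed.

Let ms0 := measurable_of_integrable is0.
Let ms1 := measurable_of_integrable is1.

Let iu : leb.-integrable (carrier w) (EFin \o u).
Proof.
have -> : EFin \o u =
    (fun x => (EFin \o s0) x + (EFin \o s1) x - (lam%:E * (EFin \o g) x))%E.
  by apply/funext.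
apply: integrableB => //; first exact: integrableD.
exact: integrableZl.
Qed.

Let iU : vol.-integrable (cylinder w) (EFin \o U).
Proof. by have [] := vol_base_integral mC iu. Qed.

Let mG : measurable_fun (cylinder w) (fun p => g p.1).
Proof.
have [iG _] := vol_base_integral mC ig.
by apply/measurable_EFinP; exact: measurable_int iG.
Qed.

Let mA : measurable A.
Proof.
rewrite (_ : A = carrier w `&` [set x | u x < 0]); first exact: measurable_sublevel iu.
by apply/seteqP; split=> x [Cx] /=; rewrite /u subr_lt0.
Qed.

Let mB : measurable B.
Proof.
rewrite (_ : B = carrier w `&` u @^-1` `]-oo, 0]).
  by apply: (measurable_of_integrable iu).
by apply/seteqP; split=> x [Cx] /=; rewrite /u in_itv/= subr_le0.
Qed.

Let NE : N = slab A.
Proof.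
apply/seteqP; split=> p.
  by move=> [[Cp p01]]; rewrite /= /U /u subr_lt0.
by move=> [[Cp /= up] p01]; split=> //=; rewrite /U /u subr_lt0.
Qed.

Lemma F0_some E : F0_domain w g a E -> (exists nu, is_tderiv w E nu) ->
  exists2 nu, is_tderiv w E nu & F0 w g s0 s1 a E = (energy nu)%:E.
Proof.
rewrite /F0 /tderiv => DE ex; case: asboolP => // _; case: pselect => // ex'.
exists (sval (cid ex')); first exact: svalP (cid ex').
have [_ vf] := charge_abs_fin (sval (cid ex')) mW.
by rewrite /energy [in RHS]EFinD [in RHS]fineK.
Qed.

(** The value +oo covers both a failed constraint and the absence of a representing charge; in the
    remaining case [nu] is whichever charge [tderiv] chose. *)
Lemma F0_cases E : F0 w g s0 s1 a E = +oo%E \/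
  exists nu, [/\ F0_domain w g a E, is_tderiv w E nu &
    F0 w g s0 s1 a E = (energy nu)%:E].
Proof.
have [DE|nDE] := pselect (F0_domain w g a E); last first.
  by left; rewrite /F0; case: asboolP.
have [ex|nex] := pselect (exists nu, is_tderiv w E nu); last first.
  by left; rewrite /F0 /tderiv; case: asboolP => // _; case: pselect.
by right; have [nu] := F0_some DE ex; exists nu.
Qed.

(** The minimum of [F0]: the bathtub minimum plus the multiplier term fixed by the mass
    constraint. *)
Let K := lam * a + \int[vol]_(p in N) U p.

Section competitor.
Variable E : set (spacetime R d).
Hypotheses (mE : measurable E) (Ew : E `<=` cylinder w).

Lemma energy_split : \int[vol]_(p in E) g p.1 = a ->
  \int[vol]_(p in E) (s0 p.1 + s1 p.1) = lam * a + \int[vol]_(p in E) U p.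
Proof.
move=> <-; have [iG _] := vol_base_integral mC ig.
have iG' := integrableS mW mE Ew iG; have iU' := integrableS mW mE Ew iU.
rewrite -RintegralZl// -RintegralD//.
  by apply: eq_Rintegral => p _; rewrite /U /u [RHS]addrC subrK.
exact: (integrableZl mE lam iG').
Qed.

Lemma energy_lower nu : F0_domain w g a E -> is_tderiv w E nu ->
  K + (\int[vol]_(p in E) U p - \int[vol]_(p in N) U p) +
  (1 - Num.max c 0) * fine (charge_abs nu (cylinder w)) <= energy nu.
Proof.
move=> [_ _ _ Ea] hnu.
have := calibrated_bound hw mE Ew hnu ms0 ms1 s0c s1c.
rewrite energy_split// => h; apply: le_trans h.
by rewrite /K; lra.
Qed.

Let bath := bathtub mW iU mE Ew.

Lemma F0_ge : (K%:E <= F0 w g s0 s1 a E)%E.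
Proof.
have [->|[nu [DE hnu ->]]] := F0_cases E; first exact: leey.
rewrite lee_fin; apply: le_trans (energy_lower DE hnu).
have [v0 _] := charge_abs_fin nu mW.
rewrite -addrA lerDl addr_ge0//; first by rewrite subr_ge0 bath.1.
by rewrite mulr_ge0 ?fine_ge0// subr_ge0 ge_max ltW//= ler01.
Qed.

(** The two terms added to [K] in [energy_lower] are nonnegative, so both vanish: since
    [1 - Num.max c 0 > 0] the variation is zero, and the equality case of the bathtub principle
    encloses [E] between two slabs. [slab_negligible] carries null differences down to the base. *)
Lemma F0_le_product : (F0 w g s0 s1 a E <= K%:E)%E ->
  exists E0 : set 'rV[R]_d,
    [/\ measurable E0, E0 `<=` carrier w, ae_subset leb A E0, ae_subset leb E0 B &
        \int[leb]_(x in E0) g x = a /\ ae_eqset vol E (slab E0)].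
Proof.
have [->//|[nu [DE hnu ->]]] := F0_cases E; rewrite lee_fin => EK.
have [v0 vf] := charge_abs_fin nu mW.
have lower := energy_lower DE hnu.
have m1 : 0 < 1 - Num.max c 0 by rewrite subr_gt0 gt_max c1 ltr01.
have V0 := fine_ge0 v0.
have mV0 := mulr_ge0 (ltW m1) V0.
have NU := bath.1.
have v00 : charge_abs nu (cylinder w) = 0%E.
  apply/eqP; rewrite -(fineK vf) eqe -(mulrI_eq0 _ (lregP (lt0r_neq0 m1))).
  by rewrite eq_le mV0 andbT; lra.
have /bath.2 nEN : \int[vol]_(p in E) U p = \int[vol]_(p in N) U p.
  by apply/eqP; rewrite eq_le NU andbT; lra.
have [E0 [mE0 E0w EE0]] := zero_variation_cylinder hw mE Ew hnu v00.
have [EE1 EE2] := EE0.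
have [_ _ _ Ea] := DE.
exists E0; split=> //.
- apply: slab_negligible; first exact: measurableD.
  apply: (negligibleS _ (negligibleU nEN EE1)) => p [[Ap nE0p] p01].
  (* A point of the slab over [A] but not over [E0] lies, if in [E], where [E] leaves the slab over
     [E0], and otherwise in [N] outside [E]; both sets are null. *)
  have [Ep|nEp] := pselect (E p); [right; split=> // -[]//|left; right].
  by have Np : N p by rewrite NE.
- apply: slab_negligible; first exact: measurableD.
  apply: (negligibleS _ (negligibleU nEN EE2)) => p [[E0p nBp] p01].
  have [Ep|nEp] := pselect (E p); [left; left|by right].
  split=> //=; rewrite ltNge; apply/negP => Up; apply: nBp; split=> /=.
    exact: E0w.
  by move: Up; rewrite /U /u subr_le0.
split=> //.
have iE0 : leb.-integrable E0 (EFin \o g) by exact: integrableS ig.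
have [_ <-] := vol_base_integral mE0 iE0.
rewrite -(Rintegral_slab_ae hw mE0 E0w mE Ew EE0 (f := fun p => g p.1))//.
Qed.

Variable E0 : set 'rV[R]_d.
Hypotheses (mE0 : measurable E0) (E0w : E0 `<=` carrier w)
  (AE0 : ae_subset leb A E0) (E0B : ae_subset leb E0 B)
  (E0a : \int[leb]_(x in E0) g x = a) (EE0 : ae_eqset vol E (slab E0)).

(** The lower bound is attained: the variation vanishes, so the calibration is exact, and [E]
    satisfies the equality case of the bathtub principle. *)
Lemma F0_product : F0 w g s0 s1 a E = K%:E.
Proof.
have iE0 : leb.-integrable E0 (EFin \o g) by exact: integrableS ig.
have Ea : \int[vol]_(p in E) g p.1 = a.
  have [_ sE0] := vol_base_integral mE0 iE0.
  rewrite (Rintegral_slab_ae hw mE0 E0w mE Ew EE0 (f := fun p => g p.1))//.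
  by rewrite sE0.
have DE : F0_domain w g a E.
  by split=> //; exact: (product_bounded_tvar hw mE0 E0w mE Ew EE0).
have [nu hnu ->] := F0_some DE (product_is_tderiv hw mE0 E0w mE Ew EE0).
have v0 := product_zero_variation hw mE0 E0w mE Ew EE0 hnu.
rewrite /energy (calibrated_eq hw mE Ew hnu ms0 ms1 s0c s1c v0) v0 add0r.
rewrite energy_split//; congr (_ + _)%:E; apply/bath.2.
have [EE1 EE2] := EE0.
apply: (negligibleS _ (negligibleU (negligibleU EE1 EE2)
  (negligibleU (negligible_slab AE0) (negligible_slab E0B)))) => p [[Ep Up]|[]].
  have [Cp p01] := Ew Ep.
  have [E0p|nE0p] := pselect (E0 p.1); last by left; left; split=> // -[].
  right; right; split=> //; split=> // -[_ /=].
  by rewrite -subr_le0 leNgt -/(u p.1) Up.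
rewrite -/N NE => -[Ap p01] nEp.
have [E0p|nE0p] := pselect (E0 p.1); first by left; right.
by right; left.
Qed.

End competitor.

Lemma F0_minimiserP E : measurable E -> E `<=` cylinder w ->
  F0_minimiser w g s0 s1 a E <->
  exists E0 : set 'rV[R]_d,
    [/\ measurable E0, E0 `<=` carrier w, ae_subset leb A E0, ae_subset leb E0 B &
        \int[leb]_(x in E0) g x = a /\ ae_eqset vol E (slab E0)].
Proof.
move=> mE Ew; split=> [[_ _ minE]|[E0 [mE0 E0w AE0 E0B [E0a EE0]]]]; last first.
  split=> // E' mE' E'w.
  by rewrite (F0_product mE Ew mE0 E0w AE0 E0B E0a EE0); exact: F0_ge.
apply: F0_le_product => //.
(* A competitor of energy exactly [K] is built: the slab over a set between [A] and [B] of mass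
   [a]. *)
have BC : B `<=` carrier w by move=> x [].
have AB : A `<=` B by move=> x [Cx /ltW].
have iB : leb.-integrable B (EFin \o g) by exact: integrableS ig.
have g0B x : B x -> 0 <= g x by move=> /BC/g0.
have [E0 [mE0 AE0 E0B E0a]] := intermediate_set i mA mB AB iB g0B gA gB.
have E0w := subset_trans E0B BC.
have mS := measurable_slab mE0.
have sub0 (S T : set 'rV[R]_d) : S `<=` T -> ae_subset leb S T.
  by rewrite -setD_eq0 /ae_subset => ->; exact: negligible_set0.
rewrite -(F0_product mS (slab_cylinder E0w) mE0 E0w (sub0 _ _ AE0) (sub0 _ _ E0B) E0a).
  by apply: minE => //; exact: slab_cylinder.
by split; rewrite /ae_subset setDv; exact: negligible_set0.
Qed.

End wetting_energy.

Theorem proposition2p2 (R : realType) (d : nat) (hd : (0 < d)%N)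
    (w : base R d) (hw : wf_base w)
    (h0 h1 : 'rV[R]_d -> R)
    (hh0 : W1infty w h0) (hh1 : W1infty w h1)
    (h0_mean : \int[lebesgue_rV R d]_(x in carrier w) h0 x = 0)
    (h1_mean : \int[lebesgue_rV R d]_(x in carrier w) h1 x = 0)
    (z : R) (hz : 0 < z)
    (hgap : forall x, carrier w x -> 0 < gap z h0 h1 x)
    (sigma0 sigma1 : 'rV[R]_d -> R)
    (hs0 : Linfty w sigma0) (hs1 : Linfty w sigma1)
    (cs0 : continuous_on w sigma0) (cs1 : continuous_on w sigma1)
    (ns0 : (Linfty_norm w sigma0 < 1)%E) (ns1 : (Linfty_norm w sigma1 < 1)%E)
    (a : R) (ha0 : 0 < a)
    (ha1 : (a%:E < z%:E * lebesgue_rV R d (carrier w))%E) :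
  let g := gap z h0 h1 in
  let sigmabar := fun x => sigma0 x + sigma1 x in
  let lam := lambda_star w g sigmabar a in
  forall E : set (spacetime R d), measurable E -> E `<=` cylinder w ->
    F0_minimiser w g sigma0 sigma1 a E <->
    exists E0 : set 'rV[R]_d,
      [/\ measurable E0, E0 `<=` carrier w,
          ae_subset (lebesgue_rV R d)
            (carrier w `&` [set x | sigmabar x < lam * g x]) E0,
          ae_subset (lebesgue_rV R d)
            E0 (carrier w `&` [set x | sigmabar x <= lam * g x]) &
          \int[lebesgue_rV R d]_(x in E0) g x = a /\
          ae_eqset vol E (E0 `*` `]0, 1[)].
Proof.
move=> g sb lam E mE Ew.
have mC := measurable_carrier hw.
have cfin := carrier_lty hw.
have ih0 := Linfty_integrable hw hh0.1; have ih1 := Linfty_integrable hw hh1.1.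
have is0 := Linfty_integrable hw hs0; have is1 := Linfty_integrable hw hs1.
have iz : (lebesgue_rV R d).-integrable (carrier w) (EFin \o cst z).
  exact: (@bounded_integrable _ _ _ _ _ _ `|z|).
have izh : (lebesgue_rV R d).-integrable (carrier w) (EFin \o (fun x => z + h1 x)).
  rewrite (_ : _ \o _ = (fun x => (EFin \o cst z) x + (EFin \o h1) x)%E)//.
  exact: integrableD.
have ig : (lebesgue_rV R d).-integrable (carrier w) (EFin \o g).
  rewrite (_ : _ \o _ =
    (fun x => (EFin \o (fun x => z + h1 x)%R) x - (EFin \o h0) x)%E)//.
  exact: integrableB.
(* The means of [h0] and [h1] vanish, so [g] has integral z times the measure of the base, and [ha1]
   is the strict upper bound asked by [threshold]. *)
have gC : a < \int[lebesgue_rV R d]_(x in carrier w) g x.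
  rewrite /g /gap RintegralB// RintegralD// h0_mean h1_mean subr0 addr0.
  rewrite Rintegral_cst//.
  have cf : lebesgue_rV R d (carrier w) \is a fin_num by rewrite ge0_fin_numE.
  by rewrite -lte_fin EFinM fineK.
have mof f : (lebesgue_rV R d).-integrable (carrier w) (EFin \o f) ->
    measurable_fun (carrier w) f.
  by move=> fi; apply/measurable_EFinP; exact: measurable_int fi.
have g0 x : carrier w x -> 0 <= g x by move=> /hgap/ltW.
(* [lambda_star] is the threshold of the ratio sigmabar / g: as [g > 0] on the carrier, sigmabar < l
   g is a sublevel condition on it, and the power -1 is the inverse there. *)
have mv : measurable_fun (carrier w) (fun x => sb x * g x `^ (-1)).
  apply: measurable_funM; first by apply: measurable_funD; exact: mof.
  by apply: (measurableT_comp (measurable_powR (-1))); exact: mof.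
have vE l x : carrier w x -> (sb x * g x `^ (-1) < l) = (sb x < l * g x).
  by move=> Cx; rewrite powR_inv1 ?g0// ltr_pdivrMr// hgap.
have vE' l x : carrier w x -> (sb x * g x `^ (-1) <= l) = (sb x <= l * g x).
  by move=> Cx; rewrite powR_inv1 ?g0// ler_pdivrMr// hgap.
have lE l : carrier w `&` [set x | sb x * g x `^ (-1) < l] =
    carrier w `&` [set x : 'rV[R]_d | sb x < l * g x].
  by apply/seteqP; split=> x [Cx /=]; rewrite vE.
have lE' l : carrier w `&` [set x | sb x * g x `^ (-1) <= l] =
    carrier w `&` [set x : 'rV[R]_d | sb x <= l * g x].
  by apply/seteqP; split=> x [Cx /=]; rewrite vE'.
have := threshold mC ig g0 mv ha0 gC; cbv zeta; rewrite lE lE'.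
have -> : sup [set l | \int[lebesgue_rV R d]_(x in
    carrier w `&` [set x | sb x * g x `^ (-1) < l]) g x < a] = lam.
  by congr sup; apply/seteqP; split=> l /=; rewrite lE.
move=> [gA gB].
have cnorm f : (Linfty_norm w f < 1)%E ->
    exists2 c : R, (0 <= c < 1) & (Linfty_norm w f <= c%:E)%E.
  have f0 : (0 <= Linfty_norm w f)%E by exact: Lnorm_ge0.
  move=> f1; exists (fine (Linfty_norm w f)).
    rewrite fine_ge0//= -lte_fin fineK// ge0_fin_numE//.
    by apply: lt_trans f1 _; rewrite ltry.
  rewrite fineK// ge0_fin_numE//.
  by apply: lt_trans f1 _; rewrite ltry.
have [c0 /andP[_ c01] n0] := cnorm _ ns0.
have [c1 /andP[_ c11] n1] := cnorm _ ns1.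
have [_ ms0 _] := hs0; have [_ ms1 _] := hs1.
apply: (@F0_minimiserP _ _ (Ordinal hd) _ hw _ _ _ (Num.max c0 c1)) => //.
- by rewrite gt_max c01.
- move=> x Cx; rewrite le_max.
  by rewrite (Linfty_pointwise hw cs0 ms0 n0 Cx).
- move=> x Cx; rewrite le_max.
  by rewrite (Linfty_pointwise hw cs1 ms1 n1 Cx) orbT.
Qed.
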